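(* Let $d\in\{1,2,3,4\}$ and $N\in\{2,3\}$. For every $\rho\in H$, $$\lim_{\hbar\to 0^+} F^{\mathcal A}_\hbar(\rho)=C(\rho).$$
   Context: Wave functions are complex-valued functions $\psi((x_1,\alpha_1),\dots,(x_N,\alpha_N))$ on $(\mathbb{R}^d\times\mathbb{Z}_2)^N$, with $x_i\in\mathbb{R}^d$ and spin $\alpha_i\in\{0,1\}$. Write $z=(z_1,\dots,z_N)$, $z_i=(x_i,\alpha_i)$, and $\int f(z)\,dz:=\sum_{\alpha_1,\dots,\alpha_N\in\{0,1\}}\int_{\mathbb{R}^{dN}} f(x_1,\alpha_1;\dots;x_N,\alpha_N)\,dx_1\cdots dx_N$. $H^1((\mathbb{R}^d\times\mathbb{Z}_2)^N)$ is the set of such functions that are $H^1$ in $(x_1,\dots,x_N)$ for each choice of spins; $\nabla$ is the gradient in the space variables. $\mathcal A$ (fermionic wave functions) is the set of $\psi\in H^1((\mathbb{R}^d\times\mathbb{Z}_2)^N)$ with $\int|\psi|^2dz=1$ and $\psi(z_{\sigma(1)},\dots,z_{\sigma(N)})=\mathrm{sign}(\sigma)\,\psi(z_1,\dots,z_N)$ for all permutations $\sigma$ of $\{1,\dots,N\}$. For a wave function $\psi$, its density is $\rho_\psi(x)=\sum_{\alpha_1,\dots,\alpha_N\in\{0,1\}}\int_{\mathbb{R}^{d(N-1)}}|\psi|^2(x,\alpha_1;x_2,\alpha_2;\dots;x_N,\alpha_N)\,dx_2\cdots dx_N$; write $\psi\downarrow\rho$ if $\rho_\psi=\rho$. $T_\hbar(\psi)=\frac{\hbar^2}{2m}\int|\nabla\psi|^2(z)\,dz$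 with $m>0$ a fixed constant, and $V_{ee}(\psi)=\int\sum_{1\le i<j\le N}\frac{|\psi|^2(z)}{|x_i-x_j|}\,dz\in[0,+\infty]$. $H=\{\rho:\mathbb{R}^d\to\mathbb{R}\ :\ \rho\ge 0,\ \int\rho=1,\ \sqrt\rho\in H^1(\mathbb{R}^d)\}$. For $\rho\in H$ and $\hbar>0$: $F^{\mathcal A}_\hbar(\rho)=\inf\{T_\hbar(\psi)+V_{ee}(\psi):\psi\in\mathcal A,\ \psi\downarrow\rho\}$. $\Pi(\rho)$ is the set of Borel probability measures $P$ on $\mathbb{R}^{dN}$ all of whose $N$ marginals on $\mathbb{R}^d$ equal $\rho$ (that is, $\rho\,dx$), and $C(\rho)=\min_{P\in\Pi(\rho)}\int\sum_{1\le i<j\le N}\frac{1}{|x_i-x_j|}\,dP$, where $1/0=+\infty$. *)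

(* Defs.v *)
From HB Require Import structures.
From mathcomp Require Import all_boot all_order all_algebra all_fingroup.
From mathcomp Require Import complex.
From mathcomp Require Import all_classical all_reals all_analysis.
From mathcomp Require Import measurable_realfun.

Set Implicit Arguments.
Unset Strict Implicit.
Unset Printing Implicit Defensive.

Import Order.TTheory GRing.Theory Num.Theory.
Import numFieldNormedType.Exports.

Local Open Scope classical_set_scope.
Local Open Scope ring_scope.

(* Points of (R^n)^m are matrices 'M[R]_(m, n), whose rows are the points of
   R^n; in particular R^n itself is 'rV[R]_n. They carry the Borel sets of
   their topology. *)
Section borel_matrix.
Variables (R : realType) (m n : nat).

HB.instance Definition _ := @isMeasurable.Build
  (sigma_display (@open 'M[R]_(m, n))) 'M[R]_(m, n) <<s @open 'M[R]_(m, n) >>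
  (@sigma_algebra0 _ setT _) (@sigma_algebraC _ _)
  (@sigma_algebra_bigcup _ setT _).

End borel_matrix.

Lemma measurable_mx_coord (R : realType) m n (i : 'I_m) (j : 'I_n) :
  measurable_fun setT (fun M : 'M[R]_(m, n) => M i j).
Proof.
apply: (measurability _ (RGenOpens.measurableE R)) => _ [_ [a [b ->]] <-].
rewrite setTI; apply: sub_sigma_algebra.
apply: open_comp => [x _|]; last exact: interval_open.
exact: coord_continuous.
Qed.

Lemma measurable_fun_mx (R : realType) d (T : measurableType d) m n
    (f : T -> 'M[R]_(m, n)) :
  (forall i j, measurable_fun setT (fun x => f x i j)) -> measurable_fun setT f.
Proof.
move=> mf; apply: (@measurability _ _ _ _ _ _ (@open 'M[R]_(m, n))) => //.
move=> _ [U oU <-]; rewrite setTI.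
pose box (ab : 'M[rat]_(m, n) * 'M[rat]_(m, n)) : set 'M[R]_(m, n) :=
  [set M | forall i j, M i j \in `]ratr (ab.1 i j), ratr (ab.2 i j)[].
have mbox ab : measurable (f @^-1` box ab).
  have -> : f @^-1` box ab = \bigcap_(i in [set: 'I_m])
      \bigcap_(j in [set: 'I_n])
      (fun x => f x i j) @^-1` `]ratr (ab.1 i j), ratr (ab.2 i j)[.
    by apply/seteqP; split => [x fx i _ j _|x fx i j]; [exact: fx|exact: fx].
  apply: fin_bigcap_measurable => // i _.
  apply: fin_bigcap_measurable => // j _.
  by rewrite -[X in measurable X]setTI; exact: mf.
have -> : f @^-1` U = \bigcup_ab (if `[< box ab `<=` U >] then f @^-1` box ab
                                 else set0).
  apply/seteqP; split => [x Ufx|x [ab _]]; last first.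
    by case: asboolP => // + bx; exact.
  have /nbhs_ballP[e /= e0 xeU] : nbhs (f x) U by exact: open_nbhs_nbhs.
  have ex i j : exists ab : rat * rat,
      [/\ f x i j - e < ratr ab.1, ratr ab.1 < f x i j,
          f x i j < ratr ab.2 & ratr ab.2 < f x i j + e].
    have [|a] := @rat_in_itvoo R (f x i j - e) (f x i j).
      by rewrite ltrBlDr ltrDl.
    have [|b] := @rat_in_itvoo R (f x i j) (f x i j + e).
      by rewrite ltrDl.
    by rewrite !in_itv/= => /andP[? ?] /andP[? ?]; exists (a, b).
  pose c i j := projT1 (cid (ex i j)).
  have cP i j := projT2 (cid (ex i j)).
  exists (\matrix_(i, j) (c i j).1, \matrix_(i, j) (c i j).2) => //.
  case: asboolP => [_|].
    by move=> i j /=; rewrite !mxE in_itv/=; case: (cP i j) => _ -> ->.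
  case=> M boxM; apply: xeU; split => // i j.
  have := boxM i j; rewrite /= !mxE in_itv/= => /andP[aM Mb].
  have [ea _ _ be] := cP i j.
  rewrite /ball/= ltr_distlC; apply/andP; split.
    exact: lt_trans aM.
  exact: lt_trans be.
apply: countable_bigcupT_measurable => [|ab]; first exact: countableP.
by case: asboolP => // _.
Qed.

(* The image of m1 \x m2 under f. The left inverse g makes it sigma-finite,
   so that the construction can be iterated. *)
Section product_along.
Context d1 d2 d' (T1 : measurableType d1) (T2 : measurableType d2)
  (T' : measurableType d') (R : realType).
Variables (f : T1 * T2 -> T') (g : T' -> T1 * T2).
Hypotheses (mf : measurable_fun setT f) (mg : measurable_fun setT g).
Hypothesis fK : cancel f g.
Variables (m1 : {sigma_finite_measure set T1 -> \bar R})
  (m2 : {sigma_finite_measure set T2 -> \bar R}).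

Definition product_image := pushforward (m1 \x m2)%E f.

Let product_image0 : product_image set0 = 0%E.
Proof. by rewrite /product_image /pushforward preimage_set0 measure0. Qed.

Let product_image_ge0 A : (0 <= product_image A)%E.
Proof. exact: measure_ge0. Qed.

Let product_image_sigma_additive : semi_sigma_additive product_image.
Proof. exact: measure_semi_sigma_additive. Qed.

HB.instance Definition _ := isMeasure.Build _ _ _ product_image
  product_image0 product_image_ge0 product_image_sigma_additive.

Let product_image_sigma_finite : sigma_finite setT product_image.
Proof.
have /sigma_finiteP[F [TF ndF Foo]] := sigma_finiteT m1.
have /sigma_finiteP[G [TG ndG Goo]] := sigma_finiteT m2.
exists (fun k => g @^-1` (F k `*` G k)).
  apply/esym; rewrite -preimage_bigcup; apply/seteqP; split => // y _ /=.
  have [i _ Fi] : (\bigcup_i F i) (g y).1 by rewrite -TF.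
  have [j _ Gj] : (\bigcup_i G i) (g y).2 by rewrite -TG.
  exists (maxn i j) => //; split.
    by move: Fi; exact/subsetPset/ndF/leq_maxl.
  by move: Gj; exact/subsetPset/ndG/leq_maxr.
move=> k; have [mF Fkoo] := Foo k; have [mG Gkoo] := Goo k; split.
  by rewrite -[X in measurable X]setTI; apply: mg => //; exact: measurableX.
rewrite /product_image /pushforward (_ : f @^-1` _ = F k `*` G k).
  by rewrite product_measure1E// lte_mul_pinfty// ge0_fin_numE.
by apply/seteqP; split => x /=; rewrite fK.
Qed.

HB.instance Definition _ := Measure_isSigmaFinite.Build _ _ _
  product_image product_image_sigma_finite.

Definition product_along : {sigma_finite_measure set T' -> \bar R} :=
  product_image.

End product_along.

(* The Lebesgue measure on (R^n)^m, built one coordinate, then one row at a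
   time; lebesgue_mx_box below gives its value on boxes. *)
Section lebesgue_matrix.
Variable R : realType.

Let row_cons n (p : measurableTypeR R * 'rV[R]_n) : 'rV[R]_n.+1 :=
  row_mx (const_mx p.1 : 'rV_1) p.2.

Let row_uncons n (v : 'rV[R]_n.+1) : measurableTypeR R * 'rV[R]_n :=
  (v ord0 ord0, @rsubmx R 1 1 n v).

Let row_consK n : cancel (@row_cons n) (@row_uncons n).
Proof.
move=> [a v]; rewrite /row_uncons /row_cons row_mxKr; congr pair.
by rewrite mxE; case: splitP => // j _; rewrite mxE.
Qed.

Let measurable_row_cons n : measurable_fun setT (@row_cons n).
Proof.
apply: measurable_fun_mx => i j; rewrite /row_cons.
under eq_fun do rewrite mxE.
case: (fintype.split _) => k /=.
  by under eq_fun do rewrite mxE; exact: measurable_fst.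
apply: (measurableT_comp (measurable_mx_coord _ _)); exact: measurable_snd.
Qed.

Let measurable_row_uncons n : measurable_fun setT (@row_uncons n).
Proof.
apply: measurable_fun_pair; first exact: measurable_mx_coord.
apply: measurable_fun_mx => i j; under eq_fun do rewrite mxE.
exact: measurable_mx_coord.
Qed.

Fixpoint lebesgue_rV n : {sigma_finite_measure set 'rV[R]_n -> \bar R} :=
  match n with
  | 0 => \d_(0 : 'rV[R]_0)
  | n.+1 => product_along (@measurable_row_cons n)
              (@measurable_row_uncons n) (@row_consK n)
              (@lebesgue_measure R) (lebesgue_rV n)
  end.

Let mx_cons m n (p : 'rV[R]_n * 'M[R]_(m, n)) : 'M[R]_(m.+1, n) :=
  col_mx p.1 p.2.

Let mx_uncons m n (M : 'M[R]_(m.+1, n)) : 'rV[R]_n * 'M[R]_(m, n) :=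
  (@usubmx R 1 m n M, @dsubmx R 1 m n M).

Let mx_consK m n : cancel (@mx_cons m n) (@mx_uncons m n).
Proof. by move=> [v M]; rewrite /mx_uncons /mx_cons col_mxKu col_mxKd. Qed.

Let measurable_mx_cons m n : measurable_fun setT (@mx_cons m n).
Proof.
apply: measurable_fun_mx => i j; rewrite /mx_cons.
under eq_fun do rewrite mxE.
case: (fintype.split _) => k /=.
  apply: (measurableT_comp (measurable_mx_coord _ _)); exact: measurable_fst.
apply: (measurableT_comp (measurable_mx_coord _ _)); exact: measurable_snd.
Qed.

Let measurable_mx_uncons m n : measurable_fun setT (@mx_uncons m n).
Proof.
apply: measurable_fun_pair; apply: measurable_fun_mx => i j;
  by under eq_fun do rewrite mxE; exact: measurable_mx_coord.
Qed.

Fixpoint lebesgue_mx m n :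
    {sigma_finite_measure set 'M[R]_(m, n) -> \bar R} :=
  match m with
  | 0 => \d_(0 : 'M[R]_(0, n))
  | m.+1 => product_along (@measurable_mx_cons m n)
              (@measurable_mx_uncons m n) (@mx_consK m n)
              (lebesgue_rV n) (lebesgue_mx m n)
  end.

End lebesgue_matrix.

Lemma measurable_mx_box (R : realType) m n (A : 'I_m -> 'I_n -> set R) :
  (forall i j, measurable (A i j)) ->
  measurable [set M : 'M[R]_(m, n) | forall i j, A i j (M i j)].
Proof.
move=> mA.
rewrite (_ : mkset _ = \bigcap_(i in [set: 'I_m]) \bigcap_(j in [set: 'I_n])
    (fun M : 'M[R]_(m, n) => M i j) @^-1` A i j).
  apply: fin_bigcap_measurable => // i _.
  apply: fin_bigcap_measurable => // j _.
  by rewrite -[X in measurable X]setTI; exact: measurable_mx_coord.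
by apply/seteqP; split => [M AM i _ j _|M AM i j]; exact: AM.
Qed.

Lemma measurable_rV_box (R : realType) n (A : 'I_n -> set R) :
  (forall j, measurable (A j)) ->
  measurable [set v : 'rV[R]_n | forall j, A j (v ord0 j)].
Proof.
move=> mA; have := @measurable_mx_box R 1 n (fun=> A) (fun=> mA).
congr measurable.
by apply/seteqP; split => [v Av j|v Av i j]; [exact: Av|by rewrite ord1].
Qed.

Lemma lebesgue_rV_box (R : realType) n (A : 'I_n -> set R) :
  (forall j, measurable (A j)) ->
  (lebesgue_rV R n [set v | forall j, A j (v ord0 j)] =
   \prod_(j < n) lebesgue_measure (A j))%E.
Proof.
elim: n A => [|n IHn] A mA.
  by rewrite big_ord0 /= diracE mem_set// => -[].
rewrite big_ord_recl -IHn//= -product_measure1E//; last 2 first.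
- exact: (mA ord0).
- exact: (@measurable_rV_box _ _ (fun j => A (lift ord0 j))).
rewrite /product_along /product_image /pushforward; congr (_ _).
apply/seteqP; split => -[a v] /=.
  move=> Aav; split => [|j].
    have := Aav ord0; rewrite mxE; case: splitP => // j _.
    by rewrite mxE.
  have := Aav (lift ord0 j); rewrite mxE; case: splitP => [k|k /= [jk]].
    by case: k => -[].
  by rewrite (_ : k = j)//; exact/val_inj.
move=> [Aa Av] j; rewrite mxE; case: splitP => [k jk|k jk].
  rewrite mxE (_ : j = ord0)//; apply/val_inj.
  by rewrite /= jk; case: k {jk} => -[].
by rewrite (_ : j = lift ord0 k)//; exact/val_inj.
Qed.

Lemma lebesgue_mx_box (R : realType) n m (A : 'I_m -> 'I_n -> set R) :
  (forall i j, measurable (A i j)) ->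
  (lebesgue_mx R m n [set M | forall i j, A i j (M i j)] =
   \prod_(i < m) \prod_(j < n) lebesgue_measure (A i j))%E.
Proof.
elim: m A => [|m IHm] A mA.
  by rewrite big_ord0 /= diracE mem_set// => -[].
rewrite big_ord_recl -IHm// -lebesgue_rV_box//=.
rewrite -product_measure1E//; last 2 first.
  - exact: measurable_rV_box.
  - exact: (@measurable_mx_box _ _ _ (fun i => A (lift ord0 i))).
rewrite /product_along /product_image /pushforward; congr (_ _).
apply/seteqP; split => -[v M] /=.
  move=> AvM; split => [j|i j].
    have := AvM ord0 j; rewrite mxE; case: splitP => // k _.
    by rewrite ord1.
  have := AvM (lift ord0 i) j; rewrite mxE; case: splitP => [k|k /= [ik]].
    by case: k => -[].
  by rewrite (_ : k = i)//; exact/val_inj.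
move=> [Av AM] i j; rewrite mxE; case: splitP => [k ik|k ik].
  rewrite ord1 (_ : i = ord0)//; apply/val_inj.
  by rewrite /= ik; case: k {ik} => -[].
by rewrite (_ : i = lift ord0 k)//; exact/val_inj.
Qed.

Section sobolev.
Context (R : realType).

Fixpoint Ck (V : normedModType R) (k : nat) (f : V -> R) : Prop :=
  continuous f /\
  if k is k.+1 then
    forall v, (forall x, derivable f x v) /\ Ck k ('D_v f)
  else True.

Definition test_function (V : normedModType R) (phi : V -> R) :=
  (forall k, Ck k phi) /\ compact (closure [set x | phi x != 0]).

Context {m n : nat}.
Local Notation V := 'M[R]_(m, n).
Local Notation mu := (lebesgue_mx R m n).

Definition is_weak_derivative (v : V) (f g : V -> R) :=
  g \in Lfun mu 2%:E /\
  forall phi : V -> R, test_function phi ->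
    \int[mu]_x (f x * 'D_v phi x) = - \int[mu]_x (g x * phi x).

Definition H1 : set (V -> R) :=
  [set f | f \in Lfun mu 2%:E /\
    forall i j, exists g, is_weak_derivative (delta_mx i j) f g].

(* Determined by f up to a null set when it exists; the default value 0 is
   never used on H1 functions. *)
Definition weak_derivative (v : V) (f : V -> R) : V -> R :=
  xget (cst 0) [set g | is_weak_derivative v f g].

End sobolev.

Section wave_functions.
Context {R : realType} {d N : nat}.
Local Notation mu := (lebesgue_mx R N d).
Local Open Scope ereal_scope.

Definition spins := {ffun 'I_N -> 'Z_2}.

(* The argument ((x_1, a_1), ..., (x_N, a_N)) is regrouped as the positions
   x, with x_i = row i x, and the spins a. *)
Definition wavefun := 'M[R]_(N, d) -> spins -> R[i].

Definition int_z (f : 'M[R]_(N, d) -> spins -> \bar R) : \bar R :=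
  \sum_(a : spins) \int[mu]_x f x a.

Definition sqmod (z : R[i]) : R := (complex.Re z ^+ 2 + complex.Im z ^+ 2)%R.

Definition re_part (psi : wavefun) (a : spins) : 'M[R]_(N, d) -> R :=
  fun x => complex.Re (psi x a).

Definition im_part (psi : wavefun) (a : spins) : 'M[R]_(N, d) -> R :=
  fun x => complex.Im (psi x a).

Definition wave_H1 : set wavefun :=
  [set psi | forall a, H1 (re_part psi a) /\ H1 (im_part psi a)].

(* H1 functions are taken modulo null sets, so the antisymmetry is required
   almost everywhere. *)
Definition fermionic : set wavefun := [set psi |
  [/\ wave_H1 psi,
      int_z (fun x a => (sqmod (psi x a))%:E) = 1 &
      forall (s : 'S_N) (a : spins), {ae mu, forall x,
        psi (row_perm s x) [ffun i => a (s i)] = ((-1) ^+ s * psi x a)%R}]].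

(* |d psi / d x_(i,k)|^2 is split into its real and imaginary parts. *)
Definition sqgrad (psi : wavefun) (x : 'M[R]_(N, d)) (a : spins) : R :=
  (\sum_(i < N) \sum_(k < d)
    (weak_derivative (delta_mx i k) (re_part psi a) x ^+ 2 +
     weak_derivative (delta_mx i k) (im_part psi a) x ^+ 2))%R.

Definition kinetic (m hbar : R) (psi : wavefun) : \bar R :=
  (hbar ^+ 2 / (2 * m))%:E * int_z (fun x a => (sqgrad psi x a)%:E).

(* The norm `|v| of the library on matrices is the sup norm. *)
Definition euclidean_norm (v : 'rV[R]_d) : R :=
  Num.sqrt (\sum_(k < d) v ord0 k ^+ 2).

(* In \bar R, 0^-1 = +oo and 0 * +oo = 0. *)
Definition Vee (psi : wavefun) : \bar R :=
  int_z (fun x a => \sum_(i < N) \sum_(j < N | (i < j)%N)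
    (sqmod (psi x a))%:E / (euclidean_norm (row i x - row j x))%:E).

Definition coulomb (x : 'M[R]_(N, d)) : \bar R :=
  \sum_(i < N) \sum_(j < N | (i < j)%N)
    1 / (euclidean_norm (row i x - row j x))%:E.

End wave_functions.
Arguments spins : clear implicits.
Arguments wavefun : clear implicits.

(* The value for N = 0 is a dummy. *)
Definition density {R : realType} {d N : nat} :
    wavefun R d N -> 'rV[R]_d -> \bar R :=
  match N with
  | 0 => fun _ _ => 0%E
  | n.+1 => fun psi x => (\sum_(a : spins n.+1)
      \int[lebesgue_mx R n d]_y (sqmod (psi (col_mx x y) a))%:E)%E
  end.

Section functionals.
Context {R : realType} {d : nat} (N : nat).
Local Notation mu1 := (lebesgue_mx R 1 d).
Local Open Scope ereal_scope.

Definition has_density (psi : wavefun R d N) (rho : 'rV[R]_d -> R) : Prop :=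
  {ae mu1, forall x, density psi x = (rho x)%:E}.

Definition densities : set ('rV[R]_d -> R) := [set rho |
  [/\ forall x, (0 <= rho x)%R,
      \int[mu1]_x (rho x)%:E = 1 &
      H1 (fun x => Num.sqrt (rho x))]].

Definition F_A (m hbar : R) (rho : 'rV[R]_d -> R) : \bar R :=
  ereal_inf [set kinetic m hbar psi + Vee psi | psi in
    [set psi | fermionic psi /\ has_density psi rho]].

Definition plans (rho : 'rV[R]_d -> R) : set (probability 'M[R]_(N, d) R) :=
  [set P | forall (i : 'I_N) (A : set 'rV[R]_d), measurable A ->
    pushforward P (row i) A = \int[mu1]_(x in A) (rho x)%:E].

Definition optimal_cost (rho : 'rV[R]_d -> R) : \bar R :=
  ereal_inf [set \int[P]_x coulomb x | P in plans rho].

End functionals.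

(* Main.v *)
(** Lower bound: if psi has density rho, then the sum over the spins of |psi|^2 is
    the density of a plan of cost Vee psi, and the kinetic energy is nonnegative.

    Upper bound: for a plan P of finite cost and eps > 0 it suffices to find one psi
    with density rho and Vee psi <= cost P + eps, since its kinetic energy is
    finite and the factor hbar^2 kills it. Let theta_k be smooth functions on R^d
    with small supports (one of them living near infinity) and sum theta_k^2 = 1.
    Discretise P into weights on N-tuples of cells; the tuples with two nearby
    cells have small weight, since the cost is finite, and exchanging coordinates
    with well separated tuples moves them away from the diagonal without changing
    the marginals. After symmetrisation this gives a density p = S^2 G, where
    S = prod_i sqrt rho(x_i) and G = sum_t c_t prod_i theta_(t_i)(x_i)^2, whose
    marginals are exactly rho, which vanishes unless |x_i - x_j| >= alpha, and
    whose cost is at most cost P + eps. Finally psi = S sqrt(G/Q) (D_0 + i D_1),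
    where D_0, D_1 are real antisymmetric functions with Q = sum_a (D_0^2 + D_1^2).
    For N = 2 take the singlet det[a; 1]; for N = 3 take det[a; x^(k); 1], with x^(k)
    the k-th coordinates of the particles. One spin up or two, real or imaginary
    part, leave room for four values of k. Then Q controls the squared distances of
    the particles, hence Q >= alpha^2 on the support of G, and psi is H^1. *)

From HB Require Import structures.
From mathcomp Require Import all_boot all_order all_algebra all_fingroup.
From mathcomp Require Import complex.
From mathcomp Require Import all_classical all_reals all_analysis.
From mathcomp Require Import measurable_realfun.
From mathcomp Require Import ring lra.
Require Import Defs.

Set Implicit Arguments.
Unset Strict Implicit.
Unset Printing Implicit Defensive.

Import Order.TTheory GRing.Theory Num.Theory.
Import numFieldNormedType.Exports.

Local Open Scope classical_set_scope.
Local Open Scope ring_scope.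

(** * Discrete multi-marginal rearrangement *)

Section rearrangement.
Variables (R : realFieldType) (K : finType) (n : nat).
Local Notation T := {ffun 'I_n -> K}.

Definition marginal (w : T -> R) (i : 'I_n) (a : K) := \sum_(t : T | t i == a) w t.

Definition image_weight (I : finType) (F : I -> T) (w : I -> R) (t : T) :=
  \sum_(x | F x == t) w x.

Lemma sum_image_weight (I : finType) (F : I -> T) (w : I -> R) (Q : pred T) :
  \sum_(t : T | Q t) image_weight F w t = \sum_(x | Q (F x)) w x.
Proof.
rewrite [RHS](partition_big F Q)//; apply: eq_bigr => t Qt.
by apply: eq_bigl => x; case: eqVneq => [->|]; rewrite ?andbF ?andbT// Qt.
Qed.

Variable sep : rel K.
Hypothesis sepC : symmetric sep.

Definition separated (t : T) := [forall i, forall j, (i != j) ==> sep (t i) (t j)].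

Definition swap (i : 'I_n) (x y : T) : T := [ffun j => if j == i then y j else x j].

Definition compat (x y : T) := [forall p, forall q, sep (x p) (y q)].

Lemma compatP (x y : T) : reflect (forall p q, sep (x p) (y q)) (compat x y).
Proof.
apply: (iffP forallP) => [H p q|H p]; first by have /forallP := H p.
by apply/forallP.
Qed.

Lemma separatedP (t : T) : reflect (forall i j, i != j -> sep (t i) (t j)) (separated t).
Proof.
apply: (iffP forallP) => [H p q pq|H p]; first by have /forallP/(_ q)/implyP := H p; apply.
by apply/forallP => q; apply/implyP; exact: H.
Qed.

Definition separated_below (k : nat) (t : T) :=
  forall p q : 'I_n, (p < k)%N -> p != q -> sep (t p) (t q).

Section swap_step.
Variables (ws b : T -> R) (eta : R) (i : 'I_n).
Hypothesis ws0 : forall t, 0 <= ws t.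
Hypothesis b0 : forall t, 0 <= b t.
Hypothesis wsS : forall t, ws t != 0 -> separated t.
Hypothesis bS : forall t, b t != 0 -> separated_below i t.
Hypothesis sumb : \sum_t b t = eta.
Hypothesis Zge : forall x, 2^-1 <= \sum_(y | compat x y) ws y.

Let Z x := \sum_(y | compat x y) ws y.
Let J (p : T * T) : R := if compat p.1 p.2 then b p.1 * ws p.2 / Z p.1 else 0.

Let Z0 x : 0 < Z x.
Proof. by rewrite (lt_le_trans _ (Zge x))// invr_gt0. Qed.

Let J0 p : 0 <= J p.
Proof. by rewrite /J; case: ifP => // _; rewrite !mulr_ge0// invr_ge0 ltW. Qed.

Let sumJ (Q : pred T) : \sum_(p | Q p.1) J p = \sum_(x | Q x) b x.
Proof.
rewrite (eq_bigl (fun p => Q p.1 && true)); last by move=> p; rewrite andbT.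
rewrite -(pair_big Q xpredT (fun x y => J (x, y)))/=; apply: eq_bigr => x _.
rewrite -big_mkcond /= -mulr_suml -mulr_sumr mulfK//.
by rewrite gt_eqF//; exact: Z0.
Qed.

(* A tuple x of the bad part b and a compatible separated tuple y, drawn from
   ws, exchange their i-th coordinates: this preserves all marginals. *)
Lemma swap_step : exists tau b' r' : T -> R,
  [/\ (forall t, 0 <= tau t <= 2 * eta * ws t) /\ (forall t, 0 <= b' t),
      (forall t, 0 <= r' t) /\ (forall t, r' t != 0 -> separated t),
      forall t, b' t != 0 -> separated_below i.+1 t,
      \sum_t b' t = eta /\ \sum_t r' t = eta &
      forall j a, marginal b j a + marginal tau j a =
        marginal b' j a + marginal r' j a].
Proof.
exists (image_weight snd J), (image_weight (fun p => swap i p.1 p.2) J),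
  (image_weight (fun p => swap i p.2 p.1) J).
have Jn0 p : J p != 0 -> [/\ compat p.1 p.2, b p.1 != 0 & ws p.2 != 0].
  rewrite /J; case: ifP => [_|]; last by rewrite eqxx.
  by rewrite !mulf_eq0 !negb_or => /andP[/andP[]].
have iw0 F t : 0 <= image_weight F J t by apply: sumr_ge0.
have iwn0 F t : image_weight F J t != 0 -> exists2 p, F p = t & J p != 0.
  rewrite psumr_neq0// => /hasP[p _ /andP[/eqP Fp Jp]].
  by exists p => //; rewrite gt_eqF.
split.
- split => [t|t]; last exact: iw0.
  rewrite iw0/= /image_weight.
  rewrite (eq_bigl (fun p : T * T => true && (p.2 == t)))//.
  rewrite -(pair_big xpredT (fun y => y == t) (fun x y => J (x, y)))/=.
  under eq_bigr => x _ do rewrite big_pred1_eq.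
  rewrite -sumb mulr_sumr mulr_suml; apply: ler_sum => x _.
  rewrite /J/=; case: ifP => _; last by rewrite !mulr_ge0.
  rewrite ler_pdivrMr// (_ : 2 * b x * ws t * Z x = b x * ws t * (2 * Z x)); last by ring.
  rewrite ler_peMr ?mulr_ge0//.
  by have := Zge x; rewrite -/(Z x); lra.
- split => [t|t]; first exact: iw0.
  move=> /iwn0[[x y] <- /Jn0[/= /compatP xy bx /wsS/separatedP sy]].
  apply/separatedP => p q pq; rewrite !ffunE.
  case: (eqVneq p i) (eqVneq q i) pq => [->|pi] [->|qi] pq.
  + by [].
  + exact: xy.
  + by rewrite sepC; exact: xy.
  + exact: sy.
- move=> t /iwn0[[x y] <- /Jn0[/= /compatP xy /bS bx _]].
  move=> p q; rewrite ltnS leq_eqVlt => pi pq; rewrite !ffunE.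
  have [pi'|pi'] := eqVneq p i.
    have -> : q == i = false by apply/negbTE; rewrite -pi' eq_sym.
    by rewrite sepC; exact: xy.
  have {}pi : (p < i)%N by case/orP : pi => // /eqP/val_inj pi; rewrite pi eqxx in pi' *.
  case: (eqVneq q i) => _; first exact: xy.
  exact: bx.
- by split; rewrite (sum_image_weight _ _ xpredT) (sumJ xpredT).
move=> j a; rewrite /marginal !sum_image_weight -sumJ.
rewrite [RHS]addrC.
have E (P : pred (T * T)) : \sum_(p | P p) J p = \sum_p (P p)%:R * J p.
  by rewrite big_mkcond; apply: eq_bigr => p _; case: (P p); rewrite ?mul1r ?mul0r.
rewrite !E -!big_split /=; apply: eq_bigr => -[x y] _ /=.
by rewrite -!mulrDl !ffunE; congr (_ * _); case: (j == i); rewrite // addrC.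
Qed.

End swap_step.

Section rearrange.
Variables (wg ws b : T -> R) (m : K -> R) (eta delta : R).
Hypothesis ws0 : forall t, 0 <= ws t <= wg t.
Hypothesis b0 : forall t, 0 <= b t.
Hypothesis wsS : forall t, ws t != 0 -> separated t.
Hypothesis sumb : \sum_t b t = eta.
Hypothesis sumws : 3 / 4 <= \sum_t ws t.
Hypothesis mE : forall i a, marginal wg i a + marginal b i a = m a.
Hypothesis mdelta : forall a, \sum_(c | ~~ sep a c) m c <= delta.
Hypothesis ndelta : n%:R * n%:R * delta <= 1 / 4.
Hypothesis neta : n%:R * (2 * eta) <= 1.

Let wg0 t : 0 <= wg t.
Proof. by have /andP[] := ws0 t; exact: le_trans. Qed.

Let Zge x : 2^-1 <= \sum_(y | compat x y) ws y.
Proof.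
have H : \sum_(y | ~~ compat x y) ws y <= 1 / 4.
  apply: le_trans ndelta.
  apply: (@le_trans _ _ (\sum_(pq : 'I_n * 'I_n) \sum_(y : T | ~~ sep (x pq.1) (y pq.2)) ws y)).
    under [leRHS]eq_bigr do rewrite big_mkcond.
    rewrite exchange_big /= big_mkcond; apply: ler_sum => y _.
    case: ifPn => [|_]; last by apply: sumr_ge0 => pq _; case: ifP => // _; have /andP[] := ws0 y.
    rewrite negb_forall => /existsP[p]; rewrite negb_forall => /existsP[q xy].
    rewrite (bigD1 (p, q))//= xy lerDl.
    by apply: sumr_ge0 => pq _; case: ifP => // _; have /andP[] := ws0 y.
  apply: (@le_trans _ _ (\sum_(pq : 'I_n * 'I_n) delta)); last first.
    by rewrite sumr_const card_prod card_ord -natrM mulr_natl.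
  apply: ler_sum => -[p q] _ /=; apply: le_trans (mdelta (x p)).
  rewrite (partition_big (fun y : T => y q) (fun c => ~~ sep (x p) c))//=.
  apply: ler_sum => c _; rewrite -(mE q) ler_wpDr ?sumr_ge0//.
  rewrite /marginal [leRHS](bigID (fun y : T => ~~ sep (x p) (y q)))/=.
  rewrite (eq_bigl (fun y : T => (y q == c) && ~~ sep (x p) (y q))); last by move=> y; rewrite andbC.
  rewrite ler_wpDr ?sumr_ge0//.
  by apply: ler_sum => y _; have /andP[] := ws0 y.
move: sumws; rewrite (bigID (compat x))/=; lra.
Qed.

Lemma rearrange : exists w' r : T -> R,
  [/\ forall t, 0 <= w' t <= wg t + r t, forall i a, marginal w' i a = m a,
      forall t, 0 <= r t, forall t, r t != 0 -> separated t &
      \sum_t r t = (n%:R + 1) * eta].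
Proof.
have eta0 : 0 <= eta by rewrite -sumb sumr_ge0.
suff H k : (k <= n)%N -> exists u b' r : T -> R,
  [/\ (forall t, wg t - k%:R * (2 * eta) * ws t <= u t <= wg t)
       /\ (forall t, 0 <= b' t),
      (forall t, 0 <= r t) /\ (forall t, r t != 0 -> separated t),
      forall t, b' t != 0 -> separated_below k t,
      \sum_t b' t = eta /\ \sum_t r t = k%:R * eta &
      forall j a, marginal u j a + marginal b' j a + marginal r j a = m a].
  have [u [b' [r [[uw b'0] [r0 rS] b'S [sumb' sumr] E]]]] := H n (leqnn n).
  exists (fun t => u t + b' t + r t), (fun t => b' t + r t).
  have sb' t : b' t != 0 -> separated t.
    by move=> /b'S bt; apply/separatedP => p q; exact: bt.
  split.
  - move=> t; have /andP[u1 u2] := uw t; apply/andP; split; last by rewrite -addrA lerD2r.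
    rewrite !addr_ge0//; apply: le_trans u1; rewrite subr_ge0.
    have /andP[w1 w2] := ws0 t.
    by apply: le_trans w2; rewrite ler_piMl.
  - by move=> i a; rewrite -(E i a) /marginal !big_split.
  - by move=> t; rewrite addr_ge0.
  - move=> t; have [->|bt] := eqVneq (b' t) 0; first by rewrite add0r; exact: rS.
    by move=> _; exact: sb'.
  - by rewrite big_split/= sumb' sumr mulrDl mul1r addrC.
elim: k => [_|k IH kn].
  exists wg, b, (fun=> 0); split => //.
  - by split=> // t; rewrite mul0r mul0r subr0 lexx.
  - by split=> // t; rewrite eqxx.
  - by split; rewrite // big1 ?mul0r.
  - by move=> j a; rewrite mE /marginal big1 ?addr0.
have [u [b' [r [[uw b'0] [r0 rS] b'S [sumb' sumr] E]]]] := IH (ltnW kn).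
have ws0' t : 0 <= ws t by case/andP : (ws0 t).
have [tau [b2 [r2 [[tau0 b20] [r20 r2S] b2S [sumb2 sumr2] E2]]]] :=
  @swap_step ws b' eta (Ordinal kn) ws0' b'0 wsS b'S sumb' Zge.
exists (fun t => u t - tau t), b2, (fun t => r t + r2 t); split => //.
- split=> // t; have /andP[u1 u2] := uw t; have /andP[t1 t2] := tau0 t.
  apply/andP; split; last by rewrite (le_trans _ u2)// gerBl.
  rewrite -natr1; lra.
- split=> t; first exact: addr_ge0.
  have [->|rt] := eqVneq (r t) 0; first by rewrite add0r; exact: r2S.
  by move=> _; exact: rS.
- by split=> //; rewrite big_split/= sumr sumr2 -natr1 mulrDl mul1r.
- move=> j a; rewrite -(E j a); have := E2 j a.
  rewrite /marginal !big_split /= sumrN; lra.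
Qed.

End rearrange.

End rearrangement.

(** * Lebesgue measure on matrices *)

Section mx_norm.
Variables (R : realType) (m n : nat).
Implicit Type M : 'M[R]_(m, n).

Lemma ler_mx_coord M i j : `|M i j| <= `|M|.
Proof.
rewrite /Num.norm/= mx_normrE.
exact: (le_bigmax _ (fun ij : 'I_m * 'I_n => `|M ij.1 ij.2|) (i, j)).
Qed.

Lemma mx_norm_leP M e : 0 <= e -> (`|M| <= e) <-> (forall i j, `|M i j| <= e).
Proof.
move=> e0; split => [Me i j|Me]; first exact: le_trans (ler_mx_coord _ _ _) Me.
by rewrite /Num.norm/= mx_normrE; apply/bigmax_leP.
Qed.

Lemma mx_norm_lt M e : 0 < e -> (`|M| < e) <-> (forall i j, `|M i j| < e).
Proof.
move=> e0; split => [Me i j|Me]; first exact: le_lt_trans (ler_mx_coord _ _ _) Me.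
by rewrite /Num.norm/= mx_normrE; apply/bigmax_ltP.
Qed.

End mx_norm.

Lemma integrable_fubini_G d1 d2 (T1 : measurableType d1)
    (T2 : measurableType d2) (R : realType)
    (m1 : {sigma_finite_measure set T1 -> \bar R})
    (m2 : {sigma_finite_measure set T2 -> \bar R}) (f : T1 * T2 -> \bar R) :
  (m1 \x m2)%E.-integrable setT f -> m2.-integrable setT (fubini_G m1 f).
Proof.
move=> fi; have /integrableP[mf _] := fi.
apply/integrableP; split; first exact: measurable_fubini_G fi.
apply: le_lt_trans ((integrable21ltyP _ _ mf).1 fi).
apply: ge0_le_integral => //.
- by apply: measurableT_comp => //; exact: measurable_fubini_G fi.
- apply: (measurable_fun_fubini_tonelli_G (abse \o f)) => //=.
  exact: measurableT_comp.
- by move=> y _; apply: le_abse_integral => //; exact: measurableT_comp.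
Qed.

Section borel.
Variable R : realType.

Lemma measurable_col_mx n d :
  measurable_fun setT (fun p : 'rV[R]_d * 'M[R]_(n, d) => col_mx p.1 p.2 : 'M[R]_(n.+1, d)).
Proof.
apply: measurable_fun_mx => i j; under eq_fun do rewrite mxE.
case: (fintype.split _) => k /=.
  apply: (measurableT_comp (measurable_mx_coord _ _)); exact: measurable_fst.
apply: (measurableT_comp (measurable_mx_coord _ _)); exact: measurable_snd.
Qed.

Lemma lebesgue_mx1E d (A : set 'rV[R]_d) : measurable A ->
  lebesgue_mx R 1 d A = lebesgue_rV R d A.
Proof.
move=> mA.
rewrite /= /product_along /= /product_image /pushforward.
rewrite /product_measure1 /=.
under eq_integral => x _.
  rewrite diracE.
  rewrite (_ : (_ \in _) = (x \in A)); last first.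
    have E0 : col_mx x (0 : 'M[R]_(0, d)) = x.
      by apply/matrixP => i j; rewrite mxE; case: splitP => k; rewrite ?(ord1 i) ?(ord1 k)//; case: k.
    rewrite mem_xsection.
    by apply/idP/idP => /set_mem/= H; apply/mem_set; move: H; rewrite /= E0.
  over.
by rewrite /= (_ : (fun x => _) = EFin \o \1_A)// integral_indic// setIT.
Qed.

Lemma integral_mx1E d (f : 'rV[R]_d -> \bar R) :
  (\int[lebesgue_mx R 1 d]_v f v = \int[lebesgue_rV R d]_v f v)%E.
Proof. by apply: eq_measure_integral => A mA _; exact: lebesgue_mx1E. Qed.

Lemma measurable_comp_col_mx n d (f : 'M[R]_(n.+1, d) -> \bar R) :
  measurable_fun setT f -> measurable_fun setT
    (f \o (fun p : 'rV[R]_d * 'M[R]_(n, d) => col_mx p.1 p.2 : 'M[R]_(n.+1, d))).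
Proof. by move=> mf; exact: (measurableT_comp mf (@measurable_col_mx n d)). Qed.

Lemma mx_tonelli1 n d (f : 'M[R]_(n.+1, d) -> \bar R) :
  measurable_fun setT f -> (forall x, 0 <= f x)%E ->
  (\int[lebesgue_mx R n.+1 d]_x f x =
   \int[lebesgue_mx R 1 d]_v \int[lebesgue_mx R n d]_y f (col_mx v y))%E.
Proof.
move=> mf f0; rewrite [LHS]ge0_integral_pushforward//; last first.
  exact: (@measurable_col_mx n d).
rewrite preimage_setT (fubini_tonelli1 _ (measurable_comp_col_mx mf) (fun=> f0 _)).
by rewrite integral_mx1E.
Qed.

Lemma measurable_tonelli1 n d (f : 'M[R]_(n.+1, d) -> \bar R) :
  measurable_fun setT f -> (forall x, 0 <= f x)%E ->
  measurable_fun setT (fun v : 'rV[R]_d =>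
    \int[lebesgue_mx R n d]_y f (col_mx v y))%E.
Proof.
move=> mf f0; exact: (measurable_fun_fubini_tonelli_F _
  (measurable_comp_col_mx mf) (fun=> f0 _)).
Qed.

Lemma col_mx_row0 n d (v : 'rV[R]_d) (y : 'M[R]_(n, d)) :
  row ord0 (col_mx v y : 'M[R]_(n.+1, d)) = v.
Proof.
apply/matrixP => i j; rewrite !mxE; case: splitP => k//= _.
by rewrite (ord1 i) (ord1 k).
Qed.

Lemma col_mx_rowS n d (v : 'rV[R]_d) (y : 'M[R]_(n, d)) i :
  row (lift ord0 i) (col_mx v y : 'M[R]_(n.+1, d)) = row i y.
Proof.
apply/matrixP => i' j; rewrite !mxE.
case: splitP => [k|k /= ik]; first by case: k => -[].
by congr (y _ _); apply/val_inj; move: ik => /=; rewrite /bump leq0n !add1n => -[].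
Qed.

Lemma mx_integrable n d (f : 'M[R]_(n.+1, d) -> \bar R) :
  (lebesgue_mx R n.+1 d).-integrable setT f ->
  (lebesgue_rV R d \x lebesgue_mx R n d)%E.-integrable setT
    (fun p => f (col_mx p.1 p.2)).
Proof.
move=> /integrableP[mf foo]; apply/integrableP; split; first exact: measurable_comp_col_mx.
move: foo; rewrite [X in (X < _ -> _)%E]ge0_integral_pushforward//.
- by exact: (@measurable_col_mx n d).
- exact: measurableT_comp.
Qed.

Lemma mx_fubini1 n d (f : 'M[R]_(n.+1, d) -> \bar R) :
  (lebesgue_mx R n.+1 d).-integrable setT f ->
  (\int[lebesgue_mx R n.+1 d]_x f x =
   \int[lebesgue_rV R d]_v \int[lebesgue_mx R n d]_y f (col_mx v y))%E.
Proof.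
move=> fi; rewrite [LHS]integral_pushforward//.
- by rewrite (integral12_prod_meas1 (mx_integrable fi)).
- exact: (@measurable_col_mx n d).
- by have /integrableP[] := fi.
- exact: mx_integrable.
Qed.

Lemma mx_fubini2 n d (f : 'M[R]_(n.+1, d) -> \bar R) :
  (lebesgue_mx R n.+1 d).-integrable setT f ->
  (\int[lebesgue_mx R n.+1 d]_x f x =
   \int[lebesgue_mx R n d]_y \int[lebesgue_rV R d]_v f (col_mx v y))%E.
Proof.
move=> fi; rewrite [LHS]integral_pushforward//.
- by rewrite (integral21_prod_meas1 (mx_integrable fi)).
- exact: (@measurable_col_mx n d).
- by have /integrableP[] := fi.
- exact: mx_integrable.
Qed.

Lemma mx_Rintegral_opp1 n d (f g : 'M[R]_(n.+1, d) -> R) :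
  (lebesgue_mx R n.+1 d).-integrable setT (EFin \o f) ->
  (lebesgue_mx R n.+1 d).-integrable setT (EFin \o g) ->
  (forall v : 'rV[R]_d, \int[lebesgue_mx R n d]_y f (col_mx v y) =
          - \int[lebesgue_mx R n d]_y g (col_mx v y)) ->
  \int[lebesgue_mx R n.+1 d]_x f x = - \int[lebesgue_mx R n.+1 d]_x g x.
Proof.
move=> fi gi fg; rewrite /Rintegral (mx_fubini1 fi) (mx_fubini1 gi).
have mfi := mx_integrable fi; have mgi := mx_integrable gi.
have fI : _.-integrable setT (fun v : 'rV[R]_d => \int[lebesgue_mx R n d]_y (f (col_mx v y))%:E)%E
  := integrable_fubini_F mfi.
have gI : _.-integrable setT (fun v : 'rV[R]_d => \int[lebesgue_mx R n d]_y (g (col_mx v y))%:E)%E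
  := integrable_fubini_F mgi.
rewrite -fineN; congr fine; rewrite -integralN/=; last first.
  exact: integrable_add_def gI.
apply: ae_eq_integral => //.
- by case/integrableP : fI.
- by apply: measurableT_comp => //; case/integrableP : gI.
have := ae_integrable1 mfi; have := ae_integrable1 mgi.
apply: filterS2 => v /= gv fv _.
rewrite -(fineK (integrable_fin_num measurableT fv)).
rewrite -(fineK (integrable_fin_num measurableT gv)).
by rewrite -EFinN; congr EFin; exact: fg.
Qed.

Lemma mx_Rintegral_opp2 n d (f g : 'M[R]_(n.+1, d) -> R) :
  (lebesgue_mx R n.+1 d).-integrable setT (EFin \o f) ->
  (lebesgue_mx R n.+1 d).-integrable setT (EFin \o g) ->
  (forall y, \int[lebesgue_mx R 1 d]_v f (col_mx v y) =
          - \int[lebesgue_mx R 1 d]_v g (col_mx v y)) ->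
  \int[lebesgue_mx R n.+1 d]_x f x = - \int[lebesgue_mx R n.+1 d]_x g x.
Proof.
move=> fi gi fg; rewrite /Rintegral (mx_fubini2 fi) (mx_fubini2 gi).
have mfi := mx_integrable fi; have mgi := mx_integrable gi.
have fI : _.-integrable setT (fun y => \int[lebesgue_rV R d]_v (f (col_mx (v : 'rV[R]_d) y))%:E)%E
  := integrable_fubini_G mfi.
have gI : _.-integrable setT (fun y => \int[lebesgue_rV R d]_v (g (col_mx (v : 'rV[R]_d) y))%:E)%E
  := integrable_fubini_G mgi.
rewrite -fineN; congr fine; rewrite -integralN/=; last first.
  exact: integrable_add_def gI.
apply: ae_eq_integral => //.
- by case/integrableP : fI.
- by apply: measurableT_comp => //; case/integrableP : gI.
have := ae_integrable2 mfi; have := ae_integrable2 mgi.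
apply: filterS2 => v /= gv fv _.
rewrite -(fineK (integrable_fin_num measurableT fv)).
rewrite -(fineK (integrable_fin_num measurableT gv)).
rewrite -EFinN; congr EFin; have := fg v.
by rewrite /Rintegral !integral_mx1E.
Qed.

Definition mx_boxes m n : set (set 'M[R]_(m, n)) :=
  [set A | exists2 B : 'I_m -> 'I_n -> set R, (forall i j, measurable (B i j)) &
     A = [set M : 'M[R]_(m, n) | forall i j, B i j (M i j)]].

Lemma measurable_mx_boxes m n :
  @measurable _ 'M[R]_(m, n) = <<s @mx_boxes m n >>.
Proof.
apply/seteqP; split; last first.
  apply: smallest_sub; first exact: sigma_algebra_measurable.
  by move=> _ [B mB ->]; exact: measurable_mx_box.
pose T := g_sigma_algebraType (@mx_boxes m n).
have mid : @measurable_fun _ _ T 'M[R]_(m, n) setT id.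
  apply: measurable_fun_mx => i j _ A mA; rewrite setTI.
  apply: sub_sigma_algebra.
  exists (fun i' j' => if (i' == i) && (j' == j) then A else setT).
    by move=> i' j'; case: ifP.
  apply/seteqP; split => [M AM i' j'|M /(_ i j)]/=; last by rewrite !eqxx.
  by case: ifP => // /andP[/eqP -> /eqP ->].
by move=> A mA; have := mid measurableT A mA; rewrite setTI.
Qed.

Lemma lebesgue_mx_unique m n (mu : measure 'M[R]_(m, n) R) :
  (forall A : 'I_m -> 'I_n -> set R, (forall i j, measurable (A i j)) ->
  mu [set M : 'M[R]_(m, n) | forall i j, A i j (M i j)] =
   \prod_(i < m) \prod_(j < n) lebesgue_measure (A i j))%E ->
  forall A, measurable A -> mu A = lebesgue_mx R m n A.
Proof.
move=> H; apply: (measure_unique (@mx_boxes m n)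
  (fun k => [set M : 'M[R]_(m, n) | forall i j, `[- k%:R, k%:R]%classic (M i j)])).
- exact: measurable_mx_boxes.
- move=> _ _ [A mA ->] [B mB ->]; exists (fun i j => A i j `&` B i j).
    by move=> i j; exact: measurableI.
  by apply/seteqP; split => [M [AM BM] i j|M ABM]; [split|split => i j; case: (ABM i j)].
- by move=> k; exists (fun _ _ => `[- k%:R, k%:R]%classic).
- apply/seteqP; split => // M _.
  exists (Num.truncn (`|M|)).+1 => // i j /=.
  rewrite in_itv/= -ler_norml; apply: (@le_trans _ _ `|M|).
    exact: ler_mx_coord.
  by apply: ltW; exact: truncnS_gt.
- by move=> _ [A mA ->]; apply: (etrans (H A mA)); exact/esym/lebesgue_mx_box.
- move=> k; have E := H (fun _ _ => `[- k%:R, k%:R]%classic)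
    (fun _ _ => measurable_itv _).
  rewrite [X in (X < _)%E]E.
  rewrite ltey_eq prode_fin_num// => i _; rewrite prode_fin_num// => j _.
  by rewrite lebesgue_measure_itv/=; case: ifP.
Qed.

End borel.

Section borel2.
Variable R : realType.

Lemma measurable_row_perm m n (s : 'S_m) :
  measurable_fun setT (fun M : 'M[R]_(m, n) => row_perm s M).
Proof.
apply: measurable_fun_mx => i j; under eq_fun do rewrite mxE.
exact: measurable_mx_coord.
Qed.

Lemma measurable_row m n (i : 'I_m) :
  measurable_fun setT (fun M : 'M[R]_(m, n) => row i M).
Proof.
apply: measurable_fun_mx => i' j; under eq_fun do rewrite mxE.
exact: measurable_mx_coord.
Qed.

Lemma lebesgue_mx_perm m n (s : 'S_m) (A : set 'M[R]_(m, n)) : measurable A ->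
  pushforward (lebesgue_mx R m n) (row_perm s) A = lebesgue_mx R m n A.
Proof.
pose mu : measure 'M[R]_(m, n) R :=
  measure_function_pushforward__canonical__measure_function_Measure
    (lebesgue_mx R m n) (measurable_row_perm s).
suff H B : (forall i j, measurable (B i j)) ->
    mu [set M : 'M[R]_(m, n) | forall i j, B i j (M i j)] =
   (\prod_(i < m) \prod_(j < n) lebesgue_measure (B i j))%E.
  exact: (lebesgue_mx_unique H).
move=> {A} mA; rewrite /mu /= /pushforward.
transitivity (lebesgue_mx R m n
  [set M : 'M[R]_(m, n) | forall i j, B (s^-1%g i) j (M i j)]).
  congr (lebesgue_mx R m n _); apply/seteqP; split => [M MB i j|M MB i j] /=.
    by have := MB (s^-1%g i) j; rewrite mxE permKV.
  by have := MB (s i) j; rewrite permK mxE.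
rewrite (@lebesgue_mx_box _ _ _ (fun i j => B (s^-1%g i) j))//.
rewrite (reindex_inj (@perm_inj _ s)) /=.
by apply: eq_bigr => i _; rewrite permK.
Qed.

Lemma ge0_integral_row_perm m n (s : 'S_m) (f : 'M[R]_(m, n) -> \bar R) :
  measurable_fun setT f -> (forall x, 0 <= f x)%E ->
  (\int[lebesgue_mx R m n]_x f (row_perm s x) = \int[lebesgue_mx R m n]_x f x)%E.
Proof.
move=> mf f0.
have := @ge0_integral_pushforward _ _ _ _ _ _ (measurable_row_perm s)
  (lebesgue_mx R m n) setT f measurableT mf (fun x _ => f0 x).
rewrite preimage_setT => <-.
exact: (@eq_measure_integral _ _ _ setT (lebesgue_mx R m n)
  (measure_function_pushforward__canonical__measure_function_Measure
    (lebesgue_mx R m n) (measurable_row_perm s)) f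
  (fun A mA _ => lebesgue_mx_perm s mA)).
Qed.

Lemma prod_mx_integral n d (f : 'I_n -> 'rV[R]_d -> R) :
  (forall i, measurable_fun setT (f i)) -> (forall i x, 0 <= f i x) ->
  (\int[lebesgue_mx R n d]_x (\prod_(i < n) f i (row i x))%:E =
   \prod_(i < n) \int[lebesgue_mx R 1 d]_v (f i v)%:E)%E.
Proof.
elim: n f => [|n IH] f mf f0.
  rewrite big_ord0.
  rewrite (eq_integral (cst 1%E)); last by move=> x _; rewrite big_ord0.
  by rewrite integral_cst//= diracT mule1.
have mp k (g : 'I_k -> 'rV[R]_d -> R) : (forall i, measurable_fun setT (g i)) ->
    measurable_fun setT (fun x : 'M[R]_(k, d) => (\prod_(i < k) g i (row i x))).
  move=> mg; apply: measurable_prod => i _.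
  by apply: (measurableT_comp (mg i)); exact: measurable_row.
rewrite mx_tonelli1//; last 2 first.
- by apply/measurable_EFinP; exact: mp.
- by move=> x; rewrite lee_fin prodr_ge0.
have E (v : 'rV[R]_d) (y : 'M[R]_(n, d)) :
    (\prod_(i < n.+1) f i (row i (col_mx v y : 'M[R]_(n.+1, d))) =
    f ord0 v * \prod_(i < n) f (lift ord0 i) (row i y)).
  rewrite big_ord_recl col_mx_row0; congr (_ * _).
  by apply: eq_bigr => i _; rewrite col_mx_rowS.
under eq_integral => v _.
  under eq_integral => y _ do rewrite E EFinM.
  rewrite ge0_integralZl//; last 3 first.
  - by apply/measurable_EFinP; apply: (mp _ (fun i => f (lift ord0 i))).
  - by move=> y _; rewrite lee_fin prodr_ge0.
  - by rewrite lee_fin.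
  rewrite (IH (fun i => f (lift ord0 i)))//.
  over.
rewrite ge0_integralZr//; last 3 first.
- exact/measurable_EFinP.
- by move=> v _; rewrite lee_fin.
- by apply: prode_ge0 => i _; apply: integral_ge0 => x _; rewrite lee_fin.
by rewrite [RHS]big_ord_recl.
Qed.

End borel2.

(** * Smooth functions *)

Section smooth.
Variable R : realType.
Implicit Types V W : normedModType R.

Lemma Ck_continuous V k (f : V -> R) : Ck k f -> continuous f.
Proof. by case: k => [|k] []. Qed.

Lemma CkW V k (f : V -> R) : Ck k.+1 f -> Ck k f.
Proof.
elim: k f => [|k IH] f; first by case.
by case=> cf df; split => // v; split; [exact: (df v).1|exact/IH/(df v).2].
Qed.

Definition smooth V (f : V -> R) := forall k, Ck k f.

Lemma smooth_continuous V (f : V -> R) : smooth f -> continuous f.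
Proof. by move=> /(_ 0%N)/Ck_continuous. Qed.

Lemma smooth_derivable V (f : V -> R) v x : smooth f -> derivable f x v.
Proof. by move=> /(_ 1%N)[_ /(_ v)[]]. Qed.

Lemma smooth_derive V (f : V -> R) v : smooth f -> smooth ('D_v f).
Proof. by move=> sf k; have [_ /(_ v)[]] := sf k.+1. Qed.

Lemma Ck_cst V k (c : R) : Ck k (cst c : V -> R).
Proof.
elim: k c => [|k IH] c; split => //; try exact: cst_continuous.
move=> v; split => [x|]; first exact: derivable_cst.
rewrite (_ : 'D_v _ = cst 0)//; apply/funext => x; exact: derive_cst.
Qed.

Lemma Ck_add V k (f g : V -> R) : Ck k f -> Ck k g -> Ck k (f \+ g).
Proof.
elim: k f g => [|k IH] f g [cf df] [cg dg].
  by split => // x; apply: cvgD; [exact: cf|exact: cg].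
split; first by move=> x; apply: cvgD; [exact: cf|exact: cg].
move=> v; have [f1 f2] := df v; have [g1 g2] := dg v.
split; first by move=> x; exact: derivableD.
rewrite (_ : 'D_v _ = 'D_v f \+ 'D_v g); first exact: IH.
by apply/funext => x; exact: deriveD.
Qed.

Lemma Ck_mul V k (f g : V -> R) : Ck k f -> Ck k g -> Ck k (f \* g).
Proof.
elim: k f g => [|k IH] f g kf kg; have [cf df] := kf; have [cg dg] := kg.
  by split => // x; apply: cvgM; [exact: cf|exact: cg].
split; first by move=> x; apply: cvgM; [exact: cf|exact: cg].
move=> v; have [f1 f2] := df v; have [g1 g2] := dg v.
split; first by move=> x; exact: derivableM.
rewrite (_ : 'D_v _ = (f \* 'D_v g) \+ (g \* 'D_v f)).
  by apply: Ck_add; apply: IH => //; exact: CkW.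
by apply/funext => x; exact: deriveM.
Qed.

Lemma derive_lineE V (f : V -> R) x v :
  (derivable f x v <-> derivable (fun t : R => f (t *: v + x)) 0 1) /\
  'D_v f x = 'D_1 (fun t : R => f (t *: v + x)) 0.
Proof.
have E : (fun h : R => h^-1 *: ((f \o shift x) (h *: v) - f x)) =
  (fun h : R => h^-1 *: (((fun t : R => f (t *: v + x)) \o shift 0) (h *: 1) -
     f (0 *: v + x))).
  apply/funext => h /=.
  by rewrite /shift /= addr0 scale0r add0r; congr (_ *: (f (_ *: _ + _) - _)); rewrite /GRing.scale/= mulr1.
by rewrite /derivable /derive E.
Qed.

Lemma is_derive_comp V (f : V -> R) (h : R -> R) x v :
  derivable f x v -> derivable h (f x) 1 ->
  derivable (h \o f) x v /\ 'D_v (h \o f) x = h^`()%classic (f x) * 'D_v f x.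
Proof.
move=> dfx dh; have [[+ _] ->] := derive_lineE f x v; move=> /(_ dfx) df.
have [[_ +] ->] := derive_lineE (h \o f) x v.
have e0 : f (0 *: v + x) = f x by rewrite scale0r add0r.
have H : is_derive (0 : R) 1 (h \o (fun t : R => f (t *: v + x)))
    (h^`()%classic (f x) * 'D_1 (fun t : R => f (t *: v + x)) 0).
  apply: is_derive1_comp; last exact: DeriveDef.
  by rewrite e0 derive1E; exact: DeriveDef.
by move=> K; split; [apply: K; exact: (@ex_derive _ _ _ _ _ _ _ H)|exact: (@derive_val _ _ _ _ _ _ _ H)].
Qed.

Lemma Ck_comp_family V (I : Type) (h : I -> R -> R) (U : set R)
    (c : I -> (R * I) * (R * I)) :
  (forall i t, U t -> derivable (h i) t 1) ->
  (forall i t, U t -> (h i)^`()%classic t =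
     (c i).1.1 * h (c i).1.2 t + (c i).2.1 * h (c i).2.2 t) ->
  forall k i (f : V -> R), (forall x, U (f x)) -> Ck k f -> Ck k (h i \o f).
Proof.
move=> dh hc k; elim: k => [|k IH] i f Uf kf.
  split=> // x; apply: continuous_comp; first exact: (Ck_continuous kf).
  by apply/differentiable_continuous/derivable1_diffP; exact: dh.
have [cf df] := kf.
split.
  move=> x; apply: continuous_comp; first exact: (Ck_continuous kf).
  by apply/differentiable_continuous/derivable1_diffP; exact: dh.
move=> v; have [f1 f2] := df v; split.
  by move=> x; apply: (is_derive_comp _ _).1 => //; exact: dh.
rewrite (_ : 'D_v _ =
  ((cst (c i).1.1 \* (h (c i).1.2 \o f)) \+ (cst (c i).2.1 \* (h (c i).2.2 \o f))) \* 'D_v f).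
  apply: Ck_mul => //.
  by apply: Ck_add; (apply: Ck_mul; [exact: Ck_cst|apply: IH => //; exact: CkW]).
apply/funext => x; rewrite (is_derive_comp _ _).2//; last exact: dh.
by rewrite hc.
Qed.

Lemma Ck_comp_affine V W k (A : W -> V) (L : W -> V) (f : V -> R) :
  continuous A -> (forall (t : R) w x, A (t *: w + x) = t *: L w + A x) ->
  Ck k f -> Ck k (f \o A).
Proof.
move=> cA AL; elim: k f => [|k IH] f kf.
  by split=> // x; apply: continuous_comp; [exact: cA|exact: (Ck_continuous kf)].
have [cf df] := kf.
have E v x : (fun h : R => h^-1 *: (((f \o A) \o shift x) (h *: v) - (f \o A) x)) =
  (fun h : R => h^-1 *: ((f \o shift (A x)) (h *: L v) - f (A x))).
  by apply/funext => h /=; rewrite AL.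
split; first by move=> x; apply: continuous_comp; [exact: cA|exact: (Ck_continuous kf)].
move=> v; split.
  by move=> x; rewrite /derivable E; exact: (df (L v)).1.
rewrite (_ : 'D_v _ = 'D_(L v) f \o A); first by apply: IH; exact: (df (L v)).2.
by apply/funext => x; rewrite /derive E.
Qed.

Lemma derive_comp_affine V W (A : W -> V) (L : W -> V) (f : V -> R) v x :
  (forall (t : R) w x, A (t *: w + x) = t *: L w + A x) ->
  'D_v (f \o A) x = 'D_(L v) f (A x).
Proof.
move=> AL; rewrite /derive.
rewrite (_ : (fun h : R => h^-1 *: (((f \o A) \o shift x) (h *: v) - (f \o A) x)) =
  (fun h : R => h^-1 *: ((f \o shift (A x)) (h *: L v) - f (A x))))//.
by apply/funext => h /=; rewrite AL.
Qed.

Lemma smooth_cst V (c : R) : smooth (cst c : V -> R).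
Proof. by move=> k; exact: Ck_cst. Qed.

Lemma smooth_add V (f g : V -> R) : smooth f -> smooth g -> smooth (f \+ g).
Proof. by move=> sf sg k; exact: Ck_add. Qed.

Lemma smooth_mul V (f g : V -> R) : smooth f -> smooth g -> smooth (f \* g).
Proof. by move=> sf sg k; exact: Ck_mul. Qed.

Lemma smooth_comp_affine V W (A : W -> V) (L : W -> V) (f : V -> R) :
  continuous A -> (forall (t : R) w x, A (t *: w + x) = t *: L w + A x) ->
  smooth f -> smooth (f \o A).
Proof. by move=> cA AL sf k; exact: (Ck_comp_affine cA AL). Qed.

Lemma smooth_sum V (I : Type) (r : seq I) (P : pred I) (f : I -> V -> R) :
  (forall i, smooth (f i)) -> smooth (fun x => \sum_(i <- r | P i) f i x).
Proof.
move=> sf; elim: r => [|i r IH].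
  by under eq_fun do rewrite big_nil; exact: smooth_cst.
under eq_fun do rewrite big_cons; case: (P i) => //.
exact: smooth_add.
Qed.

Lemma smooth_prod V (I : Type) (r : seq I) (P : pred I) (f : I -> V -> R) :
  (forall i, smooth (f i)) -> smooth (fun x => \prod_(i <- r | P i) f i x).
Proof.
move=> sf; elim: r => [|i r IH].
  by under eq_fun do rewrite big_nil; exact: smooth_cst.
under eq_fun do rewrite big_cons; case: (P i) => //.
exact: smooth_mul.
Qed.

Lemma smooth_powR V (f : V -> R) (a : R) :
  (forall x, 0 < f x) -> smooth f -> smooth (fun x => f x `^ a).
Proof.
move=> f0 sf k.
pose c (a : R) := ((a, a - 1), (0 : R, a)).
apply: (@Ck_comp_family V R (fun a t => t `^ a) [set t | 0 < t] c) => //.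
- by move=> i t t0; have [] := is_derive1_powR i t0.
- by move=> i t t0; have [_ H] := is_derive1_powR i t0; rewrite /= mul0r addr0 derive1E.
Qed.

Lemma smooth_coord m n (i : 'I_m) (j : 'I_n) :
  smooth (fun x : 'M[R]_(m, n) => x i j).
Proof.
case=> [|k]; (split => //; first exact: coord_continuous).
move=> v; have E x : 'D_v (fun x : 'M[R]_(m, n) => x i j) x = v i j /\ derivable (fun x : 'M[R]_(m, n) => x i j) x v.
  have : (h^-1 *: (((fun x : 'M[R]_(m, n) => x i j) \o shift x) (h *: v) - x i j)) @[h --> (0 : R)^'] --> v i j.
    apply: cvg_near_cst; near=> h.
    rewrite /= /shift !mxE addrK /GRing.scale/= mulKf//.
    by near: h; exact: nbhs_dnbhs_neq.
  by move=> H; split; [exact: cvg_lim|apply/cvg_ex; exists (v i j)].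
split => [x|]; first exact: (E x).2.
rewrite (_ : 'D_v _ = cst (v i j)); first exact: Ck_cst.
by apply/funext => x; exact: (E x).1.
Unshelve. all: by end_near. Qed.

End smooth.

(** * Smooth partitions into small cells *)

Section flat.
Variable R : realType.

(* The factor t^-n makes the family closed under differentiation. *)
Definition flat (n : nat) (t : R) : R :=
  if 0 < t then t^-1 ^+ n * expR (- t^-1) else 0.

Lemma flat_ge0 n t : 0 <= flat n t.
Proof.
rewrite /flat; case: ifP => // t0.
by rewrite mulr_ge0 ?expR_ge0// exprn_ge0// invr_ge0 ltW.
Qed.

Lemma flat_gt0 t : (0 < flat 0 t) = (0 < t).
Proof. by rewrite /flat; case: ifP => t0; rewrite ?ltxx// expr0 mul1r expR_gt0. Qed.

Lemma flat_eq0 t : (flat 0 t != 0) = (0 < t).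
Proof. by rewrite -flat_gt0 lt_neqAle flat_ge0 andbT eq_sym. Qed.

Lemma flat_le n t : flat n t <= n.+2`!%:R * t ^+ 2.
Proof.
rewrite /flat; case: ifPn => t0; last by rewrite mulr_ge0// sqr_ge0.
have u0 : 0 < t^-1 by rewrite invr_gt0.
rewrite expRN -[leLHS]/(_ / _) ler_pdivrMr ?expR_gt0//.
have F0 : n.+2`!%:R != 0 :> R by rewrite pnatr_eq0 -lt0n fact_gt0.
have -> : t^-1 ^+ n = n.+2`!%:R * t ^+ 2 * (t^-1 ^+ n.+2 / n.+2`!%:R).
  rewrite (exprS _ n.+1) (exprS _ n); set p := t^-1 ^+ n; field.
  by rewrite F0 gt_eqF.
rewrite ler_wpM2l ?mulr_ge0 ?exprn_ge0 ?(ltW t0)//.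
by apply: le_trans (@expR_ge1Dxn R (t^-1) n.+1 (ltW u0)); rewrite lerDr.
Qed.

Lemma is_derive_flat n (t : R) : is_derive t 1 (flat n)
  (1 * flat n.+2 t + (- n%:R) * flat n.+1 t).
Proof.
have [t0|t0|->] := ltgtP t 0.
- have flat0 k : flat k t = 0 by rewrite /flat ltNge (ltW t0).
  rewrite !flat0 !mulr0 addr0.
  apply: (@near_eq_is_derive _ _ _ (cst (0:R))).
  near=> s; rewrite /flat ifF//; apply/negbTE; rewrite -leNgt.
  by apply/ltW; near: s; exact: lt_nbhsl.
- have flatE k : flat k t = t^-1 ^+ k * expR (- t^-1) by rewrite /flat t0.
  rewrite !flatE.
  have tn0 : t != 0 by rewrite gt_eqF.
  have dV : is_derive t 1 (fun t : R => t^-1) (- t ^- 2 *: 1).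
    exact: (@is_deriveV _ id t 1 1).
  have dE : is_derive t 1 (expR \o (fun t : R => - t^-1)) (expR (- t^-1) * - (- t ^- 2 *: 1)).
    by apply: is_derive1_comp.
  have dX : is_derive t 1 ((fun t : R => t^-1) ^+ n) ((n%:R * t^-1 ^+ n.-1) *: (- t ^- 2 *: 1)).
    exact: is_deriveX.
  have dF := is_deriveM dX dE.
  have nE : \near t, (((fun t : R => t^-1) ^+ n) * (expR \o (fun t : R => - t^-1))) t = flat n t.
    near=> s; rewrite /flat ifT//; last by near: s; exact: lt_nbhsr.
    by rewrite /GRing.mul/= exprfctE.
  apply: is_derive_eq (near_eq_is_derive nE dF) _.
  rewrite exprfctE /GRing.scale/= !mulr1.
  case: n {dX dF nE} => [|k]; first by rewrite !expr0 /= -!exprVn; ring.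
  rewrite /= (exprS _ k.+2) (exprS _ k.+1) (exprS _ k).
  move: (t^-1 ^+ k) (expR _) (k.+1%:R : R) => p e q.
  by rewrite -!exprVn; ring.
- have flat0 k : flat k 0 = 0 by rewrite /flat ltxx.
  rewrite !flat0 !mulr0 addr0.
  have H : h^-1 *: ((flat n \o shift 0) (h *: (1:R)) - flat n 0) @[h --> (0 : R)^'] --> (0:R).
    apply/cvgr0Pnorm_le => e e0.
    have F0 : 0 < n.+2`!%:R :> R by rewrite ltr0n fact_gt0.
    near=> h.
    have h0 : h != 0 by near: h; exact: nbhs_dnbhs_neq.
    rewrite /= /shift addr0 [flat n 0]/flat ltxx subr0 /GRing.scale/= mulr1.
    rewrite normrM normfV ler_pdivrMl ?normr_gt0// (ger0_norm (flat_ge0 _ _)).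
    apply: (le_trans (flat_le _ _)).
    rewrite -(real_normK (num_real h)) expr2 mulrCA ler_wpM2l//.
    rewrite mulrC -ler_pdivlMr//.
    near: h; apply: dnbhs0_le; exact: divr_gt0.
  apply: DeriveDef; first by apply/cvg_ex; exists 0.
  exact: cvg_lim.
Unshelve. all: by end_near. Qed.


Lemma smooth_flat (V : normedModType R) (f : V -> R) :
  smooth f -> smooth (fun x => flat 0 (f x)).
Proof.
move=> sf k.
apply: (@Ck_comp_family _ V nat flat setT
  (fun n => ((1, n.+2), (- n%:R, n.+1)))) => //.
- by move=> i t _; have [] := is_derive_flat i t.
- by move=> i t _; have [_ H] := is_derive_flat i t; rewrite derive1E.
Qed.

End flat.

Section partition.
Variables (R : realType) (d : nat) (h r : R).
Hypotheses (h0 : 0 < h) (r0 : 0 < r).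
Let g := h / 2.
Let n := (Num.truncn (2 * r / g)).+1.
Let t_ (i : nat) := - r + i%:R * g.
Let bump1 (i : nat) (t : R) : R := flat 0 (g - (t - t_ i)) * flat 0 (g + (t - t_ i)).

Let g0 : 0 < g. Proof. by rewrite divr_gt0. Qed.

Let bump1_ge0 i t : 0 <= bump1 i t.
Proof. by rewrite mulr_ge0// flat_ge0. Qed.

Let bump1_eq0 i t : (bump1 i t != 0) = (`|t - t_ i| < g).
Proof.
rewrite mulf_eq0 negb_or !flat_eq0 ltr_norml subr_gt0 andbC; congr andb.
by rewrite -[RHS]subr_gt0 opprK addrC.
Qed.

Let bump1_ex t : `|t| <= r -> exists i : 'I_n, bump1 i t != 0.
Proof.
rewrite ler_norml => /andP[rt tr].
have tr0 : 0 <= (t + r) / g by rewrite divr_ge0 ?(ltW g0)// -lerBlDr sub0r.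
have le_n : (Num.truncn ((t + r) / g) < n)%N.
  rewrite ltnS le_truncn// ler_pM2r ?invr_gt0//.
  by rewrite mulr_natl mulr2n lerD2r.
exists (Ordinal le_n); rewrite bump1_eq0 /t_ /=.
have /andP[] := truncn_itv tr0.
set k := Num.truncn _; rewrite ler_pdivlMr// ltr_pdivrMr// => kt tk.
rewrite opprD opprK addrA ltr_norml; apply/andP; split.
  by rewrite (@lt_le_trans _ _ 0) ?oppr_lt0// subr_ge0.
by rewrite ltrBlDr (lt_le_trans tk)// -natr1 mulrDl mul1r addrC.
Qed.

Let K : finType := option {ffun 'I_d -> 'I_n}.

Let bump (k : K) (x : 'rV[R]_d) : R :=
  if k is Some c then \prod_j bump1 (c j) (x ord0 j)
  else \sum_j (flat 0 (x ord0 j - r) + flat 0 (- x ord0 j - r)).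

Let bump_ge0 k x : 0 <= bump k x.
Proof.
case: k => [c|]; first exact: prodr_ge0.
by apply: sumr_ge0 => j _; rewrite addr_ge0// flat_ge0.
Qed.

Let bump_none x : (bump None x != 0) -> r < `|x|.
Proof.
rewrite ltNge; apply: contra => xr; apply/eqP; apply: big1 => j _.
have := le_trans (ler_mx_coord x ord0 j) xr; rewrite ler_norml => /andP[a b].
have E t : t <= 0 -> flat 0 t = 0.
  by move=> t0; apply/eqP; apply: contraTT t0; rewrite flat_eq0 -ltNge.
by rewrite !E ?addr0// ?subr_le0// lerNl.
Qed.

Let bump_none_neq0 x : r < `|x| -> bump None x != 0.
Proof.
move=> xr; have [j jr] : exists j, r < `|x ord0 j|.
  apply: contrapT => /forallNP H; move: xr; rewrite ltNge => /negP; apply.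
  apply/mx_norm_leP; first exact: ltW.
  by move=> i j; rewrite (ord1 i) leNgt; apply/negP/H.
rewrite psumr_neq0 => [|j' _]; last by rewrite addr_ge0// flat_ge0.
apply/hasP; exists j; first by rewrite mem_index_enum.
move: jr; rewrite ltr_normr => /orP[jr|jr].
  by rewrite ltr_pwDl// ?flat_gt0 ?subr_gt0// flat_ge0.
by rewrite ltr_pwDr// ?flat_gt0 ?subr_gt0// flat_ge0.
Qed.

Let bump_some c x j : bump (Some c) x != 0 -> `|x ord0 j - t_ (c j)| < g.
Proof.
move=> bx; rewrite -bump1_eq0; apply: contra bx => /eqP b0.
by rewrite /bump (bigD1 j)//= b0 mul0r.
Qed.

Let S x := \sum_k bump k x ^+ 2.

Let S_gt0 x : 0 < S x.
Proof.
suff [k kx] : exists k, bump k x != 0.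
  rewrite /S (bigD1 k)//=; apply: ltr_pwDl.
    by rewrite exprn_even_gt0.
  by apply: sumr_ge0 => i _; rewrite sqr_ge0.
have [xr|xr] := leP `|x| r; last by exists None; exact: bump_none_neq0.
have c_ j : exists i : 'I_n, bump1 i (x ord0 j) != 0.
  by apply: bump1_ex; exact: (le_trans (ler_mx_coord x ord0 j) xr).
exists (Some [ffun j => projT1 (cid (c_ j))]).
by apply/prodf_neq0 => j _; rewrite ffunE; exact: (projT2 (cid (c_ j))).
Qed.

Let smooth_affine (j : 'I_d) (a b : R) :
  smooth (fun x : 'rV[R]_d => a * x ord0 j + b).
Proof.
apply: (@smooth_add _ _ (fun x : 'rV[R]_d => a * x ord0 j) (cst b)); last exact: smooth_cst.
by apply: (@smooth_mul _ _ (cst a)); [exact: smooth_cst|exact: smooth_coord].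
Qed.

Let smooth_bump k : smooth (bump k).
Proof.
case: k => [c|] /=.
  apply: smooth_prod => j.
  apply: (@smooth_mul _ _ (fun x : 'rV[R]_d => flat 0 (g - (x ord0 j - t_ (c j))))
     (fun x : 'rV[R]_d => flat 0 (g + (x ord0 j - t_ (c j))))); apply: smooth_flat.
    rewrite (_ : (fun x => _) = (fun x : 'rV[R]_d => (-1) * x ord0 j + (g + t_ (c j))));
      first exact: smooth_affine.
    by apply/funext => x; ring.
  rewrite (_ : (fun x => _) = (fun x : 'rV[R]_d => 1 * x ord0 j + (g - t_ (c j))));
    first exact: smooth_affine.
  by apply/funext => x; ring.
apply: smooth_sum => j.
apply: (@smooth_add _ _ (fun x : 'rV[R]_d => flat 0 (x ord0 j - r))
     (fun x : 'rV[R]_d => flat 0 (- x ord0 j - r))); apply: smooth_flat.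
  rewrite (_ : (fun x => _) = (fun x : 'rV[R]_d => 1 * x ord0 j + (- r)));
    first exact: smooth_affine.
  by apply/funext => x; ring.
rewrite (_ : (fun x => _) = (fun x : 'rV[R]_d => (-1) * x ord0 j + (- r)));
  first exact: smooth_affine.
by apply/funext => x; ring.
Qed.

Let theta k x := bump k x * S x `^ (- 2^-1).

Let theta_eq0 k x : (theta k x != 0) = (bump k x != 0).
Proof. by rewrite mulf_eq0 negb_or powR_eq0 (gt_eqF (S_gt0 x)) andbT. Qed.

Let smooth_theta k : smooth (theta k).
Proof.
apply: (@smooth_mul _ _ (bump k)) => //.
apply: smooth_powR => //.
by apply: smooth_sum => i; exact: (@smooth_mul _ _ (bump i) (bump i)).
Qed.

Let sum_theta x : \sum_k theta k x ^+ 2 = 1.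
Proof.
under eq_bigr do rewrite exprMn.
rewrite -mulr_suml -[X in X * _]/(S x) -powR_mulrn ?powR_ge0// -powRrM.
by rewrite mulNr mulVf ?pnatr_eq0// powR_inv1 ?(ltW (S_gt0 x))// mulfV// gt_eqF.
Qed.

Let theta_far k x : r + g < `|x| -> theta k x = if k is Some _ then 0 else 1.
Proof.
move=> xrg.
have b0 c : bump (Some c) x = 0.
  apply/eqP/negPn/negP => bx; move: xrg; rewrite ltNge => /negP; apply.
  apply/mx_norm_leP; first by rewrite addr_ge0 ?ltW.
  move=> i j; rewrite (ord1 i).
  have := bump_some j bx; rewrite ltr_norml => /andP[xg1 xg2].
  have /truncn_itv/andP[+ _] : 0 <= 2 * r / g by rewrite divr_ge0 ?mulr_ge0 ?ltW.
  rewrite ler_pdivlMr// => kr.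
  have ck : (c j)%:R * g <= (Num.truncn (2 * r / g))%:R * g.
    by rewrite ler_pM2r// ler_nat -ltnS.
  have c0 : 0 <= (c j)%:R * g by rewrite mulr_ge0 ?ler0n ?(ltW g0)//.
  by move: xg1 xg2; rewrite /t_ => xg1 xg2; rewrite ler_norml; apply/andP; split; lra.
case: k => [c|]; first by rewrite /theta b0 mul0r.
have Sx : S x = bump None x ^+ 2.
  rewrite /S (bigD1 None)//= -[RHS]addr0; congr (_ + _).
  by apply: big1 => -[c|]// _; rewrite b0 expr0n.
rewrite /theta Sx -powR_mulrn// -powRrM mulrN mulfV ?pnatr_eq0// powR_inv1//.
by rewrite mulfV// bump_none_neq0// (le_lt_trans _ xrg)// lerDl ltW.
Qed.

Let theta_derive_bounded k v : exists C, forall x, `|'D_v (theta k) x| <= C.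
Proof.
have D0 (x : 'rV[R]_d) : r + g < `|x| -> 'D_v (theta k) x = 0.
  move=> xrg.
  rewrite -[RHS](derive_cst (if k is Some _ then 0 else 1 : R) x v).
  apply: near_eq_derive; near=> y; apply: theta_far.
  near: y; move: xrg; rewrite -subr_gt0 => xrg.
  have H : \forall y \near x, `|x - id y| < `|x| - (r + g).
    by have [+ _] := @cvgrPdist_lt _ 'rV[R]_d _ (nbhs x) _ id x; apply => //; exact: cvg_id.
  near=> y; rewrite -subr_gt0.
  have xy : `|x - y| < `|x| - (r + g) by near: y; exact: H.
  by have := lerB_dist x y; lra.
have [C HC] : exists C, forall x : 'rV[R]_d, `|x| <= r + g -> `|'D_v (theta k) x| <= C.
  have cK : compact [set x : 'rV[R]_d | `|x| <= r + g].
    apply: bounded_closed_compact.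
      exists (r + g); split; first exact: num_real.
      by move=> M rM x /= xr; exact: le_trans (ltW rM).
    rewrite (_ : [set x | _] = (fun x : 'rV[R]_d => `|x|) @^-1` [set t | t <= r + g])//.
    apply: preimage_closed; last exact: closed_le.
    by move=> x _; exact: norm_continuous.
  have cD : continuous ('D_v (theta k)).
    exact: smooth_continuous (smooth_derive _ (smooth_theta k)).
  have : compact ('D_v (theta k) @` [set x : 'rV[R]_d | `|x| <= r + g]).
    by apply: continuous_compact => //; apply: continuous_subspaceT => x; exact: cD.
  move=> /compact_bounded[C [_ HC]].
  exists (C + 1) => x xr; apply: (HC (C + 1)); first by rewrite ltrDl.
  by exists x.
exists (Num.max C 0) => x; have [xr|xr] := leP `|x| (r + g).
  by rewrite le_max HC.
by rewrite D0// normr0 le_max lexx orbT.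
Unshelve. all: by end_near. Qed.

Lemma smooth_partition : exists (K : finType) (theta : K -> 'rV[R]_d -> R),
  [/\ forall k, smooth (theta k), forall x, \sum_k theta k x ^+ 2 = 1,
     forall k v, exists C, forall x, `|'D_v (theta k) x| <= C &
     forall k, (forall x y, theta k x != 0 -> theta k y != 0 -> `|x - y| <= h) \/
               (forall x, theta k x != 0 -> r <= `|x|)].
Proof.
exists K, theta; split;
  [exact: smooth_theta|exact: sum_theta|exact: theta_derive_bounded|].
move=> [c|]; [left => x y tx ty|right => x tx].
  have bx : bump (Some c) x != 0 := etrans (esym (theta_eq0 (Some c) x)) tx.
  have by_ : bump (Some c) y != 0 := etrans (esym (theta_eq0 (Some c) y)) ty.
  apply/mx_norm_leP; first exact: ltW.
  move=> i j; rewrite (ord1 i) !mxE.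
  have xt := ltW (bump_some j bx); have yt := ltW (bump_some j by_).
  apply: le_trans (ler_distD (t_ (c j)) _ _) _.
  rewrite [X in _ <= X](splitr h); apply: lerD; first exact: xt.
  by rewrite distrC; exact: yt.
exact/ltW/bump_none/(etrans (esym (theta_eq0 None x)) tx).
Qed.

End partition.

(** * Square-integrable functions *)

Section L2.
Context {dd : measure_display} {T : measurableType dd} {R : realType}.
Variable mu : {measure set T -> \bar R}.
Implicit Types f g : T -> R.

Lemma L2P f : f \in Lfun mu 2%:E <->
  measurable_fun setT f /\ (\int[mu]_x (f x ^+ 2)%:E < +oo)%E.
Proof.
have E : (\int[mu]_x (`|f x| `^ 2)%:E = \int[mu]_x (f x ^+ 2)%:E)%E.
  by apply: eq_integral => x _; rewrite powR_mulrn// real_normK ?num_real.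
split=> [f2|[mf foo]].
  move: (f2); rewrite inE => /andP[]; rewrite inE/= => mf _; split => //.
  have /integrableP[_] := Lfun2_integrable_sqr f2.
  apply: le_lt_trans; apply: ge0_le_integral => //.
  - by move=> x _; rewrite lee_fin sqr_ge0.
  - by apply/measurable_EFinP; exact: measurable_funX.
  - apply: measurableT_comp => //; apply/measurable_EFinP; exact: measurable_funX.
  - by move=> x _; rewrite /= ger0_norm// sqr_ge0.
rewrite inE; apply/andP; split; rewrite inE//= /finite_norm unlock.
by rewrite poweR_lty//= E.
Qed.

Lemma L2_measurable f : f \in Lfun mu 2%:E -> measurable_fun setT f.
Proof. by move=> /L2P[]. Qed.

Lemma L2_dominated f g C : measurable_fun setT f -> g \in Lfun mu 2%:E ->
  (forall x, `|f x| <= C * `|g x|) -> f \in Lfun mu 2%:E.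
Proof.
move=> mf /L2P[mg goo] fg; apply/L2P; split => //.
apply: (@le_lt_trans _ _ (\int[mu]_x ((C ^+ 2)%:E * (g x ^+ 2)%:E)))%E.
  apply: ge0_le_integral => //.
  - by move=> x _; rewrite lee_fin sqr_ge0.
  - by apply/measurable_EFinP; exact: measurable_funX.
  - by apply/measurable_EFinP; apply: measurable_funM => //; exact: measurable_funX.
  - move=> x _; rewrite -EFinM lee_fin -(real_normK (num_real (f x))).
    rewrite -(real_normK (num_real (g x))) -exprMn lerXn2r ?nnegrE//.
    exact: le_trans (fg x).
rewrite ge0_integralZl//; last 3 first.
- by apply/measurable_EFinP; exact: measurable_funX.
- by move=> x _; rewrite lee_fin sqr_ge0.
- by rewrite lee_fin sqr_ge0.
by rewrite lte_mul_pinfty// lee_fin sqr_ge0.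
Qed.

Lemma L2_add f g : f \in Lfun mu 2%:E -> g \in Lfun mu 2%:E ->
  f \+ g \in Lfun mu 2%:E.
Proof. by move=> f2 g2; apply: (Lfun_addr_closed mu _).2 => //; rewrite lee1n. Qed.

Lemma L2_mul_integrable f g : f \in Lfun mu 2%:E -> g \in Lfun mu 2%:E ->
  mu.-integrable setT (EFin \o (fun x => f x * g x)).
Proof. by move=> f2 g2; apply/Lfun1_integrable; exact: Lfun2_mul_Lfun1. Qed.

Lemma Rintegral_dominated_cvg (h_ : nat -> T -> R) (h G : T -> R) :
  (forall k, measurable_fun setT (h_ k)) ->
  (forall x, h_ k x @[k --> \oo] --> h x) ->
  mu.-integrable setT (EFin \o G) -> (forall k x, `|h_ k x| <= G x) ->
  (\int[mu]_x h_ k x)%R @[k --> \oo] --> (\int[mu]_x h x)%R.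
Proof.
move=> mh hcvg iG hG.
have mlim : measurable_fun setT h.
  by apply: (measurable_fun_cvg mh) => x _; exact: hcvg.
have mhE k : measurable_fun setT (EFin \o h_ k) by exact/measurable_EFinP.
have mlE : measurable_fun setT (EFin \o h) by exact/measurable_EFinP.
have ae1 : {ae mu, forall x, setT x -> (EFin \o h_ k) x @[k --> \oo] --> (EFin \o h) x}.
  apply: aeW => x _; apply/fine_cvgP; split; first exact: nearW.
  exact: hcvg.
have ae2 : {ae mu, forall x, forall k, setT x -> (`|(EFin \o h_ k) x| <= (EFin \o G) x)%E}.
  by apply: aeW => x k _; rewrite lee_fin.
have [ih _ H] := dominated_convergence measurableT mhE mlE ae1 iG ae2.
apply: fine_cvg; rewrite fineK//; exact: (integrable_fin_num _ ih).
Qed.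

End L2.

Section test_functions.
Variable R : realType.

Lemma continuous_measurable_mx m n (f : 'M[R]_(m, n) -> R) :
  continuous f -> measurable_fun setT f.
Proof.
move=> cf; apply: (measurability _ (RGenOpens.measurableE R)) => _ [_ [a [b ->]] <-].
rewrite setTI; apply: sub_sigma_algebra.
by apply: open_comp => [x _|]; [exact: cf|exact: interval_open].
Qed.

Lemma open_measurable_mx m n (A : set 'M[R]_(m, n)) : open A -> measurable A.
Proof. exact: sub_sigma_algebra. Qed.

Lemma measurable_norm_le m n (C : R) :
  measurable [set x : 'M[R]_(m, n) | (`|x| <= C)%R].
Proof.
rewrite (_ : mkset _ = ~` [set x | (C < `|x|)%R]); last first.
  by apply/seteqP; split => x /=; rewrite leNgt => /negP.
apply: measurableC; apply: open_measurable_mx.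
rewrite (_ : mkset _ = (fun x : 'M[R]_(m, n) => `|x|) @^-1` [set t | C < t])//.
apply: open_comp; last exact: open_gt.
by move=> x _; exact: norm_continuous.
Qed.

Lemma lebesgue_mx_bounded m n (C : R) :
  (lebesgue_mx R m n [set x | (`|x| <= C)%R] < +oo)%E.
Proof.
pose B : set 'M[R]_(m, n) := [set M | forall i j, `[- C, C]%classic (M i j)].
have mB : measurable B by exact: (@measurable_mx_box _ _ _ (fun _ _ => `[- C, C]%classic)).
have Boo : (lebesgue_mx R m n B < +oo)%E.
  have E := @lebesgue_mx_box R n m (fun _ _ => `[- C, C]%classic)
    (fun _ _ => measurable_itv _).
  rewrite [X in (X < _)%E]E.
  rewrite ltey_eq prode_fin_num// => i _; rewrite prode_fin_num// => j _.
  by rewrite lebesgue_measure_itv/=; case: ifP.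
apply: le_lt_trans Boo; apply: le_measure; rewrite ?inE//.
  exact: measurable_norm_le.
by move=> x /= xC i j; rewrite /= in_itv/= -ler_norml (le_trans (ler_mx_coord _ _ _)).
Qed.

Definition support_closure (V : normedModType R) (phi : V -> R) :=
  closure [set x | phi x != 0].

Lemma test_sub (V : normedModType R) (phi psi : V -> R) :
  test_function phi -> smooth psi ->
  (forall x, psi x != 0 -> support_closure phi x) -> test_function psi.
Proof.
move=> [_ cphi] spsi sub; split => //.
apply: (subclosed_compact _ cphi); first exact: closed_closure.
by rewrite [X in _ `<=` X](closure_id _).1; [exact: closure_subset|exact: closed_closure].
Qed.

Lemma test_derive (V : normedModType R) (phi : V -> R) v :
  test_function phi -> test_function ('D_v phi).
Proof.
move=> tphi; apply: (test_sub tphi); first exact: smooth_derive tphi.1.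
move=> x; apply: contra_neqP => xphi.
rewrite -[RHS](derive_cst (0 : R) x v); apply: near_eq_derive.
have : nbhs x (~` support_closure phi).
  by apply: open_nbhs_nbhs; split => //; apply: closed_openC; exact: closed_closure.
apply: filterS => y yphi; apply/eqP; apply: contrapT => /negP y0; apply: yphi.
exact: subset_closure.
Qed.

Lemma test_mul (V : normedModType R) (g phi : V -> R) :
  smooth g -> test_function phi -> test_function (g \* phi).
Proof.
move=> sg tphi; apply: (test_sub tphi); first exact: smooth_mul sg tphi.1.
move=> x; rewrite mulf_eq0 negb_or => /andP[_ px].
exact: subset_closure.
Qed.

Lemma test_L2 m n (phi : 'M[R]_(m, n) -> R) : test_function phi ->
  phi \in Lfun (lebesgue_mx R m n) 2%:E.
Proof.
move=> [sphi cphi].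
have cp : continuous phi := smooth_continuous sphi.
have mp := continuous_measurable_mx cp.
have [C [_ HC]] : bounded_set (support_closure phi) := compact_bounded cphi.
have : compact (phi @` support_closure phi).
  by apply: continuous_compact => //; apply: continuous_subspaceT => x; exact: cp.
move=> /compact_bounded[D [_ HD]].
pose B : set 'M[R]_(m, n) := [set x | (`|x| <= C + 1)%R].
have mB : measurable B by exact: measurable_norm_le.
apply/L2P; split => //.
apply: (@le_lt_trans _ _ (\int[lebesgue_mx R m n]_(x in B) ((D + 1) ^+ 2)%:E))%E.
  rewrite [X in (_ <= X)%E]integral_mkcond; apply: ge0_le_integral => //.
  - by move=> x _; rewrite lee_fin sqr_ge0.
  - by apply/measurable_EFinP; exact: measurable_funX.
  - by apply/(measurable_restrictT _ mB); exact: measurable_cst.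
  - move=> x _; rewrite patchE; have [p0|p0] := eqVneq (phi x) 0.
      by rewrite p0 expr0n/=; case: ifP => // _; rewrite lee_fin sqr_ge0.
    have sx : support_closure phi x by exact: subset_closure.
    rewrite mem_set; last by apply: (HC (C + 1)) => //; rewrite ltrDl.
    rewrite lee_fin -(real_normK (num_real (phi x))) lerXn2r ?nnegrE//.
      by apply: le_trans (HD (D + 1) _ (phi x) _); rewrite ?ltrDl//; exists x.
    by apply: (HD (D + 1)); rewrite ?ltrDl//; exists x.
rewrite integral_cst// lte_mul_pinfty//; first by rewrite lee_fin sqr_ge0.
exact: lebesgue_mx_bounded.
Qed.

End test_functions.

(** * Weak derivatives of tensor products *)

Section tensor.
Variable R : realType.

Lemma continuous_mxP (T : topologicalType) m n (f : T -> 'M[R]_(m, n)) :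
  (forall i j, continuous (fun x => f x i j)) -> continuous f.
Proof.
move=> cf x A [P MP PA]; rewrite /nbhs/=.
have H : \forall y \near x, forall i j, P i j (f y i j).
  by apply: filter_forall => i; apply: filter_forall => j; exact: (cf i j x _ (MP i j)).
by apply: filterS H => y Hy; exact: PA.
Qed.

Lemma continuous_col_mxr n d (v : 'rV[R]_d) :
  continuous (fun y : 'M[R]_(n, d) => col_mx v y : 'M[R]_(n.+1, d)).
Proof.
apply: continuous_mxP => i j; under eq_fun do rewrite mxE.
case: (fintype.split _) => k /=; first exact: cst_continuous.
exact: coord_continuous.
Qed.

Lemma continuous_col_mxl n d (y : 'M[R]_(n, d)) :
  continuous (fun v : 'rV[R]_d => col_mx v y : 'M[R]_(n.+1, d)).
Proof.
apply: continuous_mxP => i j; under eq_fun do rewrite mxE.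
case: (fintype.split _) => k /=; last exact: cst_continuous.
exact: coord_continuous.
Qed.

Lemma test_comp_section (V W : normedModType R) (A : W -> V) (B : V -> W)
    (L : W -> W -> V) (phi : V -> R) :
  continuous A -> continuous B -> cancel A B ->
  (forall w0 (t : R) w x, A (t *: w + x) = t *: L w0 w + A x) ->
  test_function phi -> test_function (phi \o A).
Proof.
move=> cA cB AK AL [sphi cphi]; split; first exact: (smooth_comp_affine cA (AL 0) sphi).
have cBK : compact (B @` support_closure phi).
  by apply: continuous_compact => //; apply: continuous_subspaceT => x; exact: cB.
apply: (subclosed_compact _ cBK); first exact: closed_closure.
have cl : closed (A @^-1` support_closure phi).
  apply: preimage_closed; last exact: closed_closure.
  by move=> x _; exact: cA.
move=> w wS; exists (A w); last exact: AK.
have : closure (A @^-1` support_closure phi) w.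
  by apply: closure_subset wS => x /= px; exact: subset_closure.
by have <- := (closure_id _).1 cl.
Qed.

Lemma col_mx_linr n d (v : 'rV[R]_d) (t : R) (w x : 'M[R]_(n, d)) :
  col_mx v (t *: w + x) = t *: col_mx 0 w + col_mx v x.
Proof. by rewrite scale_col_mx add_col_mx scaler0 add0r. Qed.

Lemma col_mx_linl n d (y : 'M[R]_(n, d)) (t : R) (w x : 'rV[R]_d) :
  col_mx (t *: w + x) y = t *: col_mx w 0 + col_mx x y.
Proof. by rewrite scale_col_mx add_col_mx scaler0 add0r. Qed.

Lemma test_sectionr n d (v : 'rV[R]_d) (phi : 'M[R]_(n.+1, d) -> R) :
  test_function phi -> test_function (fun y : 'M[R]_(n, d) => phi (col_mx v y)).
Proof.
move=> tphi; apply: (@test_comp_section 'M[R]_(n.+1, d) 'M[R]_(n, d)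
  (fun y => col_mx v y) (fun x => @dsubmx R 1 n d x) (fun _ w => col_mx (0 : 'rV[R]_d) w)
  phi _ _ _ _ tphi).
- exact: continuous_col_mxr.
- by apply: continuous_mxP => i j; under eq_fun do rewrite mxE; exact: coord_continuous.
- by move=> y; rewrite col_mxKd.
- by move=> _ t w x; exact: col_mx_linr.
Qed.

Lemma test_sectionl n d (y : 'M[R]_(n, d)) (phi : 'M[R]_(n.+1, d) -> R) :
  test_function phi -> test_function (fun v : 'rV[R]_d => phi (col_mx v y)).
Proof.
move=> tphi; apply: (@test_comp_section 'M[R]_(n.+1, d) 'rV[R]_d
  (fun v => col_mx v y) (fun x => @usubmx R 1 n d x) (fun _ w => col_mx w (0 : 'M[R]_(n, d)))
  phi _ _ _ _ tphi).
- exact: continuous_col_mxl.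
- by apply: continuous_mxP => i j; under eq_fun do rewrite mxE; exact: coord_continuous.
- by move=> v; rewrite col_mxKu.
- by move=> _ t w x; exact: col_mx_linl.
Qed.

Definition tensor n d (s : 'rV[R]_d -> R) (f : 'M[R]_(n, d) -> R)
  (x : 'M[R]_(n.+1, d)) : R := s (@usubmx R 1 n d x) * f (@dsubmx R 1 n d x).

Lemma tensorE n d (s : 'rV[R]_d -> R) (f : 'M[R]_(n, d) -> R)
    (v : 'rV[R]_d) (y : 'M[R]_(n, d)) :
  tensor s f (col_mx v y) = s v * f y.
Proof. by rewrite /tensor col_mxKu col_mxKd. Qed.

Lemma L2_tensor n d (s : 'rV[R]_d -> R) (f : 'M[R]_(n, d) -> R) :
  s \in Lfun (lebesgue_mx R 1 d) 2%:E -> f \in Lfun (lebesgue_mx R n d) 2%:E ->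
  tensor s f \in Lfun (lebesgue_mx R n.+1 d) 2%:E.
Proof.
move=> /L2P[ms soo] /L2P[mf foo].
have mt : measurable_fun setT (tensor s f).
  apply: measurable_funM.
    apply: (measurableT_comp ms); apply: measurable_fun_mx => i j.
    by under eq_fun do rewrite mxE; exact: measurable_mx_coord.
  apply: (measurableT_comp mf); apply: measurable_fun_mx => i j.
  by under eq_fun do rewrite mxE; exact: measurable_mx_coord.
apply/L2P; split => //.
rewrite mx_tonelli1//; last 2 first.
- by apply/measurable_EFinP; exact: measurable_funX.
- by move=> x; rewrite lee_fin sqr_ge0.
under eq_integral => v _.
  under eq_integral => y _ do rewrite tensorE exprMn EFinM.
  rewrite ge0_integralZl//; last 3 first.
  - by apply/measurable_EFinP; exact: measurable_funX.
  - by move=> x _; rewrite lee_fin sqr_ge0.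
  - by rewrite lee_fin sqr_ge0.
  over.
rewrite ge0_integralZr//; last 3 first.
- by apply/measurable_EFinP; exact: measurable_funX.
- by move=> x _; rewrite lee_fin sqr_ge0.
- by apply: integral_ge0 => x _; rewrite lee_fin sqr_ge0.
rewrite lte_mul_pinfty// ?ge0_fin_numE//; by apply: integral_ge0 => x _; rewrite lee_fin sqr_ge0.
Qed.

Lemma weak_derivative_tensorl n d j (s s' : 'rV[R]_d -> R) (f : 'M[R]_(n, d) -> R) :
  s \in Lfun (lebesgue_mx R 1 d) 2%:E -> f \in Lfun (lebesgue_mx R n d) 2%:E ->
  is_weak_derivative (delta_mx ord0 j) s s' ->
  is_weak_derivative (delta_mx ord0 j) (tensor s f) (tensor s' f).
Proof.
move=> s2 f2 [s'2 sw]; split; first exact: L2_tensor.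
move=> phi tphi.
have Dt v : test_function ('D_v phi) by exact: test_derive.
apply: mx_Rintegral_opp2.
- by apply: L2_mul_integrable; [exact: L2_tensor|exact: test_L2].
- by apply: L2_mul_integrable; [exact: L2_tensor|exact: test_L2].
move=> y.
have tpy := test_sectionl y tphi.
have E (v : 'rV[R]_d) : 'D_(delta_mx ord0 j) phi (col_mx v y) =
    'D_(delta_mx ord0 j) (fun v : 'rV[R]_d => phi (col_mx v y)) v.
  rewrite [RHS](derive_comp_affine (A := fun v : 'rV[R]_d => col_mx v y : 'M[R]_(n.+1, d)) (L := fun w => col_mx w (0 : 'M[R]_(n, d)))).
    congr ('D_ _ _ _); apply/matrixP => i k; rewrite !mxE.
    by case: splitP => l il; rewrite !mxE -?val_eqE/= il// ord1.
  by move=> t w x; exact: col_mx_linl.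
under eq_Rintegral => v _ do rewrite tensorE E -mulrA mulrCA.
under [in RHS]eq_Rintegral => v _ do rewrite tensorE -mulrA mulrCA.
rewrite RintegralZl//; last by apply: L2_mul_integrable => //; apply: test_L2; exact: test_derive.
rewrite RintegralZl//; last by apply: L2_mul_integrable => //; apply: test_L2.
by rewrite sw// mulrN.
Qed.

Lemma weak_derivative_tensorr n d i j (s : 'rV[R]_d -> R) (f f' : 'M[R]_(n, d) -> R) :
  s \in Lfun (lebesgue_mx R 1 d) 2%:E -> f \in Lfun (lebesgue_mx R n d) 2%:E ->
  is_weak_derivative (delta_mx i j) f f' ->
  is_weak_derivative (delta_mx (lift ord0 i) j) (tensor s f) (tensor s f').
Proof.
move=> s2 f2 [f'2 fw]; split; first exact: L2_tensor.
move=> phi tphi.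
have Dt v : test_function ('D_v phi) by exact: test_derive.
apply: mx_Rintegral_opp1.
- by apply: L2_mul_integrable; [exact: L2_tensor|exact: test_L2].
- by apply: L2_mul_integrable; [exact: L2_tensor|exact: test_L2].
move=> v.
have tpy := test_sectionr v tphi.
have E (y : 'M[R]_(n, d)) : 'D_(delta_mx (lift ord0 i) j) phi (col_mx v y) =
    'D_(delta_mx i j) (fun y : 'M[R]_(n, d) => phi (col_mx v y)) y.
  rewrite [RHS](derive_comp_affine (A := fun y : 'M[R]_(n, d) => col_mx v y : 'M[R]_(n.+1, d)) (L := fun w => col_mx (0 : 'rV[R]_d) w)).
    congr ('D_ _ _ _); apply/matrixP => i' k; rewrite !mxE.
    case: splitP => l il; rewrite !mxE -?val_eqE/= il /bump leq0n.
      by case: l {il} => -[].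
    by rewrite eqn_add2l.
  by move=> t w x; exact: col_mx_linr.
under eq_Rintegral => y _ do rewrite tensorE E -mulrA.
under [in RHS]eq_Rintegral => y _ do rewrite tensorE -mulrA.
rewrite RintegralZl//; last by apply: L2_mul_integrable => //; apply: test_L2; exact: test_derive.
rewrite RintegralZl//; last by apply: L2_mul_integrable => //; apply: test_L2.
by rewrite fw// mulrN.
Qed.

Definition prod_rows n d (s : 'rV[R]_d -> R) (x : 'M[R]_(n, d)) : R :=
  \prod_(i < n) s (row i x).

Lemma prod_rowsS n d (s : 'rV[R]_d -> R) :
  @prod_rows n.+1 d s = tensor s (@prod_rows n d s).
Proof.
apply/funext => x; rewrite /prod_rows /tensor big_ord_recl; congr (s _ * _).
  by apply/matrixP => i j; rewrite !mxE (ord1 i); congr (x _ _); apply/val_inj.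
apply: eq_bigr => i _; congr (s _); apply/matrixP => k j; rewrite !mxE.
by congr (x _ _); apply/val_inj; rewrite /= /bump leq0n.
Qed.

Lemma prod_rows0 d (s : 'rV[R]_d -> R) : @prod_rows 0 d s = cst 1.
Proof. by apply/funext => x; rewrite /prod_rows big_ord0. Qed.

Lemma L2_prod_rows n d (s : 'rV[R]_d -> R) :
  s \in Lfun (lebesgue_mx R 1 d) 2%:E ->
  @prod_rows n d s \in Lfun (lebesgue_mx R n d) 2%:E.
Proof.
move=> s2; elim: n => [|n IH]; last by rewrite prod_rowsS; exact: L2_tensor.
rewrite prod_rows0; apply/L2P; split => //.
rewrite (eq_integral (cst 1%E)); last by move=> x _; rewrite /= expr1n.
by rewrite integral_cst//= diracT mule1 ltry.
Qed.

Lemma prod_rows_H1 n d (s : 'rV[R]_d -> R) : H1 s -> H1 (@prod_rows n d s).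
Proof.
case=> s2 sw; split; first exact: L2_prod_rows.
elim: n => [|n IH] i j; first by case: i => -[].
rewrite prod_rowsS; have [i'|->] := unliftP ord0 i.
  move=> ->; have [f' fw] := IH i' j.
  by exists (tensor s f'); apply: weak_derivative_tensorr => //; exact: L2_prod_rows.
have [s' sw'] := sw ord0 j.
by exists (tensor s' (@prod_rows n d s)); apply: weak_derivative_tensorl => //; exact: L2_prod_rows.
Qed.

End tensor.

(** * Products with amplitudes *)

Section product.
Context {R : realType} {m n : nat}.
Local Notation V := 'M[R]_(m, n).
Local Notation mu := (lebesgue_mx R m n).

Lemma smooth_measurable (f : V -> R) : smooth f -> measurable_fun setT f.
Proof. by move=> /smooth_continuous/continuous_measurable_mx. Qed.

Lemma weak_derivative_mul_lim (f f' : V -> R) (v : V) (g_ : nat -> V -> R)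
    (g g' : V -> R) (C : R) :
  f \in Lfun mu 2%:E -> is_weak_derivative v f f' ->
  (forall k, smooth (g_ k)) ->
  (forall k x, `|g_ k x| <= C) -> (forall k x, `|'D_v (g_ k) x| <= C) ->
  (forall x, g_ k x @[k --> \oo] --> g x) ->
  (forall x, 'D_v (g_ k) x @[k --> \oo] --> g' x) ->
  f \* g \in Lfun mu 2%:E /\
  is_weak_derivative v (f \* g) (fun x => f' x * g x + f x * g' x).
Proof.
move=> f2 [f'2 fw] sg gC dgC gcvg dgcvg.
have mg_ k := smooth_measurable (sg k).
have mdg_ k := smooth_measurable (smooth_derive v (sg k)).
have mg : measurable_fun setT g by apply: (measurable_fun_cvg mg_) => x _; exact: gcvg.
have mg' : measurable_fun setT g' by apply: (measurable_fun_cvg mdg_) => x _; exact: dgcvg.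
have bnd (h_ : nat -> V -> R) h : (forall k x, `|h_ k x| <= C) ->
    (forall x, h_ k x @[k --> \oo] --> h x) -> forall x, `|h x| <= C.
  move=> hC hcvg x; have H : `|h_ k x| @[k --> \oo] --> `|h x| by apply: cvg_norm; exact: hcvg.
  rewrite -(cvg_lim _ H)//; apply: limr_le; first by apply/cvg_ex; exists `|h x|.
  by apply: nearW => k; exact: hC.
have gC' := bnd _ _ gC gcvg; have g'C := bnd _ _ dgC dgcvg.
have L2b (h k : V -> R) : h \in Lfun mu 2%:E -> measurable_fun setT k -> (forall x, `|k x| <= C) ->
    (fun x => h x * k x) \in Lfun mu 2%:E.
  move=> h2 mk kC; apply: (@L2_dominated _ _ _ _ _ h C) => //.
    by apply: measurable_funM => //; exact: L2_measurable h2.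
  by move=> x; rewrite normrM mulrC ler_wpM2r.
split; first exact: L2b.
split; first by apply: L2_add; apply: L2b.
move=> phi tphi.
have phi2 := test_L2 tphi.
have dphi2 : 'D_v phi \in Lfun mu 2%:E by apply: test_L2; exact: test_derive.
have mf := L2_measurable f2.
have mf' := L2_measurable f'2.
have mphi := L2_measurable phi2.
have mdphi := L2_measurable dphi2.
have int2 (h k : V -> R) : h \in Lfun mu 2%:E -> k \in Lfun mu 2%:E ->
   mu.-integrable setT (EFin \o (fun x => h x * k x)) by exact: L2_mul_integrable.
have key k : \int[mu]_x (f x * g_ k x * 'D_v phi x) =
    - \int[mu]_x ((f' x * g_ k x + f x * 'D_v (g_ k) x) * phi x).
  have tg : test_function (g_ k \* phi) by exact: test_mul.
  have := fw _ tg.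
  have E x : 'D_v (g_ k \* phi) x = g_ k x * 'D_v phi x + phi x * 'D_v (g_ k) x.
    have := @deriveM R _ (g_ k) phi x v (@smooth_derivable _ _ _ v x (sg k)) (@smooth_derivable _ _ _ v x tphi.1).
    by rewrite /GRing.scale/=.
  have E' x : f x * 'D_v (g_ k \* phi) x =
      f x * g_ k x * 'D_v phi x + f x * 'D_v (g_ k) x * phi x by rewrite E; ring.
  under eq_Rintegral => x _ do rewrite E'.
  rewrite (RintegralD measurableT (int2 _ _ (L2b f (g_ k) f2 (mg_ k) (gC k)) dphi2)
    (int2 _ _ (L2b f _ f2 (mdg_ k) (dgC k)) phi2)).
  move=> /(canRL (addrK _)) ->.
  rewrite -opprD; congr (- _).
  under [in RHS]eq_Rintegral => x _ do rewrite mulrDl.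
  rewrite (RintegralD measurableT (int2 _ _ (L2b f' (g_ k) f'2 (mg_ k) (gC k)) phi2)
    (int2 _ _ (L2b f _ f2 (mdg_ k) (dgC k)) phi2)).
  by congr (_ + _); apply: eq_Rintegral => x _; rewrite /= mulrA.
have nint (h k : V -> R) : h \in Lfun mu 2%:E -> k \in Lfun mu 2%:E ->
   mu.-integrable setT (EFin \o (fun x => C * (`|h x| * `|k x|))).
  move=> h2 k2; rewrite (_ : _ \o _ = (fun x : V => C%:E * (EFin \o (fun y : V => (`|h y| * `|k y|)%R)) x)%E).
    apply: integrableZl => //.
    have := integrable_abse (int2 _ _ h2 k2).
    by apply: eq_integrable => // x _; rewrite /= normrM.
  by apply/funext => x /=; rewrite EFinM.
have l1 : (\int[mu]_x (f x * g_ k x * 'D_v phi x))%R @[k --> \oo] -->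
    (\int[mu]_x (f x * g x * 'D_v phi x))%R.
  apply: (Rintegral_dominated_cvg _ _ (nint _ _ f2 dphi2)).
  - by move=> k; apply: measurable_funM => //; exact: measurable_funM.
  - move=> x; apply: cvgMl; apply: cvgMr; exact: gcvg.
  - by move=> k x; rewrite !normrM mulrAC mulrC ler_wpM2r ?mulr_ge0.
have l2 : (- \int[mu]_x ((f' x * g_ k x + f x * 'D_v (g_ k) x) * phi x))%R @[k --> \oo] -->
    (- \int[mu]_x ((f' x * g x + f x * g' x) * phi x))%R.
  apply: cvgN.
  apply: (@Rintegral_dominated_cvg _ _ _ _ _ _ (fun x => C * (`|f' x| * `|phi x|) + C * (`|f x| * `|phi x|))).
  - move=> k; apply: measurable_funM => //.
    by apply: measurable_funD; exact: measurable_funM.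
  - move=> x; apply: cvgMl; apply: cvgD; apply: cvgMr; [exact: gcvg|exact: dgcvg].
  - have := integrableD measurableT (nint _ _ f'2 phi2) (nint _ _ f2 phi2).
    by apply: eq_integrable => // x _.
  - move=> k x; rewrite normrM -mulrDr -mulrDl mulrA ler_wpM2r// (le_trans (ler_normD _ _))//.
    by rewrite mulrDr !normrM lerD// mulrC ler_wpM2r.
move: l1; under eq_cvg do rewrite key; move=> l1.
exact: (cvg_unique _ l1 l2).
Qed.

Lemma derive_sqrt_comp (F : V -> R) (x v : V) : 0 < F x -> derivable F x v ->
  derivable (fun y => Num.sqrt (F y)) x v /\
  'D_v (fun y => Num.sqrt (F y)) x = 'D_v F x / (2 * Num.sqrt (F x)).
Proof.
move=> F0 dF; have H := is_derive1_sqrt F0.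
have [d1 ->] := is_derive_comp dF (@ex_derive _ _ _ _ _ _ _ H).
by split => //; rewrite derive1E (@derive_val _ _ _ _ _ _ _ H) mulrC.
Qed.

Lemma derive_inv_comp (F : V -> R) (x v : V) : F x != 0 -> derivable F x v ->
  derivable (fun y => (F y)^-1) x v /\
  'D_v (fun y => (F y)^-1) x = - 'D_v F x / F x ^+ 2.
Proof.
move=> F0 dF.
have H : is_derive (F x) 1 (fun t : R => t^-1) (- F x ^- 2 *: 1).
  exact: (@is_deriveV _ id _ 1 1).
have [d1 ->] := is_derive_comp dF (@ex_derive _ _ _ _ _ _ _ H).
split => //; rewrite derive1E (@derive_val _ _ _ _ _ _ _ H).
by rewrite /GRing.scale/= mulr1 mulrC mulrN mulNr.
Qed.

Section amplitude.
Variables (D G Q : V -> R) (M : R).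
Hypothesis M1 : 1 <= M.
Hypotheses (sD : smooth D) (sG : smooth G) (sQ : smooth Q).
Hypothesis G0 : forall x, 0 <= G x <= M.
Hypothesis Q0 : forall x, 0 <= Q x.
Hypothesis GQ : forall x, G x <= M * Q x.
Hypothesis DQ : forall x, `|D x| <= Num.sqrt (Q x).
Variable v : V.
Hypothesis dD : forall x, `|'D_v D x| <= M.
Hypothesis dG : forall x, `|'D_v G x| <= M * Num.sqrt (G x).
Hypothesis dQ : forall x, `|'D_v Q x| <= M * Num.sqrt (Q x).

Let dl (k : nat) : R := k.+1%:R^-1.
Let dl0 k : 0 < dl k. Proof. by rewrite invr_gt0. Qed.
Let a k x := Num.sqrt (G x + dl k).
Let b k x := Num.sqrt (Q x + dl k).
Let Gd0 k x : 0 < G x + dl k. Proof. by rewrite ltr_wpDl//; case/andP: (G0 x). Qed.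
Let Qd0 k x : 0 < Q x + dl k. Proof. by rewrite ltr_wpDl. Qed.
Let a0 k x : 0 < a k x. Proof. by rewrite sqrtr_gt0. Qed.
Let b0 k x : 0 < b k x. Proof. by rewrite sqrtr_gt0. Qed.

Let smooth_shift (F : V -> R) k : smooth F -> smooth (fun x => F x + dl k).
Proof. by move=> sF; apply: (smooth_add (g := cst (dl k))) => //; exact: smooth_cst. Qed.

Let derive_shift (F : V -> R) k x : smooth F ->
  'D_v (fun x => F x + dl k) x = 'D_v F x.
Proof.
move=> sF; have := @deriveD R V R F (cst (dl k)) x v (@smooth_derivable _ _ _ v x sF) (derivable_cst _ _ _).
by rewrite derive_cst addr0.
Qed.

Let g_ k x := D x * (a k x * (b k x)^-1).

Let smooth_g k : smooth (g_ k).
Proof.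
apply: (smooth_mul sD).
have -> : (fun x => a k x * (b k x)^-1) =
    (fun x => (G x + dl k) `^ 2^-1) \* (fun x => (Q x + dl k) `^ (- 2^-1)).
  by apply/funext => x; rewrite /= powRN !powR12_sqrt// ltW.
by apply: smooth_mul; apply: smooth_powR => //; exact: smooth_shift.
Qed.

Let derive_g k x : 'D_v (g_ k) x = 'D_v D x * (a k x / b k x) +
  (D x / b k x * ('D_v G x / a k x) / 2 -
   D x / b k x * (a k x / b k x) * ('D_v Q x / b k x) / 2).
Proof.
have [da Ea] := derive_sqrt_comp (Gd0 k x) (@smooth_derivable _ _ _ v x (smooth_shift k sG)).
have [db Eb] := derive_sqrt_comp (Qd0 k x) (@smooth_derivable _ _ _ v x (smooth_shift k sQ)).
have bn0 : b k x != 0 by rewrite gt_eqF.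
have an0 : a k x != 0 by rewrite gt_eqF.
have [dV EV] := derive_inv_comp (F := b k) bn0 db.
have Eab := deriveM da dV.
have dab := derivableM da dV.
have := deriveM (@smooth_derivable _ _ _ v x sD) dab.
rewrite [X in X = _ -> _](_ : _ = 'D_v (g_ k) x)// => ->.
rewrite Eab EV Ea Eb !derive_shift// /GRing.scale/=.
rewrite -/(a k x) -/(b k x) /=.
rewrite [X in _ + X * _](_ : _ = a k x * (b k x)^-1)//.
by field; rewrite an0 bn0.
Qed.

Let ab_le k x : 0 <= a k x / b k x <= M.
Proof.
apply/andP; split; first by rewrite divr_ge0// ltW.
rewrite ler_pdivrMr//.
rewrite -[M]gtr0_norm ?(lt_le_trans ltr01)// -sqrtr_sqr -sqrtrM ?sqr_ge0//.
apply: ler_wsqrtr.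
rewrite mulrDr lerD//.
  apply: (le_trans (GQ x)); rewrite ler_wpM2r// expr2 ler_peMl// (le_trans ler01)//.
by rewrite ler_peMl ?(ltW (dl0 k))// exprn_ege1.
Qed.

Let Db_le k x : `|D x / b k x| <= 1.
Proof.
rewrite normrM normfV (gtr0_norm (b0 k x)) ler_pdivrMr// mul1r.
by apply: (le_trans (DQ x)); rewrite ler_wsqrtr// lerDl ltW.
Qed.

Let dGa_le k x : `|'D_v G x / a k x| <= M.
Proof.
rewrite normrM normfV (gtr0_norm (a0 k x)) ler_pdivrMr//.
apply: (le_trans (dG x)); rewrite ler_wpM2l ?(le_trans ler01)//.
by rewrite ler_wsqrtr// lerDl ltW.
Qed.

Let dQb_le k x : `|'D_v Q x / b k x| <= M.
Proof.
rewrite normrM normfV (gtr0_norm (b0 k x)) ler_pdivrMr//.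
apply: (le_trans (dQ x)); rewrite ler_wpM2l ?(le_trans ler01)//.
by rewrite ler_wsqrtr// lerDl ltW.
Qed.

Let C := 3 * M ^+ 2 + M + 1.

Let g_le k x : `|g_ k x| <= C.
Proof.
rewrite /g_ mulrCA mulrC normrM.
have H : a k x <= M + 1.
  rewrite -(@ler_pXn2r _ 2)// ?nnegrE ?(ltW (a0 _ _)) ?addr_ge0 ?(le_trans ler01)//.
  rewrite sqr_sqrtr ?(ltW (Gd0 _ _))//.
  have /andP[_ GM] := G0 x.
  have : dl k <= 1 by rewrite invf_le1// ler1n.
  by move: M1; nra.
apply: (@le_trans _ _ (1 * (M + 1))).
  by apply: ler_pM => //; rewrite gtr0_norm.
by rewrite mul1r /C; move: M1; nra.
Qed.

Let dg_le k x : `|'D_v (g_ k) x| <= C.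
Proof.
rewrite derive_g.
have [/andP[r0 rM]] := ab_le k x.
have h1 := Db_le k x; have h2 := dGa_le k x; have h3 := dQb_le k x; have h4 := dD x.
set A := 'D_v D x in h4 *; set r := a k x / b k x in r0 rM *.
set p := D x / b k x in h1 *; set q := 'D_v G x / a k x in h2 *.
set s := 'D_v Q x / b k x in h3 *.
have M0 : 0 <= M by exact: le_trans M1.
have t1 : `|A * r| <= M * M by rewrite normrM (ger0_norm r0) ler_pM.
have t2 : `|p * q| <= 1 * M by rewrite normrM ler_pM.
have t3 : `|p * r * s| <= 1 * M * M.
  by rewrite normrM ler_pM// normrM (ger0_norm r0) ler_pM.
move: t1 t2 t3; rewrite !ler_norml /C => /andP[? ?] /andP[? ?] /andP[? ?].
by apply/andP; split; nra.
Qed.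

Let cvg_dl : dl k @[k --> \oo] --> (0 : R).
Proof. exact: cvg_harmonic. Qed.

Let cvg_sqrt_shift (F : V -> R) x :
  Num.sqrt (F x + dl k) @[k --> \oo] --> Num.sqrt (F x).
Proof.
have H : F x + dl k @[k --> \oo] --> F x + 0.
  by apply: cvgD; [exact: cvg_cst|exact: cvg_dl].
rewrite addr0 in H; exact: (cvg_comp _ _ H (@sqrt_continuous R (F x))).
Qed.

Let Qx0 x : Q x = 0 -> [/\ G x = 0, D x = 0 & 'D_v G x = 0].
Proof.
move=> Qx; have Gx : G x = 0.
  by apply/eqP; rewrite eq_le; have /andP[-> _] := G0 x; have := GQ x; rewrite Qx mulr0 => ->.
split => //.
  by apply/eqP; rewrite -normr_eq0 eq_le normr_ge0 andbT; have := DQ x; rewrite Qx sqrtr0.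
by apply/eqP; rewrite -normr_eq0 eq_le normr_ge0 andbT; have := dG x; rewrite Gx sqrtr0 mulr0.
Qed.

Let g_cvg x : g_ k x @[k --> \oo] --> D x * (Num.sqrt (G x) / Num.sqrt (Q x)).
Proof.
have [Qx|Qx] := eqVneq (Q x) 0.
  have [_ Dx _] := Qx0 Qx; rewrite /g_ Dx mul0r.
  by under eq_fun do rewrite mul0r; exact: cvg_cst.
apply: cvgMr; apply: cvgM; first exact: cvg_sqrt_shift.
apply: cvgV; last exact: cvg_sqrt_shift.
by rewrite gt_eqF// sqrtr_gt0 lt_neqAle eq_sym Qx Q0.
Qed.

Let dg_cvg x : cvg ('D_v (g_ k) x @[k --> \oo]).
Proof.
have [Qx|Qx] := eqVneq (Q x) 0.
  have [Gx Dx dGx] := Qx0 Qx.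
  have E k : 'D_v (g_ k) x = 'D_v D x.
    by rewrite derive_g dGx Dx !mul0r subr0 addr0 /a /b Gx Qx divff ?mulr1// gt_eqF// sqrtr_gt0 add0r.
  by under eq_fun do rewrite E; exact: is_cvg_cst.
have sQx : Num.sqrt (Q x) != 0 by rewrite gt_eqF// sqrtr_gt0 lt_neqAle eq_sym Qx Q0.
have cb : (b k x)^-1 @[k --> \oo] --> (Num.sqrt (Q x))^-1.
  by apply: cvgV => //; exact: cvg_sqrt_shift.
have ca : a k x @[k --> \oo] --> Num.sqrt (G x) by exact: cvg_sqrt_shift.
have cab : a k x / b k x @[k --> \oo] --> Num.sqrt (G x) / Num.sqrt (Q x) by exact: cvgM.
have cda : cvg ('D_v G x / a k x @[k --> \oo]).
  have [Gx|Gx] := eqVneq (G x) 0.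
    have dGx : 'D_v G x = 0.
      by apply/eqP; rewrite -normr_eq0 eq_le normr_ge0 andbT; have := dG x; rewrite Gx sqrtr0 mulr0.
    by rewrite dGx; under eq_fun do rewrite mul0r; exact: is_cvg_cst.
  apply/cvg_ex; exists ('D_v G x / Num.sqrt (G x)); apply: cvgMr; apply: cvgV => //.
  by rewrite gt_eqF// sqrtr_gt0 lt_neqAle eq_sym Gx; case/andP: (G0 x).
have [l cl] : exists l : R, 'D_v G x / a k x @[k --> \oo] --> l by apply/cvg_ex.
apply/cvg_ex; eexists; under eq_fun do rewrite derive_g.
apply: cvgD; first by apply: cvgMr; exact: cab.
apply: cvgB.
  by apply: cvgMl; apply: cvgM; [apply: cvgMr; exact: cb|exact: cl].
apply: cvgMl; apply: cvgM; last by apply: cvgMr; exact: cb.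
by apply: cvgM; [apply: cvgMr; exact: cb|exact: cab].
Qed.

(* The factor is the limit of the smooth D sqrt (G + 1/k) / sqrt (Q + 1/k), whose
   values and derivatives along v are bounded uniformly in k. *)
Lemma weak_derivative_mul_amplitude (f f' : V -> R) :
  f \in Lfun mu 2%:E -> is_weak_derivative v f f' ->
  let g := fun x => f x * (D x * (Num.sqrt (G x) / Num.sqrt (Q x))) in
  g \in Lfun mu 2%:E /\ exists g', is_weak_derivative v g g'.
Proof.
move=> f2 fw g.
have [g2 gw] := @weak_derivative_mul_lim f f' v g_ _
  (fun x => lim ('D_v (g_ k) x @[k --> \oo])) C f2 fw smooth_g g_le dg_le g_cvg dg_cvg.
by split => //; eexists; exact: gw.
Qed.

End amplitude.

End product.

(** * Densities *)

Section density.
Context {dd : measure_display} {T : measurableType dd} {R : realType}.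
Variables (mu nu : {measure set T -> \bar R}) (f : T -> R).
Hypothesis mf : measurable_fun setT f.
Hypothesis f0 : forall x, 0 <= f x.
Hypothesis nuE : forall A, measurable A -> (nu A = \int[mu]_(x in A) (f x)%:E)%E.

Import HBNNSimple.

Lemma ge0_integral_density (h : T -> \bar R) : measurable_fun setT h ->
  (forall x, 0 <= h x)%E -> (\int[nu]_x h x = \int[mu]_x (h x * (f x)%:E))%E.
Proof.
move=> mh h0; pose g := nnsfun_approx measurableT mh.
have mfE : measurable_fun setT (EFin \o f) by exact/measurable_EFinP.
have mg n : measurable_fun setT (EFin \o g n) by exact/measurable_EFinP.
have gcvg x : (EFin \o g n) x @[n --> \oo] --> h x.
  by apply: cvg_nnsfun_approx => // y _; exact: h0.
have gnd x : {homo (fun n => g n x) : a b / (a <= b)%N >-> a <= b}.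
  by move=> a b ab; exact/lefP/nd_nnsfun_approx.
have -> : (\int[nu]_x h x = \int[nu]_x (limn (fun n => (EFin \o g n) x)))%E.
  by apply: eq_integral => x _; apply/esym/cvg_lim.
rewrite monotone_convergence//; last 2 first.
- by move=> n x _; rewrite lee_fin; exact: fun_ge0.
- by move=> x _ a b ab; rewrite lee_fin; exact: gnd.
have -> : (\int[mu]_x (h x * (f x)%:E) =
    \int[mu]_x (limn (fun n => (EFin \o g n) x * (f x)%:E)))%E.
  apply: eq_integral => x _; apply/esym/cvg_lim => //.
  by apply: cvgeZr => //; exact: gcvg.
rewrite monotone_convergence//; last 3 first.
- by move=> n; exact: emeasurable_funM.
- by move=> n x _; rewrite mule_ge0 ?lee_fin//; exact: fun_ge0.
- by move=> x _ a b ab; rewrite lee_wpmul2r ?lee_fin//; exact: gnd.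
congr (limn _); apply/funext => n /=.
rewrite integralT_nnsfun sintegralE.
transitivity (\int[mu]_x (\sum_(y \in range (g n))
    ((y * \1_(g n @^-1` [set y]) x)%:E * (f x)%:E)))%E; last first.
  apply: eq_integral => x _; rewrite -ge0_mule_fsuml; last first.
    by move=> y; exact: nnfun_muleindic_ge0.
  by rewrite fsumEFin// -(fimfunE _ x).
rewrite ge0_integral_fsum//; last 2 first.
- by move=> y; apply: emeasurable_funM => //; apply/measurable_EFinP; exact: measurable_funM.
- by move=> y x _; rewrite mule_ge0 ?lee_fin//; exact: nnfun_muleindic_ge0.
apply: eq_fsbigr => y /[!inE] -[x0 _ <-].
have mA : measurable (g n @^-1` [set g n x0]) by rewrite -[X in measurable X]setTI; exact: measurable_funP.
rewrite nuE// integral_mkcond -ge0_integralZl//; last 3 first.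
- by apply/(measurable_restrictT _ mA); exact: measurable_funTS.
- by move=> x _; rewrite patchE; case: ifP => // _; rewrite lee_fin.
- by rewrite lee_fin; exact: fun_ge0.
apply: eq_integral => x _; rewrite EFinM -muleA; congr (_ * _)%E.
rewrite patchE indicE; case: (x \in _); rewrite ?mul1e//.
by rewrite mul0e.
Qed.

End density.

Section density_measure.
Context {dd : measure_display} {T : measurableType dd} {R : realType}.
Variables (mu : {measure set T -> \bar R}) (f : T -> R).
Hypothesis mf : measurable_fun setT f.
Hypothesis f0 : forall x, 0 <= f x.
Hypothesis f1 : (\int[mu]_x (f x)%:E = 1)%E.

Definition density_measure (A : set T) := (\int[mu]_(x in A) (f x)%:E)%E.

Let density_measure0 : density_measure set0 = 0%E.
Proof. exact: integral_set0. Qed.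

Let density_measure_ge0 A : (0 <= density_measure A)%E.
Proof. by apply: integral_ge0 => x _; rewrite lee_fin. Qed.

Let density_measure_sigma_additive : semi_sigma_additive density_measure.
Proof.
move=> F mF tF mUF; rewrite /density_measure ge0_integral_bigcup//.
- apply: is_cvg_nneseries_cond => n _ _; exact: density_measure_ge0.
- by apply/measurable_funTS/measurable_EFinP.
- by move=> x _; rewrite lee_fin.
Qed.

HB.instance Definition _ := isMeasure.Build _ _ _ density_measure
  density_measure0 density_measure_ge0 density_measure_sigma_additive.

HB.instance Definition _ := Measure_isProbability.Build _ _ _ density_measure f1.

Definition density_probability : probability T R := density_measure.

End density_measure.

(** * Coulomb energy and the lower bound *)

Lemma continuous_inv_shift (R : realType) (V : normedModType R) (f : V -> R) c :
  (forall x, 0 < f x + c) -> continuous f -> continuous (fun x => (f x + c)^-1).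
Proof.
move=> f0 cf x.
have H : f y + c @[y --> x] --> f x + c.
  by apply: cvgD; [exact: cf|exact: cvg_cst].
by apply: (cvgV _ H); exact: lt0r_neq0.
Qed.

Section coulomb_cost.
Context {R : realType} {d N : nat}.
Local Notation mu := (lebesgue_mx R N d).
Implicit Types psi : wavefun R d N.

Definition pair_dist (i j : 'I_N) (x : 'M[R]_(N, d)) : R :=
  euclidean_norm (row i x - row j x).

Lemma pair_dist_ge0 i j x : 0 <= pair_dist i j x.
Proof. exact: sqrtr_ge0. Qed.

Lemma smooth_row_diff (i j : 'I_N) (k : 'I_d) :
  smooth (fun x : 'M[R]_(N, d) => x i k - x j k).
Proof.
rewrite (_ : (fun x => _) = (fun x : 'M[R]_(N, d) => x i k) \+
   (cst (-1) \* (fun x : 'M[R]_(N, d) => x j k))).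
  by apply: smooth_add; [|apply: smooth_mul; [exact: smooth_cst|]]; exact: smooth_coord.
by apply/funext => x /=; rewrite mulN1r.
Qed.

Lemma pair_distE (i j : 'I_N) (x : 'M[R]_(N, d)) : pair_dist i j x =
  Num.sqrt (\sum_(k < d) (x i k - x j k) ^+ 2).
Proof. by congr Num.sqrt; apply: eq_bigr => k _; rewrite !mxE. Qed.

Lemma pair_dist_continuous i j : continuous (pair_dist i j).
Proof.
rewrite (_ : pair_dist i j = Num.sqrt \o (fun x => \sum_(k < d) (x i k - x j k) ^+ 2)); last first.
  by apply/funext => x; rewrite pair_distE.
move=> x; apply: continuous_comp; last exact: sqrt_continuous.
apply: smooth_continuous; apply: smooth_sum => k.
by apply: smooth_mul; exact: smooth_row_diff.
Qed.

Lemma measurable_inv_pair_dist i j :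
  measurable_fun setT (fun x => ((pair_dist i j x)%:E^-1)%E).
Proof.
have dl0 n : 0 < n.+1%:R^-1 :> R by rewrite invr_gt0.
have pd0 n x : 0 < pair_dist i j x + n.+1%:R^-1 by rewrite ltr_wpDl// pair_dist_ge0.
apply: (@emeasurable_fun_cvg _ _ _ _ (fun n x => ((pair_dist i j x + n.+1%:R^-1)^-1)%:E)).
  move=> n; apply/measurable_EFinP; apply: continuous_measurable_mx.
  by apply: continuous_inv_shift => //; exact: pair_dist_continuous.
move=> x _; rewrite inver; case: eqP => [->|/eqP px].
  apply/cvgeryP; under eq_fun do rewrite add0r invrK.
  by have := @cvgr_idn R; rewrite -cvg_shiftS.
apply/fine_cvgP; split; first exact: nearW.
apply: cvgV => //; rewrite -[X in _ --> X]addr0; apply: cvgD; first exact: cvg_cst.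
exact: cvg_harmonic.
Qed.

Lemma coulombE x : (@coulomb R d N x = \sum_(i < N) \sum_(j < N | (i < j)%N)
    (pair_dist i j x)%:E^-1)%E.
Proof. by apply: eq_bigr => i _; apply: eq_bigr => j _; rewrite mul1e. Qed.

Lemma inv_pair_dist_ge0 i j x : (0 <= (pair_dist i j x)%:E^-1)%E.
Proof. by rewrite inve_ge0 lee_fin pair_dist_ge0. Qed.

Lemma coulomb_ge0 x : (0 <= @coulomb R d N x)%E.
Proof. by rewrite coulombE; do 2!apply: sume_ge0 => ? _; exact: inv_pair_dist_ge0. Qed.

Lemma measurable_coulomb : measurable_fun setT (@coulomb R d N).
Proof.
rewrite (_ : coulomb = (fun x => \sum_(i < N) \sum_(j < N | (i < j)%N)
    (pair_dist i j x)%:E^-1)%E); last by apply/funext => x; exact: coulombE.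
apply: emeasurable_sum => i; under eq_fun do rewrite big_mkcond.
apply: emeasurable_sum => j; case: (i < j)%N => //.
exact: measurable_inv_pair_dist.
Qed.

Lemma sqmod_ge0 (z : R[i]) : 0 <= sqmod z.
Proof. by rewrite addr_ge0// sqr_ge0. Qed.

Definition sum_sqmod psi (x : 'M[R]_(N, d)) : R := \sum_(a : spins N) sqmod (psi x a).

Lemma sum_sqmod_ge0 psi x : 0 <= sum_sqmod psi x.
Proof. by apply: sumr_ge0 => a _; exact: sqmod_ge0. Qed.

Lemma measurable_sqmod psi a : wave_H1 psi ->
  measurable_fun setT (fun x => sqmod (psi x a)).
Proof.
move=> /(_ a)[[/L2_measurable mr _] [/L2_measurable mi _]].
by apply: measurable_funD; exact: measurable_funX.
Qed.

Lemma measurable_sum_sqmod psi : wave_H1 psi -> measurable_fun setT (sum_sqmod psi).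
Proof. by move=> hpsi; apply: measurable_sum => a; exact: measurable_sqmod. Qed.

Lemma int_z_sqmod psi : wave_H1 psi ->
  (int_z (fun x a => (sqmod (psi x a))%:E) = \int[mu]_x (sum_sqmod psi x)%:E)%E.
Proof.
move=> hpsi; rewrite /int_z -ge0_integral_sum//.
- by apply: eq_integral => x _; rewrite sumEFin.
- by move=> a; apply/measurable_EFinP; exact: measurable_sqmod.
- by move=> a x _; rewrite lee_fin sqmod_ge0.
Qed.

Lemma VeeE psi : wave_H1 psi ->
  (Vee psi = \int[mu]_x (coulomb x * (sum_sqmod psi x)%:E))%E.
Proof.
move=> hpsi; rewrite /Vee /int_z.
have E x a : (\sum_(i < N) \sum_(j < N | (i < j)%N)
    (sqmod (psi x a))%:E / (euclidean_norm (row i x - row j x))%:E =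
    coulomb x * (sqmod (psi x a))%:E)%E.
  rewrite coulombE ge0_sume_distrl; last first.
    by move=> i _; apply: sume_ge0 => j _; exact: inv_pair_dist_ge0.
  apply: eq_bigr => i _; rewrite ge0_sume_distrl; last by move=> j _; exact: inv_pair_dist_ge0.
  by apply: eq_bigr => j _; rewrite muleC.
under eq_bigr => a _ do under eq_integral => x _ do rewrite E.
rewrite -ge0_integral_sum//.
- apply: eq_integral => x _; rewrite -sumEFin ge0_sume_distrr// => a _.
  by rewrite lee_fin sqmod_ge0.
- move=> a; apply: emeasurable_funM; first exact: measurable_coulomb.
  by apply/measurable_EFinP; exact: measurable_sqmod.
- by move=> a x _; rewrite mule_ge0 ?coulomb_ge0// lee_fin sqmod_ge0.
Qed.

Lemma kinetic_ge0 m hbar psi : 0 < m -> (0 <= kinetic m hbar psi)%E.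
Proof.
move=> m0; apply: mule_ge0.
  by rewrite lee_fin divr_ge0 ?sqr_ge0// mulr_ge0// ltW.
apply: sume_ge0 => a _; apply: integral_ge0 => x _; rewrite lee_fin.
by do 2!apply: sumr_ge0 => ? _; rewrite addr_ge0// sqr_ge0.
Qed.

Lemma sum_sqmod_sym psi (s : 'S_N) : fermionic psi ->
  {ae mu, forall x, sum_sqmod psi (row_perm s x) = sum_sqmod psi x}.
Proof.
move=> [_ _ asym].
have : {ae mu, forall x, forall a : spins N,
    psi (row_perm s x) [ffun i => a (s i)] = (-1) ^+ s * psi x a}.
  by apply: (@filter_forall _ _ (fun (a : spins N) x => psi (row_perm s x) [ffun i => a (s i)] = (-1) ^+ s * psi x a)) => a; exact: asym.
apply: filterS => x H; rewrite /sum_sqmod.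
pose h (a : spins N) : spins N := [ffun i => a (s i)].
have hb : bijective h.
  exists (fun a : spins N => [ffun i => a (s^-1%g i)]) => a.
    by apply/ffunP => i; rewrite !ffunE permKV.
  by apply/ffunP => i; rewrite !ffunE permK.
rewrite (reindex h); last exact: onW_bij.
apply: eq_bigr => a _; rewrite H /sqmod.
by case: (odd_perm s); rewrite ?expr0 ?mul1r// expr1 mulN1r; case: (psi x a) => u w /=; rewrite !sqrrN.
Qed.

End coulomb_cost.

Lemma measurable_col_mxr (R : realType) n d (v : 'rV[R]_d) :
  measurable_fun setT (fun y : 'M[R]_(n, d) => col_mx v y : 'M[R]_(n.+1, d)).
Proof.
apply: measurable_fun_mx => i j; under eq_fun do rewrite mxE.
case: (fintype.split _) => k; first exact: measurable_cst.
exact: measurable_mx_coord.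
Qed.

Section lower_bound.
Context {R : realType} {d n : nat}.
Local Notation mu := (lebesgue_mx R n.+1 d).
Local Notation mu1 := (lebesgue_mx R 1 d).
Variables (psi : wavefun R d n.+1) (rho : 'rV[R]_d -> R).
Hypotheses (mrho : measurable_fun setT rho) (rho0 : forall v, 0 <= rho v).
Hypotheses (psi_fermionic : fermionic psi) (psi_rho : has_density psi rho).

Let hpsi : wave_H1 psi. Proof. by have [] := psi_fermionic. Qed.

Let psi1 : (\int[mu]_x (sum_sqmod psi x)%:E = 1)%E.
Proof. by rewrite -int_z_sqmod//; have [] := psi_fermionic. Qed.

Definition wave_plan : probability 'M[R]_(n.+1, d) R :=
  density_probability (measurable_sum_sqmod hpsi) (sum_sqmod_ge0 psi) psi1.

Lemma densityE v : (density psi v =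
  \int[lebesgue_mx R n d]_y (sum_sqmod psi (col_mx v y))%:E)%E.
Proof.
rewrite /density -ge0_integral_sum//.
- by apply: eq_integral => y _; rewrite sumEFin.
- move=> a; apply/measurable_EFinP.
  apply: (measurableT_comp (measurable_sqmod a hpsi)).
  exact: measurable_col_mxr.
- by move=> a y _; rewrite lee_fin sqmod_ge0.
Qed.

Lemma wave_plan_plans : plans rho wave_plan.
Proof.
move=> i A mA; rewrite /pushforward /wave_plan /density_probability/=.
have mf := measurable_sum_sqmod hpsi.
have mfE : measurable_fun setT (EFin \o sum_sqmod psi) by exact/measurable_EFinP.
have mrow := @measurable_row R n.+1 d.
have mri k : measurable (row k @^-1` A : set 'M[R]_(n.+1, d)).
  by rewrite -[X in measurable X]setTI; exact: mrow.
pose F k (x : 'M[R]_(n.+1, d)) := ((\1_A (row k x))%:E * (sum_sqmod psi x)%:E)%E.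
have mF k : measurable_fun setT (F k).
  apply: emeasurable_funM => //; apply/measurable_EFinP.
  by apply: (measurableT_comp (measurable_indic mA)); exact: mrow.
have F0 k x : (0 <= F k x)%E by rewrite mule_ge0 ?lee_fin// sum_sqmod_ge0.
transitivity (\int[mu]_x F i x)%E.
  rewrite /density_measure integral_mkcond; apply: eq_integral => x _.
  rewrite patchE /F indicE; rewrite (_ : (x \in _) = (row i x \in A)); last first.
    by apply/idP/idP => /set_mem/= H; apply/mem_set.
  by case: (_ \in A); rewrite ?mul1e ?mul0e.
transitivity (\int[mu]_x F ord0 x)%E.
  rewrite -(ge0_integral_row_perm (tperm ord0 i) (mF ord0) (F0 ord0)).
  apply: ge0_ae_eq_integral => //.
    apply: (measurableT_comp (mF ord0)); exact: measurable_row_perm.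
  apply: filterS (sum_sqmod_sym (tperm ord0 i) psi_fermionic) => x H _.
  rewrite /F H; congr ((\1_A _)%:E * _)%E.
  by apply/rowP => k; rewrite !mxE tpermL.
rewrite mx_tonelli1//.
have -> := @integral_mkcond _ _ _ mu1 A (EFin \o rho).
apply: ge0_ae_eq_integral => //.
- exact: measurable_tonelli1.
- apply/(measurable_restrictT _ mA); apply: measurable_funTS.
  exact/measurable_EFinP.
- by move=> v _; apply: integral_ge0.
- by move=> v _; rewrite patchE; case: ifP => // _; rewrite lee_fin.
apply: filterS psi_rho => v Hv _.
rewrite patchE /= -Hv densityE// /F.
under eq_integral => y _ do rewrite col_mx_row0 indicE.
case: (v \in A).
  by apply: eq_integral => y _; rewrite mul1e.
by apply: integral0_eq => y _; rewrite mul0e.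
Qed.

Lemma wave_plan_cost : (\int[wave_plan]_x coulomb x = Vee psi)%E.
Proof.
rewrite VeeE//.
rewrite (@ge0_integral_density _ _ _ mu wave_plan (sum_sqmod psi))//.
- exact: measurable_sum_sqmod.
- exact: sum_sqmod_ge0.
- exact: measurable_coulomb.
- exact: coulomb_ge0.
Qed.

Lemma optimal_cost_le m hbar : 0 < m ->
  (optimal_cost n.+1 rho <= kinetic m hbar psi + Vee psi)%E.
Proof.
move=> m0; apply: (@le_trans _ _ (Vee psi)); last by rewrite leeDr// kinetic_ge0.
rewrite -wave_plan_cost; apply: ereal_inf_lbound.
by exists wave_plan => //; exact: wave_plan_plans.
Qed.

End lower_bound.

(** * Concentration of the density *)

Lemma measurable_norm_ge (R : realType) m n (r : R) :
  measurable [set x : 'M[R]_(m, n) | (r <= `|x|)%R].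
Proof.
rewrite (_ : mkset _ = (fun x : 'M[R]_(m, n) => `|x|) @^-1` `[r, +oo[%classic).
  rewrite -[X in measurable X]setTI.
  apply: (continuous_measurable_mx (f := fun x : 'M[R]_(m, n) => `|x|)) => //.
  by move=> x; exact: norm_continuous.
by apply/seteqP; split => t; rewrite /= in_itv/= andbT.
Qed.

Lemma continuous_norm_sub (R : realType) (V : normedModType R) (x : V) :
  continuous (fun y => `|y - x|).
Proof. by move=> y; apply: cvg_norm; apply: cvgB; [exact: cvg_id|exact: cvg_cst]. Qed.

Lemma measurable_dist_le (R : realType) m n (x : 'M[R]_(m, n)) (b : R) :
  measurable [set y : 'M[R]_(m, n) | (`|y - x| <= b)%R].
Proof.
rewrite (_ : mkset _ = (fun y : 'M[R]_(m, n) => `|y - x|) @^-1` `]-oo, b]%classic).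
  rewrite -[X in measurable X]setTI.
  apply: (continuous_measurable_mx (f := fun y : 'M[R]_(m, n) => `|y - x|)) => //.
  exact: (@continuous_norm_sub R 'M[R]_(m, n)).
by apply/seteqP; split => t; rewrite /= in_itv/=.
Qed.

Section rho_estimates.
Context {R : realType} {d : nat}.
Local Notation mu1 := (lebesgue_mx R 1 d).
Variable rho : 'rV[R]_d -> R.
Hypothesis mrho : measurable_fun setT rho.
Hypothesis rho0 : forall x, 0 <= rho x.
Hypothesis rho1 : (\int[mu1]_x (rho x)%:E = 1)%E.

Let mrhoE : measurable_fun setT (EFin \o rho). Proof. exact/measurable_EFinP. Qed.

Lemma rho_integrable : mu1.-integrable setT (EFin \o rho).
Proof.
apply/integrableP; split => //.
rewrite (eq_integral (EFin \o rho)); first by rewrite rho1 ltry.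
by move=> x _; rewrite /= ger0_norm.
Qed.

Lemma rho_tail (delta : R) : 0 < delta -> exists2 r : R, 0 < r &
  (\int[mu1]_(x in [set x | (r <= `|x|)%R]) (rho x)%:E <= delta%:E)%E.
Proof.
move=> delta0.
pose A k : set 'rV[R]_d := [set x | (k.+1%:R <= `|x|)%R].
have mA k : measurable (A k) by exact: measurable_norm_ge.
have H : (\int[mu1]_x (rho x * \1_(A k) x))%R @[k --> \oo] --> (\int[mu1]_x (cst 0 x : R))%R.
  apply: (@Rintegral_dominated_cvg _ _ _ mu1 _ _ rho).
  - by move=> k; apply: measurable_funM => //; exact: measurable_indic.
  - move=> x; apply: cvg_near_cst; near=> k.
    rewrite indicE memNset ?mulr0//= /A /=; apply/negP; rewrite -ltNge.
    apply: (lt_le_trans (truncnS_gt `|x|)); rewrite ler_nat.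
    by rewrite ltnW// ltnS; near: k; exact: nbhs_infty_ge.
  - exact: rho_integrable.
  - by move=> k x; rewrite ger0_norm ?mulr_ge0// indicE; case: (_ \in _); rewrite ?mulr1// mulr0.
move: H; rewrite Rintegral_cst// mul0r => /cvgr0Pnorm_le /(_ _ delta0)[k _ /(_ k (leqnn k))] /= H.
exists k.+1%:R => //.
have -> : (\int[mu1]_(x in A k) (rho x)%:E = \int[mu1]_x (rho x * \1_(A k) x)%:E)%E.
  rewrite [LHS]integral_mkcond; apply: eq_integral => x _; rewrite patchE indicE.
  by case: (x \in _); rewrite ?mulr1// mulr0.
have i2 : mu1.-integrable setT (fun x => (rho x * \1_(A k) x)%:E).
  apply: (le_integrable _ _ _ rho_integrable) => //.
    by apply/measurable_EFinP; apply: measurable_funM => //; exact: measurable_indic.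
  by move=> x _; rewrite /= lee_fin !ger0_norm// ?mulr_ge0// indicE; case: (_ \in _); rewrite ?mulr1// mulr0.
rewrite -(fineK (integrable_fin_num _ i2))// lee_fin.
by apply: le_trans H; exact: ler_norm.
Unshelve. all: by end_near. Qed.

Lemma rho_tail_mono (r r' : R) : r <= r' ->
  (\int[mu1]_(x in [set x | (r' <= `|x|)%R]) (rho x)%:E <=
   \int[mu1]_(x in [set x | (r <= `|x|)%R]) (rho x)%:E)%E.
Proof.
move=> rr'; apply: ge0_subset_integral => //.
- exact: measurable_norm_ge.
- exact: measurable_norm_ge.
- exact: measurable_funTS.
- by move=> x _; rewrite lee_fin.
- by move=> x /=; exact: le_trans.
Qed.

Lemma lebesgue_cube (x : 'rV[R]_d) (b : R) : 0 < b ->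
  (mu1 [set y | (`|y - x| <= b)%R] = ((b + b) ^+ d)%:E)%E.
Proof.
move=> b0.
pose B (i : 'I_1) (j : 'I_d) : set R := `[x i j - b, x i j + b]%classic.
have <- : [set M : 'rV[R]_d | forall i j, B i j (M i j)] = [set y | `|y - x| <= b].
  apply/seteqP; split => y /=.
    move=> H; apply/mx_norm_leP; first exact: ltW.
    by move=> i j; have := H i j; rewrite /B /= in_itv/= !mxE ler_distl.
  move=> H i j; rewrite /B /= in_itv/= -ler_distl.
  by have := (mx_norm_leP _ (ltW b0)).1 H i j; rewrite !mxE.
apply: (etrans (@lebesgue_mx_box R d 1 B (fun _ _ => measurable_itv _))).
rewrite big_ord1.
have E j : (lebesgue_measure (B ord0 j) = (b + b)%:E)%E.
  rewrite lebesgue_measure_itv/= lte_fin ltrD2l gtrN// -EFinB.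
  by congr EFin; ring.
by under eq_bigr => j _ do rewrite E; rewrite prodEFin prodr_const card_ord.
Qed.

Lemma rho_small_ball (delta : R) : (0 < d)%N -> 0 < delta ->
  exists2 b0 : R, 0 < b0 & forall b x, b <= b0 ->
  (\int[mu1]_(y in [set y | (`|y - x| <= b)%R]) (rho y)%:E <= delta%:E)%E.
Proof.
move=> d0 delta0.
pose A (k : nat) : set 'rV[R]_d := [set x | k.+1%:R <= rho x].
have mA k : measurable (A k).
  rewrite (_ : A k = rho @^-1` `[k.+1%:R, +oo[%classic).
    by rewrite -[X in measurable X]setTI; exact: mrho.
  by apply/seteqP; split => t; rewrite /= in_itv/= andbT.
have H : (\int[mu1]_x (rho x * \1_(A k) x))%R @[k --> \oo] --> (\int[mu1]_x (cst 0 x : R))%R.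
  apply: (@Rintegral_dominated_cvg _ _ _ mu1 _ _ rho).
  - by move=> k; apply: measurable_funM => //; exact: measurable_indic.
  - move=> x; apply: cvg_near_cst; near=> k.
    rewrite indicE memNset ?mulr0//= /A /=; apply/negP; rewrite -ltNge.
    apply: (lt_le_trans (truncnS_gt (rho x))); rewrite ler_nat.
    by rewrite ltnW// ltnS; near: k; exact: nbhs_infty_ge.
  - exact: rho_integrable.
  - by move=> k x; rewrite ger0_norm ?mulr_ge0// indicE; case: (_ \in _); rewrite ?mulr1// mulr0.
have d20 : 0 < delta / 2 by rewrite divr_gt0.
move: H; rewrite Rintegral_cst// mul0r => /cvgr0Pnorm_le /(_ _ d20)[k _ /(_ k (leqnn k))] /= H.
have i2 : mu1.-integrable setT (fun x => (rho x * \1_(A k) x)%:E).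
  apply: (le_integrable _ _ _ rho_integrable) => //.
    by apply/measurable_EFinP; apply: measurable_funM => //; exact: measurable_indic.
  by move=> x _; rewrite /= lee_fin !ger0_norm// ?mulr_ge0// indicE; case: (_ \in _); rewrite ?mulr1// mulr0.
have {}H : (\int[mu1]_x (rho x * \1_(A k) x)%:E <= (delta / 2)%:E)%E.
  rewrite -(fineK (integrable_fin_num _ i2))// lee_fin.
  by apply: le_trans H; exact: ler_norm.
pose b0 : R := Num.min 2^-1 (delta / 2 / k.+1%:R / 2).
have b00 : 0 < b0 by rewrite lt_min invr_gt0 ltr0n/= !divr_gt0.
have small b x : 0 < b -> b <= b0 ->
  (\int[mu1]_(y in [set y | (`|y - x| <= b)%R]) (rho y)%:E <= delta%:E)%E.
  move=> bb bb0.
  pose B : set 'rV[R]_d := [set y | (`|y - x| <= b)%R].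
  have mB : measurable B by exact: measurable_dist_le.
  apply: (@le_trans _ _ (\int[mu1]_(y in B) ((rho y * \1_(A k) y)%:E + k.+1%:R%:E)))%E.
    apply: ge0_le_integral => //.
    - by move=> y _; rewrite lee_fin.
    - exact: measurable_funTS.
    - apply: measurable_funTS; apply: emeasurable_funD => //.
      by case/integrableP: i2.
    - move=> y _; rewrite -EFinD lee_fin indicE; have [yA|yA] := boolP (y \in A k).
        by rewrite mulr1 lerDl.
      rewrite mulr0 add0r; move: yA; rewrite notin_setE /A /= => /negP.
      by rewrite -ltNge => /ltW.
  rewrite ge0_integralD//; last 2 first.
  - by move=> y _; rewrite lee_fin mulr_ge0.
  - by apply: measurable_funTS; case/integrableP: i2.
  have cube : (mu1 B = ((b + b) ^+ d)%:E)%E by exact: lebesgue_cube.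
  rewrite integral_cst// [X in (_ + _ * X)%E]cube.
  rewrite (splitr delta) EFinD; apply: leeD.
    apply: le_trans H; apply: ge0_subset_integral => //.
      by case/integrableP: i2.
    by move=> y _; rewrite lee_fin mulr_ge0.
  rewrite -EFinM lee_fin.
  have b2 : b <= 2^-1 by apply: le_trans bb0 _; rewrite ge_min lexx.
  have b1 : b <= delta / 2 / k.+1%:R / 2 by apply: le_trans bb0 _; rewrite ge_min lexx orbT.
  apply: (@le_trans _ _ (k.+1%:R * (b + b))).
    rewrite ler_wpM2l// -[leRHS]expr1 ler_wiXn2l ?addr_ge0 ?(ltW bb)//.
    by lra.
  by rewrite mulrC -ler_pdivlMr//; move: b1; set q := delta / 2 / _; lra.
exists b0 => // b x bb0.
have [bp|bn] := ltP 0 b; first exact: small.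
apply: (@le_trans _ _ (\int[mu1]_(y in [set y | (`|y - x| <= b0)%R]) (rho y)%:E)%E); last exact: small.
have mB e : measurable [set y : 'rV[R]_d | (`|y - x| <= e)%R] by exact: measurable_dist_le.
apply: (ge0_subset_integral mu1 (mB b) (mB b0)).
- exact: measurable_funTS.
- by move=> y _; rewrite lee_fin.
- by move=> y /= yb; exact: le_trans yb bb0.
Unshelve. all: by end_near. Qed.

End rho_estimates.

(** * Discretisation of plans *)

Section discretisation.
Context {R : realType} {d N : nat}.
Local Notation mu1 := (lebesgue_mx R 1 d).
Local Notation mu := (lebesgue_mx R N d).
Variables (rho : 'rV[R]_d -> R) (K : finType) (theta : K -> 'rV[R]_d -> R).
Hypothesis mrho : measurable_fun setT rho.
Hypothesis rho0 : forall x, 0 <= rho x.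
Hypothesis rho1 : (\int[mu1]_x (rho x)%:E = 1)%E.
Hypothesis stheta : forall k, smooth (theta k).
Hypothesis sumtheta : forall x, \sum_k theta k x ^+ 2 = 1.
Local Notation T := {ffun 'I_N -> K}.

Definition cell_mass (a : K) : R := (\int[mu1]_x (rho x * theta a x ^+ 2))%R.

Definition cell_prod (t : T) (x : 'M[R]_(N, d)) : R :=
  \prod_(i < N) theta (t i) (row i x) ^+ 2.

Lemma measurable_cell a : measurable_fun setT (fun x => theta a x ^+ 2).
Proof.
apply: measurable_funX; apply: continuous_measurable_mx.
exact: smooth_continuous.
Qed.

Lemma cell_le1 a x : theta a x ^+ 2 <= 1.
Proof.
rewrite -(sumtheta x) (bigD1 a)//= lerDl.
by apply: sumr_ge0 => k _; exact: sqr_ge0.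
Qed.

Lemma measurable_cell_prod t : measurable_fun setT (cell_prod t).
Proof.
apply: measurable_prod => i _; apply: (measurableT_comp (measurable_cell _)).
exact: measurable_row.
Qed.

Lemma cell_prod_ge0 t x : 0 <= cell_prod t x.
Proof. by apply: prodr_ge0 => i _; exact: sqr_ge0. Qed.

Lemma cell_prod_le1 t x : cell_prod t x <= 1.
Proof. by apply: prodr_ile1 => i; rewrite sqr_ge0 cell_le1. Qed.

Lemma cell_prod_neq0 t x : cell_prod t x != 0 -> forall i, theta (t i) (row i x) != 0.
Proof.
move=> + i; apply: contra => /eqP ti.
by rewrite /cell_prod (bigD1 i)//= ti expr0n mul0r.
Qed.

Lemma sum_cell_prod_at i a x :
  \sum_(t : T | t i == a) cell_prod t x = theta a (row i x) ^+ 2.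
Proof.
pose F (j : 'I_N) (k : K) : R :=
  if j == i then (k == a)%:R * theta k (row j x) ^+ 2 else theta k (row j x) ^+ 2.
transitivity (\sum_(t : T) \prod_j F j (t j)).
  rewrite big_mkcond; apply: eq_bigr => t _.
  rewrite /cell_prod (bigD1 i)//= [in RHS](bigD1 i)//= {1}/F eqxx.
  rewrite (eq_bigr (fun j => F j (t j))); last by move=> j /negbTE ji; rewrite /F ji.
  by case: eqP => [->|]; rewrite ?mul1r// !mul0r.
rewrite -bigA_distr_bigA (bigD1 i)//= [X in _ * X]big1 ?mulr1.
  rewrite (bigD1 a)//= /F eqxx eqxx mul1r big1 ?addr0// => k /negbTE ->.
  by rewrite mul0r.
move=> j /negbTE ji; rewrite -(sumtheta (row j x)); apply: eq_bigr => k _.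
by rewrite /F ji.
Qed.

Lemma sum_cell_prod x : \sum_(t : T) cell_prod t x = 1.
Proof.
rewrite /cell_prod -(bigA_distr_bigA (fun j k => theta k (row j x) ^+ 2)).
by rewrite big1// => i _; exact: sumtheta.
Qed.

Lemma cell_massE a : (\int[mu1]_x (rho x * theta a x ^+ 2)%:E = (cell_mass a)%:E)%E.
Proof.
rewrite /cell_mass /Rintegral fineK//.
apply: (@integrable_fin_num _ _ _ mu1 setT) => //.
apply: (le_integrable _ _ _ (rho_integrable mrho rho0 rho1)) => //.
  by apply/measurable_EFinP; apply: measurable_funM => //; exact: measurable_cell.
move=> x _; have H0 : 0 <= rho x * theta a x ^+ 2 by rewrite mulr_ge0// sqr_ge0.
by rewrite /= lee_fin (ger0_norm H0) ger0_norm// ler_piMr// cell_le1.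
Qed.

Lemma cell_mass_ge0 a : 0 <= cell_mass a.
Proof.
rewrite -lee_fin -cell_massE; apply: integral_ge0 => x _.
by rewrite lee_fin mulr_ge0// sqr_ge0.
Qed.

Lemma integral_cells t :
  (\int[mu]_x (\prod_(i < N) (rho (row i x) * theta (t i) (row i x) ^+ 2))%:E =
   (\prod_(i < N) cell_mass (t i))%:E)%E.
Proof.
rewrite (prod_mx_integral (f := fun i x => rho x * theta (t i) x ^+ 2)).
- by rewrite -prodEFin; apply: eq_bigr => i _; rewrite cell_massE.
- by move=> i; apply: measurable_funM => //; exact: measurable_cell.
- by move=> i x; rewrite mulr_ge0// sqr_ge0.
Qed.

Lemma sum_cell_mass_le (S : pred K) (A : set 'rV[R]_d) : measurable A ->
  (forall c x, S c -> theta c x != 0 -> A x) ->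
  ((\sum_(c | S c) cell_mass c)%:E <= \int[mu1]_(x in A) (rho x)%:E)%E.
Proof.
move=> mA SA; rewrite -sumEFin.
have mc (c : K) : measurable_fun setT (fun x => (rho x * theta c x ^+ 2)%:E).
  by apply/measurable_EFinP; apply: measurable_funM => //; exact: measurable_cell.
have c0 (c : K) x : (0 <= (rho x * theta c x ^+ 2)%:E)%E by rewrite lee_fin mulr_ge0// sqr_ge0.
under eq_bigr do rewrite -cell_massE.
rewrite -big_filter -ge0_integral_sum// [leRHS]integral_mkcond.
apply: ge0_le_integral => //.
- by move=> x _; apply: sume_ge0.
- exact: emeasurable_sum.
- by apply/(measurable_restrictT _ mA); apply: measurable_funTS; exact/measurable_EFinP.
move=> x _; rewrite patchE; case: ifPn => [xA|xA].
  rewrite sumEFin lee_fin big_filter -mulr_sumr ler_piMr// -(sumtheta x).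
  by rewrite [leRHS](bigID S)/= lerDl sumr_ge0// => k _; exact: sqr_ge0.
rewrite big_filter big1// => c Sc; congr EFin.
have [->|t0] := eqVneq (theta c x) 0; first by rewrite expr0n mulr0.
by move: xA; rewrite notin_setE => /(_ (SA c x Sc t0)).
Qed.

Section plan.
Variable P : probability 'M[R]_(N, d) R.
Hypothesis hP : plans rho P.

Definition plan_weight (t : T) : R := (\int[P]_x cell_prod t x)%R.

Lemma plan_weightE t : (\int[P]_x (cell_prod t x)%:E = (plan_weight t)%:E)%E.
Proof.
rewrite /plan_weight /Rintegral fineK//.
apply: (@integrable_fin_num _ _ _ P setT) => //.
apply: (le_integrable _ _ _ (finite_measure_integrable_cst P 1 measurableT)) => //.
  by apply/measurable_EFinP; exact: measurable_cell_prod.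
by move=> x _; rewrite /= lee_fin normr1 ger0_norm ?cell_prod_ge0// cell_prod_le1.
Qed.

Lemma plan_weight_ge0 t : 0 <= plan_weight t.
Proof.
rewrite -lee_fin -plan_weightE; apply: integral_ge0 => x _.
by rewrite lee_fin cell_prod_ge0.
Qed.

Lemma sum_plan_weightE (Q : pred T) : ((\sum_(t | Q t) plan_weight t)%:E =
  \int[P]_x (\sum_(t | Q t) cell_prod t x)%:E)%E.
Proof.
rewrite -sumEFin; under eq_bigr do rewrite -plan_weightE.
rewrite -big_filter -ge0_integral_sum//.
- by apply: eq_integral => x _; rewrite sumEFin big_filter.
- by move=> t; apply/measurable_EFinP; exact: measurable_cell_prod.
- by move=> t x _; rewrite lee_fin cell_prod_ge0.
Qed.

Lemma integral_plan_row i (h : 'rV[R]_d -> R) : measurable_fun setT h ->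
  (forall x, 0 <= h x) ->
  (\int[P]_x (h (row i x))%:E = \int[mu1]_x (h x * rho x)%:E)%E.
Proof.
move=> mh h0; have mhE : measurable_fun setT (EFin \o h) by exact/measurable_EFinP.
have mr := @measurable_row R N d i.
have := @ge0_integral_pushforward _ _ _ _ _ _ mr P setT (EFin \o h) measurableT mhE (fun x _ => h0 x).
rewrite preimage_setT => <-.
rewrite (@ge0_integral_density _ _ _ mu1
  (measure_function_pushforward__canonical__measure_function_Measure P mr) rho)//.
by move=> A mA; exact: hP.
Qed.

Lemma plan_weight_marginal i a : marginal plan_weight i a = cell_mass a.
Proof.
apply: EFin_inj; rewrite /marginal sum_plan_weightE -cell_massE.
under eq_integral => x _ do rewrite sum_cell_prod_at.
rewrite (integral_plan_row i (measurable_cell a)); last by move=> x; exact: sqr_ge0.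
by apply: eq_integral => x _; rewrite mulrC.
Qed.

Lemma sum_plan_weight_le (Q : pred T) (B : set 'M[R]_(N, d)) : measurable B ->
  (forall t x, Q t -> cell_prod t x != 0 -> B x) ->
  ((\sum_(t | Q t) plan_weight t)%:E <= P B)%E.
Proof.
move=> mB QB; rewrite sum_plan_weightE -[X in P X]setIT -integral_indic//.
apply: ge0_le_integral => //.
- by move=> x _; rewrite lee_fin sumr_ge0// => t _; exact: cell_prod_ge0.
- apply/measurable_EFinP; under eq_fun do rewrite -big_filter.
  by apply: measurable_sum => t; exact: measurable_cell_prod.
- by apply/measurable_EFinP; exact: measurable_indic.
move=> x _; rewrite lee_fin indicE; case: (boolP (x \in B)) => [xB|xB].
  rewrite -(sum_cell_prod x) [leRHS](bigID Q)/= lerDl.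
  by apply: sumr_ge0 => t _; exact: cell_prod_ge0.
rewrite big1// => t Qt; apply/eqP; apply: contraNT xB => tx.
by apply/mem_set; exact: QB tx.
Qed.

Lemma sum_plan_weight : \sum_t plan_weight t = 1.
Proof.
apply: EFin_inj; rewrite (sum_plan_weightE xpredT).
under eq_integral => x _ do rewrite sum_cell_prod.
rewrite (integral_cst P measurableT 1) mul1e. exact: probability_setT.
Qed.

End plan.

End discretisation.

(** * Geometry of the Coulomb cost *)

Section coulomb_geometry.
Context {R : realType} {d N : nat}.
Implicit Types x y : 'M[R]_(N, d).

Lemma norm_le_pair_dist i j x : `|row i x - row j x| <= pair_dist i j x.
Proof.
apply/mx_norm_leP; first exact: pair_dist_ge0.
move=> i' k; rewrite (ord1 i') !mxE pair_distE -sqrtr_sqr ler_wsqrtr//.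
by rewrite (bigD1 k)//= lerDl sumr_ge0// => l _; exact: sqr_ge0.
Qed.

Lemma coord_le_pair_dist i j k x : `|x i k - x j k| <= pair_dist i j x.
Proof.
apply: le_trans (norm_le_pair_dist i j x).
by have := ler_mx_coord (row i x - row j x) ord0 k; rewrite !mxE.
Qed.

Lemma pair_dist_le_norm i j x : pair_dist i j x <= d%:R * `|row i x - row j x|.
Proof.
rewrite -[leRHS]ger0_norm ?mulr_ge0// -sqrtr_sqr pair_distE ler_wsqrtr// exprMn.
apply: (@le_trans _ _ (\sum_(k < d) `|row i x - row j x| ^+ 2)).
  apply: ler_sum => k _; rewrite -real_normK ?num_real// lerXn2r ?nnegrE//.
  by have := ler_mx_coord (row i x - row j x) ord0 k; rewrite !mxE.
rewrite sumr_const card_ord -[leLHS]mulr_natl ler_wpM2r ?exprn_ge0//.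
by rewrite -natrX ler_nat; case: d => // k; rewrite -mulnn leq_pmulr.
Qed.

Lemma pair_dist_ratio (h e alpha : R) i j x y : 0 < alpha -> 0 < e -> h <= alpha ->
  0 <= h -> 8 * d%:R * h <= e * alpha ->
  `|row i x - row i y| <= h -> `|row j x - row j y| <= h ->
  alpha <= `|row i x - row j x| -> pair_dist i j y <= (1 + e) * pair_dist i j x.
Proof.
move=> a0 e0 ha h0 he xyi xyj xij.
set A := pair_dist i j x.
have A0 : alpha <= A by apply: le_trans xij _; exact: norm_le_pair_dist.
have A00 : 0 <= A by apply: le_trans A0; exact: ltW.
have e10 : 0 <= 1 + e by rewrite addr_ge0// ltW.
rewrite -[leRHS]ger0_norm ?mulr_ge0// -sqrtr_sqr [pair_dist i j y]pair_distE ler_wsqrtr//.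
have AE : A ^+ 2 = \sum_(k < d) (x i k - x j k) ^+ 2.
  by rewrite /A pair_distE sqr_sqrtr// sumr_ge0// => k _; exact: sqr_ge0.
apply: (@le_trans _ _ (\sum_(k < d) ((x i k - x j k) ^+ 2 + 8 * h * A))).
  apply: ler_sum => k _.
  have := coord_le_pair_dist i j k x; rewrite -/A.
  have := le_trans (ler_mx_coord (row i x - row i y) ord0 k) xyi.
  have := le_trans (ler_mx_coord (row j x - row j y) ord0 k) xyj.
  rewrite !mxE !ler_norml.
  move: (x i k) (x j k) (y i k) (y j k) => a b a' b'.
  move=> /andP[b1 b2] /andP[a1 a2] /andP[c1 c2].
  have D1 : - (2 * h) <= (a' - b') - (a - b) by lra.
  have D2 : (a' - b') - (a - b) <= 2 * h by lra.
  move: D1 D2 c1 c2; set u := a - b; set v := a' - b' => D1 D2 c1 c2.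
  have -> : v ^+ 2 = u ^+ 2 + (v - u) * (2 * u + (v - u)) by ring.
  rewrite lerD2l; apply: le_trans (ler_norm _) _; rewrite normrM.
  apply: (@le_trans _ _ (2 * h * (4 * A))); last by rewrite le_eqVlt; apply/orP; left; apply/eqP; ring.
  apply: ler_pM => //.
    by rewrite ler_norml D1 D2.
  rewrite ler_norml; apply/andP; split; lra.
rewrite big_split /= -AE sumr_const card_ord -[X in _ + X]mulr_natl exprMn.
have e2 : 1 + e <= (1 + e) ^+ 2 by rewrite expr2 ler_peMr// lerDl ltW.
apply: (@le_trans _ _ ((1 + e) * A ^+ 2)); last by rewrite ler_wpM2r ?exprn_ge0.
rewrite [(1 + e) * _]mulrDl mul1r lerD2l.
rewrite (_ : d%:R * (8 * h * A) = 8 * d%:R * h * A); last by ring.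
rewrite expr2 [leRHS]mulrA.
rewrite ler_wpM2r//; apply: (le_trans he); rewrite ler_wpM2l//; exact: ltW.
Qed.

Lemma inv_pair_dist_le i j x (g : R) : 0 < g -> g <= `|row i x - row j x| ->
  ((pair_dist i j x)%:E^-1 <= (g^-1)%:E)%E.
Proof.
move=> g0 gx; have gp := le_trans gx (norm_le_pair_dist i j x).
have p0 := lt_le_trans g0 gp.
by rewrite inver gt_eqF// lee_fin lef_pV2// posrE.
Qed.

Lemma coulomb_le x (g : R) : 0 < g ->
  (forall i j, i != j -> g <= `|row i x - row j x|) ->
  (coulomb x <= (N%:R * N%:R / g)%:E)%E.
Proof.
move=> g0 gx; rewrite coulombE.
apply: (@le_trans _ _ (\sum_(i < N) \sum_(j < N) (g^-1)%:E)%E).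
  apply: lee_sum => i _; rewrite big_mkcond; apply: lee_sum => j _.
  case: ifPn => [ij|_]; last by rewrite lee_fin invr_ge0 ltW.
  by apply: inv_pair_dist_le => //; apply: gx; rewrite neq_ltn ij.
under eq_bigr do rewrite sumEFin.
rewrite sumEFin lee_fin !sumr_const !card_ord -mulrnA -[leLHS]mulr_natl.
by rewrite natrM.
Qed.

Lemma coulomb_ge i j x (g : R) : 0 < g -> i != j -> (0 < d)%N ->
  `|row i x - row j x| <= g -> (((d%:R * g)^-1)%:E <= coulomb x)%E.
Proof.
move=> g0; wlog: i j / (i < j)%N => [H|ij].
  rewrite neq_ltn => /orP[ij|ji] d0 gx; first by apply: (H i j) => //; rewrite neq_ltn ij.
  by apply: (H j i) => //; [rewrite neq_ltn ji|rewrite distrC].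
move=> _ d0 gx; rewrite coulombE (bigD1 i)//= (bigD1 j)//= -addeA.
apply: (@le_trans _ _ ((pair_dist i j x)%:E^-1)%E); last first.
  rewrite leeDl// adde_ge0//; first by apply: sume_ge0 => k _; exact: inv_pair_dist_ge0.
  by apply: sume_ge0 => k _; apply: sume_ge0 => l _; exact: inv_pair_dist_ge0.
have dg : pair_dist i j x <= d%:R * g.
  by apply: (le_trans (pair_dist_le_norm i j x)); rewrite ler_wpM2l.
rewrite inver; case: eqP => [_|/eqP p0]; first by rewrite leey.
have pp : 0 < pair_dist i j x by rewrite lt_neqAle eq_sym p0 pair_dist_ge0.
by rewrite lee_fin lef_pV2// ?posrE// (lt_le_trans pp).
Qed.

Lemma coulomb_ratio (e : R) x y : 0 <= e ->
  (forall i j, i != j -> 0 < pair_dist i j x /\ 0 < pair_dist i j y /\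
     pair_dist i j y <= (1 + e) * pair_dist i j x) ->
  (coulomb x <= (1 + e)%:E * coulomb y)%E.
Proof.
move=> e0 H; rewrite !coulombE ge0_sume_distrr; last first.
  by move=> i _; apply: sume_ge0 => j _; exact: inv_pair_dist_ge0.
apply: lee_sum => i _; rewrite ge0_sume_distrr; last by move=> j _; exact: inv_pair_dist_ge0.
apply: lee_sum => j ij; have [px [py pxy]] := H i j (ltac:(by rewrite neq_ltn ij)).
rewrite !inver !gt_eqF// -EFinM lee_fin.
rewrite -[leLHS]mul1r ler_pdivrMr// mulrAC ler_pdivlMr// mul1r.
exact: pxy.
Qed.

Lemma coulomb_sym (s : 'S_N) x : coulomb (row_perm s x) = coulomb x.
Proof.
have pds i j : pair_dist i j (row_perm s x) = pair_dist (s i) (s j) x.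
  by rewrite !pair_distE; congr Num.sqrt; apply: eq_bigr => k _; rewrite !mxE.
have pdC i j z : pair_dist i j z = pair_dist j i z.
  by rewrite !pair_distE; congr Num.sqrt; apply: eq_bigr => k _; rewrite -sqrrN opprB.
have E z : (coulomb z + coulomb z = \sum_(i < N) \sum_(j < N | i != j) (pair_dist i j z)%:E^-1)%E.
  rewrite coulombE.
  rewrite {2}(exchange_big_dep xpredT)//= -big_split/=; apply: eq_bigr => i _.
  under [X in (_ + X)%E]eq_bigr => j _ do rewrite pdC.
  rewrite [RHS](bigID (fun j : 'I_N => (i < j)%N))/=; congr (_ + _)%E; apply: eq_bigl => j.
    by case: ltngtP => //; rewrite ?andbT ?andbF// neq_ltn => ->.
  by rewrite neq_ltn; case: ltngtP.
have : (coulomb (row_perm s x) + coulomb (row_perm s x) = coulomb x + coulomb x)%E.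
  rewrite !E [RHS](reindex_inj (@perm_inj _ s))/=; apply: eq_bigr => i _.
  rewrite [RHS](reindex_inj (@perm_inj _ s))/=; apply: eq_big => j; first by rewrite (inj_eq perm_inj).
  by move=> _; rewrite pds.
have := coulomb_ge0 (row_perm s x); have := coulomb_ge0 x.
case: (coulomb x) (coulomb (row_perm s x)) => [a| |] [b| |]// _ _.
by rewrite -!EFinD => -[ab]; congr EFin; lra.
Qed.

Lemma coulomb_markov (P : probability 'M[R]_(N, d) R) (c0 k : R) :
  (\int[P]_x coulomb x <= c0%:E)%E -> 0 < k ->
  (P [set x | (k%:E <= coulomb x)%E] <= (c0 / k)%:E)%E.
Proof.
move=> Pc k0; set B := [set x | _].
have mB : measurable B.
  rewrite (_ : B = coulomb @^-1` `[k%:E, +oo%E]%classic).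
    by rewrite -[X in measurable X]setTI; apply: measurable_coulomb => //; exact: emeasurable_itv.
  by apply/seteqP; split => x; rewrite /B/= in_itv/= leey andbT.
have : (k%:E * P B <= c0%:E)%E.
  apply: le_trans Pc; rewrite -integral_cst//.
  apply: (@le_trans _ _ (\int[P]_(x in B) coulomb x))%E.
    apply: ge0_le_integral => //.
    - by move=> x _; rewrite lee_fin ltW.
    - by apply: measurable_funTS; exact: measurable_coulomb.
  apply: ge0_subset_integral => //; first exact: measurable_coulomb.
  by move=> x _; exact: coulomb_ge0.
by move=> H; rewrite EFinM [X in (_ <= X)%E]muleC lee_pdivlMl//.
Qed.

End coulomb_geometry.

(** * Costs of cells *)

Section discrete_plan.
Context {R : realType} {d N : nat}.
Local Notation mu1 := (lebesgue_mx R 1 d).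
Local Notation mu := (lebesgue_mx R N d).
Variables (rho : 'rV[R]_d -> R).
Hypothesis mrho : measurable_fun setT rho.
Hypothesis rho0 : forall x, 0 <= rho x.
Hypothesis rho1 : (\int[mu1]_x (rho x)%:E = 1)%E.
Hypothesis d0 : (0 < d)%N.
Variables (P : probability 'M[R]_(N, d) R) (c0 : R).
Hypothesis hP : plans rho P.
Hypothesis Pc : (\int[P]_x coulomb x <= c0%:E)%E.

Section fixed_partition.
Variables (K : finType) (theta : K -> 'rV[R]_d -> R) (h r : R).
Hypothesis stheta : forall k, smooth (theta k).
Hypothesis sumtheta : forall x, \sum_k theta k x ^+ 2 = 1.
Hypothesis cell_size : forall k,
  (forall x y, theta k x != 0 -> theta k y != 0 -> `|x - y| <= h) \/
  (forall x, theta k x != 0 -> r <= `|x|).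
Local Notation T := {ffun 'I_N -> K}.
Local Notation m := (cell_mass rho theta).
Local Notation w := (plan_weight theta P).

Definition cellsep (g : R) (a b : K) : bool :=
  `[< forall x y, theta a x != 0 -> theta b y != 0 -> g <= `|x - y| >].

Definition cellsmall (a : K) : bool :=
  `[< forall x y, theta a x != 0 -> theta a y != 0 -> `|x - y| <= h >].

Definition good (g : R) (t : T) : bool :=
  [forall i, cellsmall (t i)] && separated (cellsep g) t.

Lemma cellsepC g : symmetric (cellsep g).
Proof.
by move=> a b; apply/asboolP/asboolP => H x y ax by_; rewrite distrC; exact: H.
Qed.

Lemma cell_far a x : ~~ cellsmall a -> theta a x != 0 -> r <= `|x|.
Proof. by move=> /asboolPn na ax; have [/na|] := cell_size a; [|exact]. Qed.

Lemma measurable_cost t : measurable_fun setT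
  (fun x => coulomb x * (\prod_(i < N) (rho (row i x) * theta (t i) (row i x) ^+ 2))%:E)%E.
Proof.
apply: emeasurable_funM; first exact: measurable_coulomb.
apply/measurable_EFinP; apply: measurable_prod => i _.
apply: (measurableT_comp (f := fun x => rho x * theta (t i) x ^+ 2)).
  by apply: measurable_funM => //; exact: measurable_cell.
exact: measurable_row.
Qed.

Definition cell_cost (t : T) : \bar R :=
  (\int[mu]_x (coulomb x * (\prod_(i < N) (rho (row i x) * theta (t i) (row i x) ^+ 2))%:E))%E.

Let q_ge0 (t : T) (x : 'M[R]_(N, d)) :
  0 <= \prod_(i < N) (rho (row i x) * theta (t i) (row i x) ^+ 2).
Proof. by apply: prodr_ge0 => i _; rewrite mulr_ge0// sqr_ge0. Qed.

Lemma cell_cost_ge0 t : (0 <= cell_cost t)%E.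
Proof. by apply: integral_ge0 => x _; rewrite mule_ge0 ?coulomb_ge0// lee_fin. Qed.

Let mq (t : T) : measurable_fun setT (fun x : 'M[R]_(N, d) =>
  (\prod_(i < N) (rho (row i x) * theta (t i) (row i x) ^+ 2))%:E).
Proof.
apply/measurable_EFinP; apply: measurable_prod => i _.
apply: (measurableT_comp (f := fun x => rho x * theta (t i) x ^+ 2)).
  by apply: measurable_funM => //; exact: measurable_cell.
exact: measurable_row.
Qed.

Let cell_prod_supp (t : T) (x : 'M[R]_(N, d)) :
  \prod_(i < N) (rho (row i x) * theta (t i) (row i x) ^+ 2) != 0 ->
  forall i, theta (t i) (row i x) != 0.
Proof.
move=> + i; apply: contra => /eqP ti.
by rewrite (bigD1 i)//= ti expr0n mulr0 mul0r.
Qed.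

Lemma cell_cost_le (t : T) (k : R) : 0 <= k ->
  (forall x, (forall i, theta (t i) (row i x) != 0) -> (coulomb x <= k%:E)%E) ->
  (cell_cost t <= (k * \prod_(i < N) m (t i))%:E)%E.
Proof.
move=> k0 ck; rewrite EFinM -(integral_cells mrho rho0 rho1 stheta sumtheta).
rewrite -ge0_integralZl//; last by move=> x _; rewrite lee_fin.
apply: ge0_le_integral => //.
- by move=> x _; rewrite mule_ge0 ?coulomb_ge0// lee_fin.
- exact: measurable_cost.
- exact: emeasurable_funM.
move=> x _; set q := \prod_(i < N) _.
have [->|q0] := eqVneq q 0; first by rewrite !mule0.
by rewrite lee_wpmul2r ?lee_fin ?q_ge0//; apply: ck; exact: cell_prod_supp q0.
Qed.

Lemma separated_dist g (t : T) x : separated (cellsep g) t ->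
  (forall i, theta (t i) (row i x) != 0) ->
  forall i j, i != j -> g <= `|row i x - row j x|.
Proof. by move=> /separatedP st xt i j ij; have /asboolP := st i j ij; apply. Qed.

Lemma separated_cost g (t : T) : 0 < g -> separated (cellsep g) t ->
  (cell_cost t <= (N%:R * N%:R / g * \prod_(i < N) m (t i))%:E)%E.
Proof.
move=> g0 st; apply: cell_cost_le; first by rewrite divr_ge0 ?mulr_ge0// ltW.
move=> x xt; apply: coulomb_le => //; exact: (separated_dist st xt).
Qed.

Lemma good_cost e alpha (t : T) : 0 < e -> 0 < alpha -> 0 <= h -> h <= alpha ->
  8 * d%:R * h <= e * alpha -> good alpha t ->
  ((w t)%:E * cell_cost t <= ((1 + e) * \prod_(i < N) m (t i))%:E *
    \int[P]_x (coulomb x * (cell_prod theta t x)%:E))%E.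
Proof.
move=> e0 a0 h0 ha he /andP[/forallP small st].
have e10 : 0 <= 1 + e by rewrite addr_ge0// ltW.
have m0 : 0 <= \prod_(i < N) m (t i).
  by apply: prodr_ge0 => i _; exact: (cell_mass_ge0 mrho rho0 rho1 stheta sumtheta).
have mcp : measurable_fun setT (fun x : 'M[R]_(N, d) => (cell_prod theta t x)%:E).
  by apply/measurable_EFinP; exact: measurable_cell_prod.
rewrite muleC -(plan_weightE stheta sumtheta) -ge0_integralZl//; last 2 first.
- by move=> x _; rewrite lee_fin cell_prod_ge0.
- exact: cell_cost_ge0.
rewrite -ge0_integralZl//; last 3 first.
- by apply: emeasurable_funM => //; exact: measurable_coulomb.
- by move=> x _; rewrite mule_ge0 ?coulomb_ge0// lee_fin cell_prod_ge0.
- by rewrite lee_fin mulr_ge0.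
apply: ge0_le_integral => //.
- by move=> y _; rewrite mule_ge0 ?cell_cost_ge0// lee_fin cell_prod_ge0.
- exact: emeasurable_funM.
- by apply: emeasurable_funM => //; apply: emeasurable_funM => //; exact: measurable_coulomb.
move=> y _; rewrite muleA.
have [->|yt] := eqVneq (cell_prod theta t y) 0; first by rewrite !mule0.
rewrite lee_wpmul2r ?lee_fin ?cell_prod_ge0//.
have yt' := cell_prod_neq0 yt.
have sy := separated_dist st yt'.
have cyfin : coulomb y \is a fin_num.
  by rewrite ge0_fin_numE ?coulomb_ge0// (le_lt_trans (coulomb_le a0 sy))// ltry.
rewrite -(fineK cyfin) -EFinM mulrAC; apply: cell_cost_le.
  by rewrite mulr_ge0// fine_ge0// coulomb_ge0.
move=> x xt; rewrite EFinM fineK//.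
have sx := separated_dist st xt.
apply: coulomb_ratio; first exact: ltW.
move=> i j ij; split; first by apply: (lt_le_trans a0); apply: le_trans (sx i j ij) _; exact: norm_le_pair_dist.
split; first by apply: (lt_le_trans a0); apply: le_trans (sy i j ij) _; exact: norm_le_pair_dist.
apply: (pair_dist_ratio a0 e0 ha h0 he) (sx i j ij).
  by have /asboolP := small i; apply.
by have /asboolP := small j; apply.
Qed.

Lemma bad_weight g tail : 0 < g -> h <= g / 2 ->
  (\int[mu1]_(x in [set x | (r <= `|x|)%R]) (rho x)%:E <= tail%:E)%E ->
  \sum_(t | ~~ good g t) w t <= N%:R * tail + 2 * d%:R * g * c0.
Proof.
move=> g0 hg Htail.
have w0 := plan_weight_ge0 stheta sumtheta P.
apply: (@le_trans _ _ (\sum_(i < N) \sum_(t : T | ~~ cellsmall (t i)) w t +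
   \sum_(t : T | [forall i, cellsmall (t i)] && ~~ separated (cellsep g) t) w t)).
  rewrite (bigID (fun t : T => [forall i, cellsmall (t i)]))/= addrC; apply: lerD.
    under [leRHS]eq_bigr do rewrite big_mkcond.
    rewrite exchange_big /= big_mkcond; apply: ler_sum => t _.
    case: ifPn => [/andP[_]|_]; last by apply: sumr_ge0 => i _; case: ifP.
    rewrite negb_forall => /existsP[i ti]; rewrite (bigD1 i)//= ti lerDl.
    by apply: sumr_ge0 => j _; case: ifP.
  rewrite le_eqVlt; apply/orP; left; apply/eqP; apply: eq_bigl => t.
  by rewrite /good; case: [forall i, _]; rewrite ?andbT ?andbF.
apply: lerD.
  rewrite mulr_natl -[X in _ <= _ *+ X](card_ord N) -sumr_const; apply: ler_sum => i _.
  rewrite (partition_big (fun t : T => t i) (fun a => ~~ cellsmall a))//=.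
  apply: (@le_trans _ _ (\sum_(a | ~~ cellsmall a) m a)).
    apply: ler_sum => a _.
    rewrite -(plan_weight_marginal mrho rho0 rho1 stheta sumtheta hP i a) /marginal.
    rewrite [leRHS](bigID (fun t : T => ~~ cellsmall (t i)))/=.
    rewrite (eq_bigl (fun t : T => (t i == a) && ~~ cellsmall (t i))); last by move=> t; rewrite andbC.
    by rewrite lerDl; apply: sumr_ge0.
  rewrite -lee_fin; apply: le_trans Htail.
  apply: (sum_cell_mass_le mrho rho0 rho1 stheta sumtheta); first exact: measurable_norm_ge.
  by move=> c x; exact: cell_far.
rewrite -lee_fin.
have k0 : 0 < (d%:R * (2 * g))^-1 by rewrite invr_gt0 !mulr_gt0// ltr0n.
apply: (@le_trans _ _ (P [set x | (((d%:R * (2 * g))^-1)%:E <= coulomb x)%E])); last first.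
  apply: (le_trans (coulomb_markov Pc k0)).
  by rewrite lee_fin invrK le_eqVlt; apply/orP; left; apply/eqP; ring.
apply: sum_plan_weight_le => //.
  set B := [set x | _].
  rewrite (_ : B = coulomb @^-1` `[((d%:R * (2 * g))^-1)%:E, +oo%E]%classic).
    by rewrite -[X in measurable X]setTI; apply: measurable_coulomb => //; exact: emeasurable_itv.
  by apply/seteqP; split => x; rewrite /B/= in_itv/= leey andbT.
move=> t x /andP[/forallP small nsep] /cell_prod_neq0 xt.
have [i [j [ij /asboolPn {}nsep]]] :
    exists i j, i != j /\ ~~ cellsep g (t i) (t j).
  move: nsep; apply: contraNP => H; apply/separatedP => i j ij.
  by apply: contrapT => /negP nij; apply: H; exists i, j.
apply: (coulomb_ge (i := i) (j := j)) => //; first exact: mulr_gt0.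
rewrite leNgt; apply/negP => gx; apply: nsep => y z yi zj.
have /asboolP/(_ _ _ (xt i) yi) yx := small i.
have /asboolP/(_ _ _ (xt j) zj) zx := small j.
have : `|row i x - row j x| <= `|row i x - y| + `|y - z| + `|row j x - z|.
  rewrite -[row i x - row j x](subrKA y) -[y - row j x](subrKA z) addrA [in X in _ <= _ + X]distrC.
  by rewrite !(le_trans (ler_normD _ _))// lerD2r ler_normD.
by move: hg gx yx zx; lra.
Qed.

Lemma near_mass beta delta a : 0 < beta -> h <= beta / 2 ->
  (forall x, \int[mu1]_(y in [set y | (`|y - x| <= 2 * beta)%R]) (rho y)%:E <= delta%:E)%E ->
  (\int[mu1]_(y in [set y | (r - 2 * beta <= `|y|)%R]) (rho y)%:E <= delta%:E)%E ->
  \sum_(c | ~~ cellsep beta a c) m c <= 2 * delta.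
Proof.
move=> b0 hb Hball Htail.
have far c z : (exists x y, [/\ theta a x != 0, theta c y != 0 & `|x - y| < beta]) ->
    ~~ cellsmall a || ~~ cellsmall c -> theta c z != 0 -> r - 2 * beta <= `|z|.
  move=> [x [y [ax cy xy]]] ac cz.
  have [sc|nc] := boolP (cellsmall c); last first.
    by apply: le_trans (cell_far nc cz); rewrite gerBl mulr_ge0// ltW.
  move: ac; rewrite sc orbF => na; have := cell_far na ax.
  have /asboolP/(_ _ _ cy cz) yz := sc.
  have : `|x| <= `|x - y| + `|y - z| + `|z|.
    rewrite -{1}[x](subrK y) -{2}[y](subrK z) addrA.
    by rewrite !(le_trans (ler_normD _ _))// lerD2r ler_normD.
  move: hb yz xy; lra.
have nsepP c : ~~ cellsep beta a c ->
    exists x y, [/\ theta a x != 0, theta c y != 0 & `|x - y| < beta].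
  move=> /asboolPn nc; apply: contrapT => H; apply: nc => x y ax cy.
  by rewrite leNgt; apply/negP => xy; apply: H; exists x, y.
have sumle S A := @sum_cell_mass_le R d rho K theta mrho rho0 rho1 stheta sumtheta S A.
have delta0 : 0 <= delta.
  by rewrite -lee_fin; apply: le_trans Htail; apply: integral_ge0 => x _; rewrite lee_fin.
rewrite (bigID (fun c => cellsmall a && cellsmall c))/= mulr_natl mulr2n; apply: lerD; last first.
  rewrite -lee_fin; apply: le_trans Htail; apply: sumle; first exact: measurable_norm_ge.
  by move=> c x /andP[/nsepP nc]; rewrite negb_and => ac; exact: far.
have [[x ax]|nx] := pselect (exists x, theta a x != 0); last first.
  rewrite big1// => c /andP[/nsepP[x [y [ax _ _]]] _]; exfalso.
  by apply: nx; exists x.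
rewrite -lee_fin; apply: le_trans (Hball x); apply: sumle; first exact: measurable_dist_le.
move=> c z /andP[/nsepP[x' [y [ax' cy xy]]] /andP[/asboolP sa /asboolP sc]] cz /=.
have := sa _ _ ax ax'; have := sc _ _ cy cz => yz xx'.
have h1 := ler_distD y z x; have h2 := ler_distD x' y x.
rewrite (distrC z y) in h1; rewrite (distrC y x') (distrC x' x) in h2.
by move: hb yz xx' xy h1 h2; lra.
Qed.

End fixed_partition.
End discrete_plan.

(** * Separated plans *)

Section discrete_plan_exists.
Context {R : realType} {d N : nat}.
Local Notation mu1 := (lebesgue_mx R 1 d).
Local Notation mu := (lebesgue_mx R N d).
Variables (rho : 'rV[R]_d -> R).
Hypothesis mrho : measurable_fun setT rho.
Hypothesis rho0 : forall x, 0 <= rho x.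
Hypothesis rho1 : (\int[mu1]_x (rho x)%:E = 1)%E.
Hypothesis d0 : (0 < d)%N.
Variables (P : probability 'M[R]_(N, d) R) (c0 : R).
Hypothesis hP : plans rho P.
Hypothesis Pc : (\int[P]_x coulomb x <= c0%:E)%E.

Section fixed_partition.
Variables (K : finType) (theta : K -> 'rV[R]_d -> R) (h : R).
Hypothesis stheta : forall k, smooth (theta k).
Hypothesis sumtheta : forall x, \sum_k theta k x ^+ 2 = 1.
Local Notation T := {ffun 'I_N -> K}.
Local Notation m := (cell_mass rho theta).
Local Notation w := (plan_weight theta P).
Local Notation J := (@cell_cost R d N rho K theta).
Local Notation pm t := (\prod_(i < N) m (t i)).

Let m_ge0 := cell_mass_ge0 mrho rho0 rho1 stheta sumtheta.
Let pm_ge0 (t : T) : 0 <= pm t.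
Proof. by apply: prodr_ge0. Qed.

Let J_ge0 (t : T) : (0 <= J t)%E.
Proof. exact: (cell_cost_ge0 rho0). Qed.

Lemma rearranged_cost (alpha beta e eta delta : R) :
  0 < e -> 0 < alpha -> alpha <= beta -> 0 <= h -> h <= alpha ->
  8 * d%:R * h <= e * alpha ->
  \sum_(t | ~~ good theta h alpha t) w t <= eta ->
  \sum_(t | ~~ good theta h beta t) w t <= 1 / 4 ->
  (forall a, \sum_(c | ~~ cellsep theta beta a c) m c <= delta) ->
  N%:R * N%:R * delta <= 1 / 4 -> N%:R * (2 * eta) <= 1 ->
  exists w' : T -> R, [/\ forall t, 0 <= w' t,
    forall i a, marginal w' i a = m a,
    forall t, w' t != 0 -> separated (cellsep theta alpha) t &
    (\sum_t (w' t / pm t)%:E * J t <=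
      ((1 + e) * c0 + N%:R * N%:R / beta * ((N%:R + 1) * eta))%:E)%E].
Proof.
move=> e0 a0 ab h0 ha he Heta Hb Hdelta HN Hne.
have w0 := plan_weight_ge0 stheta sumtheta P.
have b0 : 0 < beta by exact: lt_le_trans ab.
pose wg t := if good theta h alpha t then w t else 0.
pose ws t := if good theta h beta t then w t else 0.
pose b t := if good theta h alpha t then 0 else w t.
have sepab : forall x y, cellsep theta beta x y -> cellsep theta alpha x y.
  by move=> x y /asboolP H; apply/asboolP => u v ux vy; apply: (le_trans ab); exact: H.
have goodab (t : T) : good theta h beta t -> good theta h alpha t.
  move=> /andP[sm /separatedP st]; rewrite /good sm; apply/separatedP => i j ij.
  by apply: sepab; exact: st.
have sumb : \sum_t b t = \sum_(t | ~~ good theta h alpha t) w t.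
  by rewrite [RHS]big_mkcond; apply: eq_bigr => t _; rewrite /b; case: ifP.
have eta'0 : 0 <= \sum_(t | ~~ good theta h alpha t) w t by apply: sumr_ge0.
have [|||||||||w' [r [w'le w'm r0 rS sumr]]] :=
  @rearrange R K N (cellsep theta beta) (cellsepC theta beta) wg ws b m
    (\sum_(t | ~~ good theta h alpha t) w t) delta.
- move=> t; rewrite /ws /wg; case: ifPn => [gb|_]; first by rewrite (goodab _ gb) w0/=.
  by rewrite lexx/=; case: ifP.
- by move=> t; rewrite /b; case: ifP.
- by move=> t; rewrite /ws; case: ifPn => [/andP[_ st] _//|]; rewrite eqxx.
- exact: sumb.
- have := sum_plan_weight stheta sumtheta P.
  rewrite (bigID (good theta h beta))/= => E.
  rewrite /ws -big_mkcond/=; lra.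
- move=> i a; rewrite -(plan_weight_marginal mrho rho0 rho1 stheta sumtheta hP i a).
  rewrite /marginal -big_split; apply: eq_bigr => t _.
  by rewrite /wg /b /=; case: ifP; rewrite ?addr0 ?add0r.
- exact: Hdelta.
- exact: HN.
- by apply: le_trans Hne; rewrite ler_wpM2l// ler_wpM2l.
exists w'; split => //.
- by move=> t; have /andP[] := w'le t.
- move=> t w't; have [gt|ngt] := boolP (good theta h alpha t); first by case/andP: gt.
  have /andP[w1 w2] := w'le t.
  have rt : r t != 0.
    apply: contra w't => /eqP rt; rewrite eq_le w1 andbT; apply: le_trans w2 _.
    by rewrite rt addr0 /wg (negbTE ngt).
  have /separatedP st := rS t rt; apply/separatedP => i j ij.
  by apply: sepab; exact: st.
pose I t := (\int[P]_x (coulomb x * (cell_prod theta t x)%:E))%E.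
have I0 t : (0 <= I t)%E.
  by apply: integral_ge0 => x _; rewrite mule_ge0 ?coulomb_ge0// lee_fin cell_prod_ge0.
have sumI : (\sum_t I t = \int[P]_x coulomb x)%E.
  rewrite -ge0_integral_sum//.
  - apply: eq_integral => x _; rewrite -ge0_sume_distrr => [|t _]; last by rewrite lee_fin cell_prod_ge0.
    by rewrite sumEFin sum_cell_prod// mule1.
  - move=> t; apply: emeasurable_funM; first exact: measurable_coulomb.
    by apply/measurable_EFinP; exact: measurable_cell_prod.
  - by move=> t x _; rewrite mule_ge0 ?coulomb_ge0// lee_fin cell_prod_ge0.
apply: (@le_trans _ _ (\sum_t ((1 + e)%:E * I t + (N%:R * N%:R / beta * r t)%:E))%E).
  apply: lee_sum => t _; have /andP[w1 w2] := w'le t.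
  apply: (@le_trans _ _ ((wg t / pm t)%:E * J t + (r t / pm t)%:E * J t)%E).
    rewrite -ge0_muleDl ?lee_fin ?divr_ge0//.
      by rewrite -EFinD -mulrDl lee_wpmul2r// lee_fin ler_wpM2r// invr_ge0.
    by rewrite /wg; case: ifP.
  have e10 : 0 <= 1 + e by rewrite addr_ge0// ltW.
  apply: leeD.
    rewrite /wg; case: ifPn => [gt|_]; last by rewrite mul0r mul0e mule_ge0// lee_fin.
    have [p0|p0] := eqVneq (pm t) 0.
      by rewrite p0 invr0 mulr0 mul0e mule_ge0// lee_fin.
    have := good_cost mrho rho0 rho1 P stheta sumtheta e0 a0 h0 ha he gt.
    have pgt : 0 < pm t by rewrite lt_neqAle eq_sym p0 pm_ge0.
    move=> H; rewrite mulrC EFinM -muleA -[X in (X <= _)%E]mul1e.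
    apply: (@le_trans _ _ ((pm t)^-1%:E * (((1 + e) * pm t)%:E * I t))%E).
      by rewrite mul1e lee_wpmul2l// lee_fin invr_ge0.
    by rewrite muleA -EFinM mulrCA mulVf// mulr1.
  have [->|rt] := eqVneq (r t) 0; first by rewrite mul0r mulr0 mul0e.
  have := separated_cost mrho rho0 rho1 stheta sumtheta b0 (rS t rt) => H.
  have [p0|p0] := eqVneq (pm t) 0.
    by rewrite p0 invr0 mulr0 mul0e lee_fin mulr_ge0// divr_ge0 ?mulr_ge0// ltW.
  apply: (@le_trans _ _ ((r t / pm t)%:E * (N%:R * N%:R / beta * pm t)%:E)%E).
    by rewrite lee_wpmul2l// lee_fin divr_ge0.
  by rewrite -EFinM lee_fin mulrCA divfK.
rewrite big_split/= -ge0_sume_distrr// sumI sumEFin -mulr_sumr sumr [X in (_ <= X)%E]EFinD.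
apply: leeD.
  by rewrite EFinM lee_wpmul2l// lee_fin addr_ge0// ltW.
rewrite lee_fin ler_wpM2l ?divr_ge0 ?mulr_ge0 ?(ltW b0)//.
by rewrite ler_wpM2l.
Qed.

Let reorder (s : 'S_N) (t : T) : T := [ffun i => t (s i)].

Let reorderK (s : 'S_N) : cancel (reorder s) (reorder (s^-1)%g).
Proof. by move=> t; apply/ffunP => i; rewrite !ffunE permKV. Qed.

Let reorder_bij (s : 'S_N) : bijective (reorder s).
Proof.
exists (reorder s^-1%g); first exact: reorderK.
by move=> t; apply/ffunP => i; rewrite !ffunE permK.
Qed.

Let pm_reorder (s : 'S_N) (t : T) : pm (reorder s t) = pm t.
Proof.
rewrite [RHS](reindex_inj (@perm_inj _ s))/=.
by apply: eq_bigr => i _; rewrite ffunE.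
Qed.

Let J_reorder (s : 'S_N) (t : T) : J (reorder s t) = J t.
Proof.
rewrite /cell_cost -(ge0_integral_row_perm s).
- apply: eq_integral => x _; rewrite coulomb_sym; congr (_ * _%:E)%E.
  rewrite [RHS](reindex_inj (@perm_inj _ s))/=; apply: eq_bigr => i _.
  rewrite ffunE; suff -> : row i (row_perm s x) = row (s i) x by [].
  by apply/rowP => k; rewrite !mxE.
- exact: measurable_cost.
- move=> x; rewrite mule_ge0 ?coulomb_ge0// lee_fin; apply: prodr_ge0 => i _.
  by rewrite mulr_ge0// sqr_ge0.
Qed.

Lemma symmetrise (w' : T -> R) (alpha C : R) : (forall t, 0 <= w' t) ->
  (forall i a, marginal w' i a = m a) ->
  (forall t, w' t != 0 -> separated (cellsep theta alpha) t) ->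
  (\sum_t (w' t / pm t)%:E * J t <= C%:E)%E ->
  exists c : T -> R, [/\ forall t, 0 <= c t,
    forall (s : 'S_N) (t : T), c [ffun i => t (s i)] = c t,
    forall i a, \sum_(t : T | t i == a) c t * pm t = m a,
    forall t, c t != 0 -> separated (cellsep theta alpha) t &
    (\sum_t (c t)%:E * J t <= C%:E)%E].
Proof.
move=> w'0 w'm w'S w'c.
pose F : R := N`!%:R.
have F0 : 0 < F by rewrite ltr0n fact_gt0.
have cardS : #|'S_N|%:R = F by rewrite card_Sn.
pose v t := F^-1 * \sum_(s : 'S_N) w' (reorder s t).
have v0 t : 0 <= v t by rewrite mulr_ge0 ?invr_ge0 ?(ltW F0)// sumr_ge0.
have vm i a : marginal v i a = m a.
  rewrite /marginal /v -mulr_sumr exchange_big /=.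
  rewrite (eq_bigr (fun=> m a)) => [|s _].
    by rewrite sumr_const -[X in _ * X]mulr_natl cardS mulKf// gt_eqF.
  rewrite -(w'm (s^-1%g i) a) /marginal [RHS](reindex (reorder s)); last exact: onW_bij.
  by apply: eq_bigl => t; rewrite ffunE permKV.
have vpm (t : T) : pm t = 0 -> v t = 0.
  move=> /eqP; rewrite prodf_seq_eq0 => /hasP[i _ /andP[_ /eqP mi]].
  apply/eqP; rewrite eq_le v0 andbT -mi -(vm i (t i)) /marginal (bigD1 t)//= lerDl.
  by apply: sumr_ge0.
exists (fun t => v t / pm t); split.
- by move=> t; rewrite divr_ge0.
- move=> s t; rewrite -[finfun _]/(reorder s t) pm_reorder; congr (_ / _); congr (_ * _).
  rewrite [RHS](reindex_inj (mulIg s))/=; apply: eq_bigr => s' _; congr w'.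
  by apply/ffunP => i; rewrite !ffunE permM.
- move=> i a; rewrite -(vm i a); apply: eq_bigr => t _.
  by have [p0|p0] := eqVneq (pm t) 0; [rewrite (vpm _ p0) p0 mulr0|rewrite divfK].
- move=> t vt; have : v t != 0 by apply: contra vt => /eqP ->; rewrite mul0r.
  rewrite mulf_eq0 negb_or => /andP[_]; rewrite psumr_neq0 => [|s _]; last exact: w'0.
  move=> /hasP[s _ /andP[_]]; rewrite lt0r => /andP[/w'S/separatedP st _].
  apply/separatedP => i j ij; have := st (s^-1%g i) (s^-1%g j).
  by rewrite (inj_eq perm_inj) => /(_ ij); rewrite !ffunE !permKV.
- apply: le_trans w'c.
  have -> : (\sum_t (v t / pm t)%:E * J t =
      \sum_(s : 'S_N) F^-1%:E * \sum_t (w' (reorder s t) / pm t)%:E * J t)%E.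
    transitivity (\sum_t \sum_(s : 'S_N) F^-1%:E * ((w' (reorder s t) / pm t)%:E * J t))%E.
      apply: eq_bigr => t _; rewrite -ge0_sume_distrr => [|s _]; last first.
        by rewrite mule_ge0// lee_fin divr_ge0.
      rewrite -ge0_sume_distrl => [|s _]; last by rewrite lee_fin divr_ge0.
      by rewrite sumEFin muleA -EFinM -mulr_suml mulrA.
    rewrite exchange_big /=; apply: eq_bigr => s _; rewrite ge0_sume_distrr// => t _.
    by rewrite mule_ge0// lee_fin divr_ge0.
  have E (s : 'S_N) : (\sum_t (w' (reorder s t) / pm t)%:E * J t =
      \sum_t (w' t / pm t)%:E * J t)%E.
    rewrite [RHS](reindex (reorder s)); last exact: onW_bij.
    by apply: eq_bigr => t _; rewrite pm_reorder J_reorder.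
  under eq_bigr => s _ do rewrite E.
  set X := (\sum_t (w' t / pm t)%:E * J t)%E.
  have X0 : (0 <= X)%E by apply: sume_ge0 => t _; rewrite mule_ge0// lee_fin divr_ge0.
  rewrite -ge0_sume_distrl => [|s _]; last by rewrite lee_fin invr_ge0 ltW.
  by rewrite sumEFin sumr_const -mulr_natl cardS mulfV ?mul1e// gt_eqF.
Qed.

End fixed_partition.
End discrete_plan_exists.

Section discrete_plan_thm.
Context {R : realType} {d N : nat}.
Local Notation mu1 := (lebesgue_mx R 1 d).
Local Notation mu := (lebesgue_mx R N d).

Lemma discrete_plan (rho : 'rV[R]_d -> R) (P : probability 'M[R]_(N, d) R)
    (c0 eps : R) :
  measurable_fun setT rho -> (forall x, 0 <= rho x) ->
  (\int[mu1]_x (rho x)%:E = 1)%E -> (0 < d)%N -> plans rho P ->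
  (\int[P]_x coulomb x <= c0%:E)%E -> 0 < eps ->
  exists (K : finType) (theta : K -> 'rV[R]_d -> R) (alpha : R)
    (c : {ffun 'I_N -> K} -> R),
    [/\ [/\ 0 < alpha <= 1, forall k, smooth (theta k),
            forall x, \sum_k theta k x ^+ 2 = 1 &
            forall k v, exists C, forall x, `|'D_v (theta k) x| <= C],
        (forall t, 0 <= c t) /\
          (forall (s : 'S_N) (t : {ffun 'I_N -> K}), c [ffun i => t (s i)] = c t),
        forall t, c t != 0 -> separated (cellsep theta alpha) t,
        forall i a, \sum_(t : {ffun 'I_N -> K} | t i == a)
          c t * \prod_j cell_mass rho theta (t j) = cell_mass rho theta a &
        (\sum_t (c t)%:E * cell_cost rho theta t <= (c0 + eps)%:E)%E].
Proof.
move=> mrho rho0 rho1 d0 hP Pc eps0.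
have c00 : 0 <= c0.
  by rewrite -lee_fin; apply: le_trans Pc; apply: integral_ge0 => x _; exact: coulomb_ge0.
have dR : 1 <= d%:R :> R by rewrite ler1n.
have NR : 0 <= N%:R :> R by [].
have [D DE] : exists D : R, d%:R = D by exists d%:R.
have [M ME] : exists M : R, N%:R = M by exists N%:R.
move: dR NR; rewrite DE ME => dR NR.
pose delta : R := 1 / (8 * (M * M + 1)).
have M0 : 0 < M * M + 1 by nra.
have delta0 : 0 < delta by rewrite divr_gt0// mulr_gt0.
have [b1 b10 Hball] := rho_small_ball mrho rho0 rho1 d0 delta0.
have D0 : 0 < D by apply: lt_le_trans dR.
have c1 : 0 < c0 + 1 by rewrite ltr_wpDl.
have M1 : 0 < M + 1 by rewrite ltr_wpDl.
have q0 : 0 < 1 / (16 * D * (c0 + 1)) by rewrite divr_gt0// !mulr_gt0.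
have [beta [bpos bb1 bc b_le1]] : exists beta : R, [/\ 0 < beta, 2 * beta <= b1, 16 * D * (c0 + 1) * beta <= 1 & beta <= 1].
  exists (Num.min (Num.min (b1 / 2) 1) (1 / (16 * D * (c0 + 1)))).
  have h1 : Num.min (Num.min (b1 / 2) 1) (1 / (16 * D * (c0 + 1))) <= b1 / 2 by rewrite !ge_min lexx.
  have h2 : Num.min (Num.min (b1 / 2) 1) (1 / (16 * D * (c0 + 1))) <= 1 / (16 * D * (c0 + 1)) by rewrite !ge_min lexx !orbT.
  have h3 : Num.min (Num.min (b1 / 2) 1) (1 / (16 * D * (c0 + 1))) <= 1 by rewrite !ge_min lexx !orbT.
  have h4 : 0 < Num.min (Num.min (b1 / 2) 1) (1 / (16 * D * (c0 + 1))) by rewrite !lt_min q0 ltr01 divr_gt0.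
  split => //; first by rewrite mulrC -ler_pdivlMr.
  by rewrite mulrC -ler_pdivlMr// !mulr_gt0.
have [eta [eta0 etaM etaeps]] : exists eta : R, [/\ 0 < eta, M * (2 * eta) <= 1 & M * M / beta * ((M + 1) * eta) <= eps / 2].
  have M2 : 0 < 2 * M + 1 by rewrite ltr_wpDl// mulr_ge0.
  have p1 : 0 < 1 / (2 * M + 1) by rewrite divr_gt0.
  have p2 : 0 < (M * M + 1) / beta * (M + 1) by rewrite mulr_gt0 ?divr_gt0.
  have p3 : 0 < eps / 2 / ((M * M + 1) / beta * (M + 1)) by rewrite divr_gt0// divr_gt0.
  exists (Num.min (1 / (2 * M + 1)) (eps / 2 / ((M * M + 1) / beta * (M + 1)))).
  set eta := Num.min _ _.
  have h1 : eta <= 1 / (2 * M + 1) by rewrite ge_min lexx.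
  have h2 : eta <= eps / 2 / ((M * M + 1) / beta * (M + 1)) by rewrite ge_min lexx orbT.
  have h3 : 0 < eta by rewrite lt_min p1 p3.
  split => //.
    by move: h1; rewrite ler_pdivlMr//; move: h3; clear; nra.
  move: h2; rewrite ler_pdivlMr// => h2; apply: le_trans h2.
  rewrite (_ : eta * _ = (M * M + 1) / beta * ((M + 1) * eta)); last by ring.
  rewrite ler_wpM2r//.
    by rewrite mulr_ge0// ltW.
  by rewrite ler_wpM2r ?invr_ge0 ?(ltW bpos)// lerDl.
pose e : R := eps / (2 * (c0 + 1)).
have c10 : 0 < 2 * (c0 + 1) by rewrite mulr_gt0.
have e0 : 0 < e by rewrite divr_gt0.
have ec : e * c0 <= eps / 2.
  have : e * (2 * (c0 + 1)) = eps by rewrite divfK// gt_eqF.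
  by move: e0; clear; nra.
clearbody e.
have [alpha [a0 ab ac]] : exists alpha : R, [/\ 0 < alpha, alpha <= beta & 4 * D * (c0 + 1) * alpha <= eta].
  have p0 : 0 < 4 * D * (c0 + 1) by rewrite !mulr_gt0.
  have p1 : 0 < eta / (4 * D * (c0 + 1)) by rewrite divr_gt0.
  exists (Num.min beta (eta / (4 * D * (c0 + 1)))).
  have h1 : Num.min beta (eta / (4 * D * (c0 + 1))) <= eta / (4 * D * (c0 + 1)) by rewrite ge_min lexx orbT.
  split; first by rewrite lt_min bpos p1.
    by rewrite ge_min lexx.
  by rewrite mulrC -ler_pdivlMr.
have [tau [tau0 taud taueta tau8]] : exists tau : R, [/\ 0 < tau, tau <= delta, M * tau <= eta / 2 & M * tau <= 1 / 8].
  have p1 : 0 < eta / 2 / (M + 1) by rewrite !divr_gt0.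
  have p2 : 0 < 1 / 8 / (M + 1) by rewrite !divr_gt0.
  exists (Num.min delta (Num.min (eta / 2 / (M + 1)) (1 / 8 / (M + 1)))).
  set tau := Num.min _ _.
  have h0 : 0 < tau by rewrite !lt_min delta0 p1 p2.
  have h1 : tau <= eta / 2 / (M + 1) by rewrite !ge_min lexx orbT.
  have h2 : tau <= 1 / 8 / (M + 1) by rewrite !ge_min lexx !orbT.
  split => //; first by rewrite ge_min lexx.
    by move: h0 h1; rewrite ler_pdivlMr//; clear; nra.
  by move: h0 h2; rewrite ler_pdivlMr//; clear; nra.
have [r0 r00 Htail] := rho_tail mrho rho0 rho1 tau0.
pose r := r0 + 2 * beta.
have [h [hpos ha he]] : exists h : R, [/\ 0 < h, h <= alpha / 2 & 8 * D * h <= e * alpha].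
  have p1 : 0 < e * alpha / (8 * D) by rewrite divr_gt0 ?mulr_gt0.
  exists (Num.min (alpha / 2) (e * alpha / (8 * D))).
  have h1 : Num.min (alpha / 2) (e * alpha / (8 * D)) <= e * alpha / (8 * D) by rewrite ge_min lexx orbT.
  split; first by rewrite lt_min p1 divr_gt0.
    by rewrite ge_min lexx.
  by rewrite mulrC -ler_pdivlMr// mulr_gt0.
have rpos : 0 < r by rewrite addr_gt0 ?mulr_gt0.
have [K [theta [sth sumth bth cell]]] := @smooth_partition R d h r hpos rpos.
have Htail_r : (\int[mu1]_(x in [set x | (r <= `|x|)%R]) (rho x)%:E <= tau%:E)%E.
  by apply: le_trans Htail; apply: (rho_tail_mono mrho rho0); rewrite lerDl mulr_ge0 ?ltW.
have bad_a : \sum_(t : {ffun 'I_N -> K} | ~~ good theta h alpha t) plan_weight theta P t <= eta.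
  apply: (le_trans (bad_weight mrho rho0 rho1 d0 hP Pc sth sumth cell a0 ha Htail_r)).
  by rewrite DE ME; move: taueta ac c00 a0 dR; clear; nra.
have hb : h <= beta / 2 by move: ha ab; clear; lra.
have bad_b : \sum_(t : {ffun 'I_N -> K} | ~~ good theta h beta t) plan_weight theta P t <= 1 / 4.
  apply: (le_trans (bad_weight mrho rho0 rho1 d0 hP Pc sth sumth cell bpos hb Htail_r)).
  by rewrite DE ME; move: tau8 bc c00 bpos dR; clear; nra.
have near a : \sum_(k | ~~ cellsep theta beta a k) cell_mass rho theta k <= 2 * delta.
  apply: (near_mass mrho rho0 rho1 sth sumth cell _ bpos hb).
    by move=> x; apply: Hball.
  rewrite /r addrK; apply: le_trans Htail _; rewrite lee_fin; exact: taud.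
have MM : M * M * (2 * delta) <= 1 / 4.
  by rewrite /delta mulrA mul1r ler_pdivrMr ?mulr_gt0//; move: M0; clear; nra.
have hal : h <= alpha by move: ha a0; clear; lra.
have [w' [w'0 w'm w'S w'c]] : exists w' : {ffun 'I_N -> K} -> R, [/\ forall t, 0 <= w' t,
    forall i a, marginal w' i a = cell_mass rho theta a,
    forall t, w' t != 0 -> separated (cellsep theta alpha) t &
    (\sum_t (w' t / \prod_i cell_mass rho theta (t i))%:E * cell_cost rho theta t <=
      ((1 + e) * c0 + N%:R * N%:R / beta * ((N%:R + 1) * eta))%:E)%E].
  apply: (rearranged_cost mrho rho0 rho1 hP Pc sth sumth e0 a0 ab (ltW hpos) hal _ bad_a bad_b near).
  - by rewrite DE.
  - by rewrite ME.
  - by rewrite ME.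
have w'c' : (\sum_t (w' t / \prod_i cell_mass rho theta (t i))%:E * cell_cost rho theta t <= (c0 + eps)%:E)%E.
  apply: le_trans w'c _; rewrite lee_fin ME; move: ec etaeps; clear; lra.
have [c [cc0 cs cm cS ccost]] := symmetrise mrho rho0 rho1 sth sumth w'0 w'm w'S w'c'.
exists K, theta, alpha, c; split => //.
by split => //; rewrite a0 (le_trans ab).
Qed.

End discrete_plan_thm.

(** * The trial wave function *)

Section bounded_derivatives.
Variables (R : realType) (V : normedModType R).
Implicit Types (f : V -> R) (v x : V).

Lemma derive_sum_smooth (I : Type) (r : seq I) (f : I -> V -> R) v x :
  (forall i, smooth (f i)) ->
  'D_v (fun y => \sum_(i <- r) f i y) x = \sum_(i <- r) 'D_v (f i) x.
Proof.
move=> sf; elim: r => [|i r IH].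
  rewrite big_nil (_ : (fun _ => _) = cst 0) ?derive_cst//.
  by apply/funext => y; rewrite big_nil.
rewrite big_cons -IH (_ : (fun _ => _) = f i \+ (fun y => \sum_(j <- r) f j y)); last first.
  by apply/funext => y; rewrite big_cons.
rewrite deriveD//; first exact: (@smooth_derivable R V _ _ _ (sf i)).
exact: (@smooth_derivable R V _ _ _ (smooth_sum _ _ sf)).
Qed.

Lemma smooth_sqr f : smooth f -> smooth (fun x => f x ^+ 2).
Proof. by move=> sf; exact: (smooth_mul sf sf). Qed.

Lemma derive_sqr_smooth f v x : smooth f -> 'D_v (fun y => f y ^+ 2) x = 2 * f x * 'D_v f x.
Proof.
move=> sf; rewrite (_ : (fun _ => _) = f \* f)//.
rewrite deriveM; try exact: (@smooth_derivable R V _ _ _ sf).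
by rewrite /GRing.scale/=; ring.
Qed.

Lemma sqrt_sum_sqr_ge (I : finType) (f : I -> R) i : `|f i| <= Num.sqrt (\sum_j f j ^+ 2).
Proof.
rewrite -sqrtr_sqr ler_wsqrtr// (bigD1 i)//= lerDl.
by apply: sumr_ge0 => j _; exact: sqr_ge0.
Qed.

Lemma derive_sum_sqr_le (I : finType) (f : I -> V -> R) v :
  (forall i, smooth (f i)) -> (forall i, exists C, forall x, `|'D_v (f i) x| <= C) ->
  exists C, forall x, `|'D_v (fun y => \sum_i f i y ^+ 2) x| <=
    C * Num.sqrt (\sum_i f i x ^+ 2).
Proof.
move=> sf /choice[C Cf]; exists (\sum_i 2 * C i) => x.
rewrite derive_sum_smooth => [|i]; last exact: smooth_sqr.
apply: (le_trans (ler_norm_sum _ _ _)); rewrite mulr_suml; apply: ler_sum => i _.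
rewrite derive_sqr_smooth// !normrM normr_nat mulrAC.
apply: ler_pM => //; last exact: (sqrt_sum_sqr_ge (fun i => f i x)).
by rewrite ler_wpM2l.
Qed.

Definition tame v f := smooth f /\ exists C, forall x, `|f x| <= C /\ `|'D_v f x| <= C.

Lemma tame_cst v c : tame v (cst c).
Proof.
split; first exact: smooth_cst.
by exists `|c| => x; rewrite derive_cst normr0.
Qed.

Lemma tame_mul v f g : tame v f -> tame v g -> tame v (f \* g).
Proof.
move=> [sf [A fA]] [sg [B gB]]; split; first exact: smooth_mul.
exists (A * B + A * B) => x; have [f0 df] := fA x; have [g0 dg] := gB x.
have A0 : 0 <= A by apply: le_trans f0.
have B0 : 0 <= B by apply: le_trans g0.
split; first by rewrite /= normrM; apply: (le_trans (ler_pM _ _ f0 g0)); rewrite // lerDl mulr_ge0.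
rewrite deriveM; [|exact: (@smooth_derivable R V _ _ _ sf)|exact: (@smooth_derivable R V _ _ _ sg)].
rewrite /GRing.scale/=; apply: (le_trans (ler_normD _ _)); rewrite !normrM.
by apply: lerD; [|rewrite [leRHS]mulrC]; apply: ler_pM.
Qed.

Lemma tame_prod v (I : Type) (r : seq I) (f : I -> V -> R) :
  (forall i, tame v (f i)) -> tame v (fun x => \prod_(i <- r) f i x).
Proof.
move=> tf; elim: r => [|i r IH].
  by under eq_fun do rewrite big_nil; exact: tame_cst.
by under eq_fun do rewrite big_cons; exact: tame_mul.
Qed.

End bounded_derivatives.

Lemma row_continuous (R : realType) m n (i : 'I_m) : continuous (fun x : 'M[R]_(m, n) => row i x).
Proof.
by apply: continuous_mxP => k l; under eq_fun do rewrite mxE; exact: coord_continuous.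
Qed.

Lemma tame_row (R : realType) m n (i : 'I_m) (v : 'M[R]_(m, n)) (f : 'rV[R]_n -> R) :
  tame (row i v) f -> tame v (fun x => f (row i x)).
Proof.
move=> [sf [C fC]].
have aff (t : R) (w x : 'M[R]_(m, n)) : row i (t *: w + x) = t *: row i w + row i x.
  by rewrite linearP.
split; first exact: (@smooth_comp_affine R _ _ _ _ f (@row_continuous R m n i) aff sf).
exists C => x; split; first by case: (fC (row i x)).
rewrite (@derive_comp_affine R _ _ _ _ f v x aff); by case: (fC (row i x)).
Qed.

Section trial_wave_function.
Context {R : realType} {d n : nat}.
Local Notation N := n.+1.
Local Notation mu1 := (lebesgue_mx R 1 d).
Local Notation mu := (lebesgue_mx R N d).
Variables (rho : 'rV[R]_d -> R) (K : finType) (theta : K -> 'rV[R]_d -> R).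
Variables (alpha q : R) (c : {ffun 'I_N -> K} -> R).
Variable D : bool -> spins N -> 'M[R]_(N, d) -> R.
Local Notation T := {ffun 'I_N -> K}.
Hypothesis d0 : (0 < d)%N.
Hypothesis mrho : measurable_fun setT rho.
Hypothesis rho0 : forall x, 0 <= rho x.
Hypothesis rho1 : (\int[mu1]_x (rho x)%:E = 1)%E.
Hypothesis rhoH1 : H1 (fun x => Num.sqrt (rho x)).
Hypothesis stheta : forall k, smooth (theta k).
Hypothesis sumtheta : forall x, \sum_k theta k x ^+ 2 = 1.
Hypothesis dtheta : forall k v, exists C, forall x, `|'D_v (theta k) x| <= C.
Hypothesis c0 : forall t, 0 <= c t.
Hypothesis c_sym : forall (s : 'S_N) (t : T), c [ffun i => t (s i)] = c t.
Hypothesis c_sep : forall t, c t != 0 -> separated (cellsep theta alpha) t.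
Hypothesis c_marginal : forall i a, \sum_(t : T | t i == a)
  c t * \prod_j cell_mass rho theta (t j) = cell_mass rho theta a.
Hypothesis sD : forall b a, smooth (D b a).
Hypothesis dD : forall b a v, exists C, forall x, `|'D_v (D b a) x| <= C.
Hypothesis D_anti : forall b (a : spins N) (s : 'S_N) x,
  D b [ffun i => a (s i)] (row_perm s x) = (-1) ^+ s * D b a x.
Hypothesis q0 : 0 < q.
Hypothesis D_sep : forall x, (forall i j : 'I_N, i != j -> alpha <= `|row i x - row j x|) ->
  q <= \sum_(p : bool * spins N) D p.1 p.2 x ^+ 2.

Definition slater_norm (x : 'M[R]_(N, d)) : R := \sum_(p : bool * spins N) D p.1 p.2 x ^+ 2.
Local Notation Q := slater_norm.

Definition correlation (x : 'M[R]_(N, d)) : R :=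
  \sum_(t : T) (Num.sqrt (c t) * \prod_i theta (t i) (row i x)) ^+ 2.
Local Notation G := correlation.

(* Where slater_norm vanishes, so does correlation, and x / 0 = 0 is harmless. *)
Definition amplitude (b : bool) (a : spins N) (x : 'M[R]_(N, d)) : R :=
  prod_rows (fun y => Num.sqrt (rho y)) x * (D b a x * (Num.sqrt (G x) / Num.sqrt (Q x))).

Definition trial_wave : wavefun R d N :=
  fun x a => Complex (amplitude false a x) (amplitude true a x).

Let theta_le1 k x : `|theta k x| <= 1.
Proof.
by rewrite -(@ler_pXn2r _ 2)// ?nnegrE// expr1n real_normK ?num_real//; exact: cell_le1.
Qed.

Let tame_factor (t : T) v :
  tame v (fun x : 'M[R]_(N, d) => Num.sqrt (c t) * \prod_i theta (t i) (row i x)).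
Proof.
apply: (tame_mul (f := cst (Num.sqrt (c t)))); first exact: tame_cst.
apply: tame_prod => i; apply: tame_row; split; first exact: stheta.
have [C hC] := dtheta (t i) (row i v); exists (1 + `|C|) => x; split.
  by apply: (le_trans (theta_le1 _ _)); rewrite lerDl.
by apply: (le_trans (hC x)); apply: (le_trans (ler_norm C)); rewrite lerDr.
Qed.

Let G_ge0 x : 0 <= G x.
Proof. by apply: sumr_ge0 => t _; exact: sqr_ge0. Qed.

Let Q_ge0 x : 0 <= Q x.
Proof. by apply: sumr_ge0 => t _; exact: sqr_ge0. Qed.

Lemma correlationE x : G x = \sum_(t : T) c t * cell_prod theta t x.
Proof.
by apply: eq_bigr => t _; rewrite exprMn sqr_sqrtr// /cell_prod prodrXl.
Qed.

Let G_le x : G x <= \sum_t c t.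
Proof.
rewrite correlationE; apply: ler_sum => t _; rewrite ler_piMr//.
by rewrite cell_prod_le1.
Qed.

Let sumc0 : 0 <= \sum_t c t. Proof. exact: sumr_ge0. Qed.

Let GQ x : G x <= (\sum_t c t) / q * Q x.
Proof.
have [Gx|Gx] := eqVneq (G x) 0.
  by rewrite Gx mulr_ge0// divr_ge0// ltW.
have [t ct xt] : exists2 t, c t != 0 & cell_prod theta t x != 0.
  apply: contrapT => H; move/eqP: Gx; apply; rewrite correlationE.
  apply: big1 => t _; have [->|ct] := eqVneq (c t) 0; first by rewrite mul0r.
  have [->|xt] := eqVneq (cell_prod theta t x) 0; first by rewrite mulr0.
  by case: H; exists t.
have qQ : q <= Q x.
  apply: D_sep => i j ij.
  have /separatedP/(_ i j ij)/asboolP := c_sep ct.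
  by apply; exact: (cell_prod_neq0 xt).
apply: (le_trans (G_le x)); rewrite mulrAC ler_pdivlMr// ler_wpM2l//.
Qed.

Lemma amplitude_weak_derivative b a (v : 'M[R]_(N, d)) f' :
  is_weak_derivative v (prod_rows (fun y => Num.sqrt (rho y))) f' ->
  amplitude b a \in Lfun mu 2%:E /\ exists g, is_weak_derivative v (amplitude b a) g.
Proof.
move=> wf'.
have [A hA] := dD b a v.
have [B hB] := derive_sum_sqr_le (fun t => (tame_factor t v).1)
  (fun t => let: conj _ (ex_intro C hC) := tame_factor t v in
    ex_intro _ C (fun x => (hC x).2)).
have [E hE] := @derive_sum_sqr_le R _ _ (fun p : bool * spins N => D p.1 p.2) v
  (fun p => sD p.1 p.2) (fun p => dD p.1 p.2 v).
pose M := 1 + \sum_t c t + (\sum_t c t) / q + `|A| + `|B| + `|E|.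
have sq0 : 0 <= (\sum_t c t) / q by rewrite divr_ge0// ltW.
have [M1 M3 M4 [M2 M5 M6]] : [/\ 1 <= M, (\sum_t c t) / q <= M, A <= M &
    [/\ \sum_t c t <= M, B <= M & E <= M]].
  rewrite /M; move: sumc0 sq0; set u := _ / q; move: (\sum_t c t) u => w u w0 u0.
  have := ler_norm A; have := ler_norm B; have := ler_norm E.
  have := normr_ge0 A; have := normr_ge0 B; have := normr_ge0 E.
  by move: `|A| `|B| `|E| => A' B' E' *; do !split; lra.
apply: (@weak_derivative_mul_amplitude R N d (D b a) G Q M M1 (sD b a) _ _ _ Q_ge0 _ _ v
  _ _ _ _ f' _ wf').
- by apply: smooth_sum => t; apply: smooth_sqr; exact: (tame_factor t 0).1.
- by apply: smooth_sum => p; exact: smooth_sqr.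
- by move=> x; rewrite G_ge0 (le_trans (G_le x)).
- by move=> x; apply: (le_trans (GQ x)); rewrite ler_wpM2r.
- by move=> x; exact: (sqrt_sum_sqr_ge (fun p : bool * spins N => D p.1 p.2 x) (b, a)).
- by move=> x; exact: le_trans (hA x) _.
- by move=> x; apply: (le_trans (hB x)); rewrite ler_wpM2r// sqrtr_ge0.
- by move=> x; apply: (le_trans (hE x)); rewrite ler_wpM2r// sqrtr_ge0.
- exact: (prod_rows_H1 n.+1 rhoH1).1.
Qed.

Lemma amplitude_H1 b a : H1 (amplitude b a).
Proof.
have [_ wd] := prod_rows_H1 N rhoH1.
split; first by have [f' /(amplitude_weak_derivative b a)[]] := wd ord0 (Ordinal d0).
by move=> i j; have [f' /(amplitude_weak_derivative b a)[]] := wd i j.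
Qed.

Lemma trial_wave_H1 : wave_H1 trial_wave.
Proof. by move=> a; split; exact: amplitude_H1. Qed.

Lemma trial_sum_sqmod x : sum_sqmod trial_wave x =
  \sum_(t : T) c t * \prod_i (rho (row i x) * theta (t i) (row i x) ^+ 2).
Proof.
transitivity (prod_rows (fun y => Num.sqrt (rho y)) x ^+ 2 * G x).
  have -> : sum_sqmod trial_wave x = prod_rows (fun y => Num.sqrt (rho y)) x ^+ 2 *
      (Num.sqrt (G x) / Num.sqrt (Q x)) ^+ 2 * Q x.
    have QE : Q x = \sum_(a : spins N) \sum_(b : bool) D b a x ^+ 2.
      by rewrite /slater_norm -(pair_bigA _ (fun b a => D b a x ^+ 2))/= exchange_big.
    rewrite [X in _ = _ * X]QE mulr_sumr; apply: eq_bigr => a _.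
    rewrite big_bool /sqmod /= /amplitude /=.
    move: (prod_rows _ x) (Num.sqrt (G x) / _) (D true a x) (D false a x) => S r D1 D0; ring.
  rewrite -mulrA exprMn exprVn !sqr_sqrtr//.
  have [Qx|Qx] := eqVneq (Q x) 0; last by rewrite divfK.
  have Gx : G x = 0 by apply/eqP; rewrite eq_le G_ge0 andbT; have := GQ x; rewrite Qx mulr0.
  by rewrite Qx Gx !mulr0.
rewrite correlationE mulr_sumr; apply: eq_bigr => t _.
rewrite mulrCA; congr (_ * _); rewrite /cell_prod /prod_rows -prodrXl -big_split/=.
by apply: eq_bigr => i _; rewrite sqr_sqrtr.
Qed.

Let reorder_bij (A : finType) (s : 'S_N) :
  bijective (fun t : {ffun 'I_N -> A} => [ffun i => t (s i)]).
Proof.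
by exists (fun t : {ffun 'I_N -> A} => [ffun i => t (s^-1%g i)]) => t;
  apply/ffunP => i; rewrite !ffunE ?permKV ?permK.
Qed.

Lemma trial_wave_antisymmetric (s : 'S_N) (a : spins N) x :
  trial_wave (row_perm s x) [ffun i => a (s i)] = (-1) ^+ s * trial_wave x a.
Proof.
have row_s i : row i (row_perm s x) = row (s i) x by apply/rowP => k; rewrite !mxE.
have GE : G (row_perm s x) = G x.
  rewrite !correlationE (reindex (fun t : T => [ffun i => t (s i)])); last first.
    exact/onW_bij/reorder_bij.
  apply: eq_bigr => t _; rewrite c_sym; congr (_ * _).
  rewrite /cell_prod [RHS](reindex_inj (@perm_inj _ s))/=.
  by apply: eq_bigr => i _; rewrite ffunE row_s.
have QE : Q (row_perm s x) = Q x.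
  rewrite /slater_norm -!(pair_bigA _ (fun b a => D b a _ ^+ 2))/=; apply: eq_bigr => b _.
  rewrite (reindex (fun t : spins N => [ffun i => t (s i)])); last first.
    exact/onW_bij/reorder_bij.
  by apply: eq_bigr => t _; rewrite D_anti exprMn sqrr_sign mul1r.
have SE : prod_rows (fun y => Num.sqrt (rho y)) (row_perm s x) =
    prod_rows (fun y => Num.sqrt (rho y)) x.
  rewrite /prod_rows [RHS](reindex_inj (@perm_inj _ s))/=.
  by apply: eq_bigr => i _; rewrite row_s.
rewrite /trial_wave /amplitude GE QE SE !D_anti.
case: (odd_perm s) => /=.
  by rewrite expr1 !mulN1r; apply/eqP; rewrite eq_complex /= !(mulNr, mulrN, opprK) !eqxx.
by rewrite expr0 !mul1r.
Qed.

Let m := cell_mass rho theta.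

Let m_ge0 a : 0 <= m a.
Proof. exact: cell_mass_ge0. Qed.

Let mfactor k : measurable_fun setT (fun y : 'rV[R]_d => rho y * theta k y ^+ 2).
Proof. by apply: measurable_funM => //; exact: measurable_cell. Qed.

Let factor_ge0 k (y : 'rV[R]_d) : 0 <= rho y * theta k y ^+ 2.
Proof. by rewrite mulr_ge0// sqr_ge0. Qed.

Let mprod (t : T) :
  measurable_fun setT (fun x : 'M[R]_(N, d) => \prod_i (rho (row i x) * theta (t i) (row i x) ^+ 2)).
Proof.
by apply: measurable_prod => i _; apply: (measurableT_comp (mfactor (t i))); exact: measurable_row.
Qed.

Lemma trial_wave_normalised : int_z (fun x a => (sqmod (trial_wave x a))%:E) = 1%E.
Proof.
rewrite (int_z_sqmod trial_wave_H1).
transitivity (\int[mu]_x \sum_(t : T)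
    ((c t)%:E * (\prod_i (rho (row i x) * theta (t i) (row i x) ^+ 2))%:E))%E.
  by apply: eq_integral => x _; rewrite trial_sum_sqmod -sumEFin.
rewrite ge0_integral_sum//; first last.
- by move=> t x _; rewrite mule_ge0 ?lee_fin// prodr_ge0.
- by move=> t; apply: measurable_funeM; exact/measurable_EFinP.
transitivity (\sum_(t : T) (c t)%:E * (\prod_i m (t i))%:E)%E.
  apply: eq_bigr => t _; rewrite ge0_integralZl//.
  - by rewrite (integral_cells mrho rho0 rho1 stheta sumtheta t).
  - exact/measurable_EFinP.
  - by move=> x _; rewrite lee_fin prodr_ge0.
  - by rewrite lee_fin.
under eq_bigr => t _ do rewrite -EFinM.
rewrite sumEFin (partition_big (fun t : T => t ord0) xpredT)//=.
under eq_bigr => a _ do rewrite c_marginal.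
rewrite -sumEFin; under eq_bigr => a _ do rewrite -(cell_massE mrho rho0 rho1 stheta sumtheta).
rewrite -ge0_integral_sum//; first last.
- by move=> a x _; rewrite lee_fin.
- by move=> a; exact/measurable_EFinP.
rewrite -rho1; apply: eq_integral => x _.
by rewrite sumEFin -mulr_sumr sumtheta mulr1.
Qed.

Lemma trial_wave_fermionic : fermionic trial_wave.
Proof.
split; [exact: trial_wave_H1|exact: trial_wave_normalised|].
by move=> s a; apply: aeW => x; exact: trial_wave_antisymmetric.
Qed.

Lemma trial_wave_Vee : Vee trial_wave = (\sum_t (c t)%:E * cell_cost rho theta t)%E.
Proof.
rewrite (VeeE trial_wave_H1).
transitivity (\int[mu]_x \sum_(t : T) ((c t)%:E *
    (coulomb x * (\prod_i (rho (row i x) * theta (t i) (row i x) ^+ 2))%:E)))%E.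
  apply: eq_integral => x _; rewrite trial_sum_sqmod -sumEFin ge0_sume_distrr//.
    by apply: eq_bigr => t _; rewrite EFinM muleCA.
  by move=> t _; rewrite lee_fin mulr_ge0// prodr_ge0.
rewrite ge0_integral_sum//; first last.
- by move=> t x _; rewrite !mule_ge0 ?lee_fin ?coulomb_ge0// prodr_ge0.
- by move=> t; apply: measurable_funeM; exact: measurable_cost.
apply: eq_bigr => t _; rewrite ge0_integralZl//.
- exact: measurable_cost.
- by move=> x _; rewrite mule_ge0 ?coulomb_ge0// lee_fin prodr_ge0.
- by rewrite lee_fin.
Qed.

Lemma trial_wave_density : has_density trial_wave rho.
Proof.
pose k a := \sum_(t : T | t ord0 == a) c t * \prod_(i < n) m (t (lift ord0 i)).
have km a : m a * k a = m a.
  rewrite -[RHS](c_marginal ord0 a) mulr_sumr; apply: eq_bigr => t /eqP ta.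
  by rewrite big_ord_recl ta mulrCA.
have dens (v : 'rV[R]_d) : density trial_wave v = (\sum_a rho v * theta a v ^+ 2 * k a)%:E.
  rewrite (densityE trial_wave_fermionic).
  transitivity (\int[lebesgue_mx R n d]_y \sum_(t : T)
      ((c t * (rho v * theta (t ord0) v ^+ 2))%:E *
       (\prod_(i < n) (rho (row i y) * theta (t (lift ord0 i)) (row i y) ^+ 2))%:E))%E.
    apply: eq_integral => y _; rewrite trial_sum_sqmod -sumEFin; apply: eq_bigr => t _.
    rewrite big_ord_recl col_mx_row0 mulrA EFinM; congr (_ * (_ %:E))%E.
    by apply: eq_bigr => i _; rewrite col_mx_rowS.
  have mp (t : T) : measurable_fun setT (fun y : 'M[R]_(n, d) =>
      (\prod_(i < n) (rho (row i y) * theta (t (lift ord0 i)) (row i y) ^+ 2))%:E).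
    apply/measurable_EFinP; apply: measurable_prod => i _.
    by apply: (measurableT_comp (mfactor _)); exact: measurable_row.
  rewrite ge0_integral_sum//; first last.
  - by move=> t y _; rewrite mule_ge0// lee_fin ?prodr_ge0// mulr_ge0.
  - by move=> t; apply: measurable_funeM.
  transitivity (\sum_(t : T) (c t * (rho v * theta (t ord0) v ^+ 2))%:E *
      (\prod_(i < n) m (t (lift ord0 i)))%:E)%E.
    apply: eq_bigr => t _; rewrite ge0_integralZl//.
    - by rewrite (integral_cells mrho rho0 rho1 stheta sumtheta (fun i => t (lift ord0 i))).
    - by move=> y _; rewrite lee_fin prodr_ge0.
    - by rewrite lee_fin mulr_ge0.
  under eq_bigr => t _ do rewrite -EFinM.
  rewrite sumEFin (partition_big (fun t : T => t ord0) xpredT)//=; congr (_%:E).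
  apply: eq_bigr => a _; rewrite /k mulr_sumr; apply: eq_bigr => t /eqP <-; ring.
have null a : m a = 0 -> {ae mu1, forall v, rho v * theta a v ^+ 2 = 0}.
  move=> ma; have := cell_massE mrho rho0 rho1 stheta sumtheta a.
  rewrite -/m ma => H.
  have : (\int[mu1]_v `|(rho v * theta a v ^+ 2)%:E| = 0)%E.
    rewrite -[RHS]H; apply: eq_integral => v _; by rewrite gee0_abs// lee_fin.
  have mE : measurable_fun setT (fun v => (rho v * theta a v ^+ 2)%:E).
    by apply/measurable_EFinP; exact: mfactor.
  move=> /(ae_eq_integral_abs mu1 measurableT mE).
  by apply: filterS => v /(_ I) [].
have nullT : {ae mu1, forall v, forall a, m a = 0 -> rho v * theta a v ^+ 2 = 0}.
  apply: filter_forall => a.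
  have [ma|/eqP ma] := eqVneq (m a) 0; last by apply: aeW => v.
  by apply: filterS (null a ma).
apply: filterS nullT => v Hv; rewrite dens; congr (_%:E).
transitivity (\sum_a rho v * theta a v ^+ 2); last by rewrite -mulr_sumr sumtheta mulr1.
apply: eq_bigr => a _; have [ma|ma] := eqVneq (m a) 0; first by rewrite Hv// mul0r.
have -> : k a = 1 by apply: (mulfI ma); rewrite km mulr1.
by rewrite mulr1.
Qed.

End trial_wave_function.

(** * Slater determinants *)

Section slater_determinants.
Variable R : realType.

Lemma det2E (F : nat -> nat -> R) :
  \det (\matrix_(i < 2, j < 2) F i j) = F 0 0 * F 1 1 - F 0 1 * F 1 0.
Proof.
rewrite (expand_det_row _ ord0) !big_ord_recl big_ord0 /cofactor !det_mx11 !mxE /=.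
by rewrite /bump /=; ring.
Qed.

Lemma det3E (F : nat -> nat -> R) :
  \det (\matrix_(i < 3, j < 3) F i j) =
    F 0 0 * (F 1 1 * F 2 2 - F 1 2 * F 2 1) - F 0 1 * (F 1 0 * F 2 2 - F 1 2 * F 2 0)
    + F 0 2 * (F 1 0 * F 2 1 - F 1 1 * F 2 0).
Proof.
rewrite (expand_det_row _ ord0) !big_ord_recl big_ord0 /cofactor.
have minor (j : 'I_3) : row' ord0 (col' j (\matrix_(i < 3, j < 3) F i j)) =
    \matrix_(i < 2, k < 2) F (bump 0 i) (bump j k).
  by apply/matrixP => i k; rewrite !mxE.
rewrite !minor !(det2E (fun i k => F (bump 0 i) (bump _ k))) !mxE /= /bump /=.
ring.
Qed.

Section family.
Variables (d N : nat) (alpha q : R).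

Definition slater_family (D : bool -> spins N -> 'M[R]_(N, d) -> R) :=
  [/\ forall b a, smooth (D b a),
      forall b a v, exists C, forall x, `|'D_v (D b a) x| <= C,
      forall b (a : spins N) (s : 'S_N) x,
        D b [ffun i => a (s i)] (row_perm s x) = (-1) ^+ s * D b a x &
      forall x, (forall i j : 'I_N, i != j -> alpha <= `|row i x - row j x|) ->
        q <= \sum_(p : bool * spins N) D p.1 p.2 x ^+ 2].

End family.

Lemma det_col_perm n (s : 'S_n) (A : 'M[R]_n) : \det (col_perm s A) = (-1) ^+ s * \det A.
Proof. by rewrite col_permE det_mulmx det_perm odd_permV mulrC. Qed.

Lemma slater_family2 d (alpha : R) : exists D, @slater_family d 2 alpha 1 D.
Proof.
pose E (a : spins 2) (i j : 'I_2) : R := if i == 0 :> nat then (a j : nat)%:R else 1.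
exists (fun b a _ => if b then 0 else \det (\matrix_(i, j) E a i j)); split.
- by move=> b a; exact: smooth_cst.
- by move=> b a v; exists 0 => x; rewrite derive_cst normr0.
- move=> [] a s x; first by rewrite mulr0.
  rewrite -det_col_perm; congr (\det _); apply/matrixP => i j; rewrite !mxE /E ffunE.
  by [].
move=> x _; pose a : spins 2 := [ffun j : 'I_2 => if j == 0 :> nat then 1 else 0].
rewrite (bigD1 (false, a))//= (_ : \det _ = 1).
  by rewrite expr1n lerDl; apply: sumr_ge0 => p _; exact: sqr_ge0.
transitivity (\det (\matrix_(i < 2, j < 2) (if i == 0 :> nat then (j == 0 :> nat)%:R else 1 : R))).
  by congr (\det _); apply/matrixP => i j; rewrite !mxE /E ffunE; case: ifP => //; case: ifP.
by rewrite (det2E (fun i j => if i == 0 then (j == 0)%:R else 1))/=; ring.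
Qed.

Definition coordinate d m (x : 'M[R]_(m, d)) (j : 'I_m) (k : nat) : R :=
  if insub k is Some l then x j l else 0.

Lemma slater_family3 d (alpha : R) : (d <= 4)%N -> 0 < alpha ->
  exists D, @slater_family d 3 alpha (alpha ^+ 2) D.
Proof.
move=> d4 alpha0.
pose E (a : spins 3) (k : nat) (x : 'M[R]_(3, d)) (i j : 'I_3) : R :=
  if i == 0 :> nat then (a j : nat)%:R else
  if i == 1 :> nat then coordinate x j k else 1.
(* One spin up selects the coordinates 0 and 1, two spins up the coordinates 2
   and 3, for the real and the imaginary part; this is where d <= 4 is used. *)
pose kb (b : bool) (a : spins 3) : nat := (b + (\sum_j (a j : nat)).-1.*2)%N.
pose D (b : bool) (a : spins 3) (x : 'M[R]_(3, d)) := \det (\matrix_(i, j) E a (kb b a) x i j).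
have sE a k i j : smooth (fun x => E a k x i j).
  rewrite /E; case: (i == 0 :> nat); first exact: smooth_cst.
  case: (i == 1 :> nat); last exact: smooth_cst.
  by rewrite /coordinate; case: insub => [l|]; [exact: smooth_coord|exact: smooth_cst].
have Dlin b a (t : R) (w x : 'M[R]_(3, d)) : D b a (t *: w + x) = t *: D b a w + D b a x.
  rewrite /D -[X in _ = _ + X]mul1r /GRing.scale/=.
  apply: (@determinant_multilinear R _ _ _ _ (@Ordinal 3 1 isT)).
  - apply/rowP => j; rewrite !mxE /E /= /coordinate.
    by case: insubP => [l _ _|_]; rewrite ?mxE ?mulr0 ?addr0// mul1r.
  - by apply/matrixP => i j; rewrite !mxE /E; case: ifP => //; case: ifP => // /eqP; case: i => -[|[|[]]].
  - by apply/matrixP => i j; rewrite !mxE /E; case: ifP => //; case: ifP => // /eqP; case: i => -[|[|[]]].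
exists D; split.
- move=> b a; rewrite /D /determinant; apply: smooth_sum => s.
  apply: (smooth_mul (f := cst ((-1) ^+ s))); first exact: smooth_cst.
  by apply: smooth_prod => i; under eq_fun do rewrite mxE; exact: sE.
- move=> b a v; exists `|D b a v| => x.
  rewrite (_ : D b a = (@id R) \o D b a)// (@derive_comp_affine R _ _ _ _ _ v x (Dlin b a)).
  by rewrite derive_id.
- move=> b a s x; rewrite -det_col_perm /D.
  have -> : kb b [ffun i => a (s i)] = kb b a.
    rewrite /kb; congr (_ + _.-1.*2)%N; rewrite [RHS](reindex_inj (@perm_inj _ s))/=.
    by apply: eq_bigr => i _; rewrite ffunE.
  congr (\det _); apply/matrixP => i j; rewrite !mxE /E ffunE /coordinate.
  by case: insubP => [l _ _|_]; rewrite ?mxE.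
move=> x xs.
have [k xk] : exists k : 'I_d, alpha <= `|x ord0 k - x (@Ordinal 3 1 isT) k|.
  apply: contrapT => H; have := xs ord0 (@Ordinal 3 1 isT) isT.
  rewrite leNgt => /negP; apply; apply/mx_norm_lt => // i l.
  by rewrite !mxE ltNge; apply/negP => Hl; apply: H; exists l.
have key b a : D b a x = x ord0 k - x (@Ordinal 3 1 isT) k \/
    D b a x = - (x ord0 k - x (@Ordinal 3 1 isT) k) ->
    alpha ^+ 2 <= \sum_(p : bool * spins 3) D p.1 p.2 x ^+ 2.
  move=> Dx; apply: (@le_trans _ _ (D b a x ^+ 2)).
    rewrite -(real_normK (num_real (D b a x))) lerXn2r ?nnegrE// ?(ltW alpha0)//.
    by case: Dx => ->; rewrite ?normrN.
  rewrite (bigD1 (b, a))//= lerDl; apply: sumr_ge0 => p _; exact: sqr_ge0.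
have DE b a : kb b a = k -> forall a' : nat -> nat, (forall j : 'I_3, a j = a' j :> nat) ->
   D b a x = (a' 0)%:R * (x (inord 1) k - x (inord 2) k) -
     (a' 1)%:R * (x (inord 0) k - x (inord 2) k) + (a' 2)%:R * (x (inord 0) k - x (inord 1) k).
  move=> kE a' aa'.
  transitivity (\det (\matrix_(i < 3, j < 3) (if i == 0 :> nat then (a' j)%:R else
     if i == 1 :> nat then x (inord j) k else 1 : R))).
    rewrite /D; congr (\det _); apply/matrixP => i j; rewrite !mxE /E aa' kE inord_val.
    by rewrite /coordinate valK.
  rewrite (det3E (fun i j => if i == 0 then (a' j)%:R else if i == 1 then x (inord j) k else 1))/=.
  ring.
have i0 : inord 0 = ord0 :> 'I_3 by apply/val_inj; rewrite /= inordK.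
have i1 : inord 1 = @Ordinal 3 1 isT :> 'I_3 by apply/val_inj; rewrite /= inordK.
have k4 : (k < 4)%N by apply: leq_trans d4.
have [k2|k2] := ltnP k 2.
  pose a : spins 3 := [ffun j : 'I_3 => if j == 2 :> nat then 1 else 0].
  have kE : kb (odd k) a = k.
    rewrite /kb !big_ord_recl big_ord0 !ffunE /=.
    by case: (nat_of_ord k) k2 => [|[]].
  apply: (key (odd k) a); left.
  rewrite (DE _ _ kE (fun j => (j == 2) : nat)).
    by rewrite i0 i1 /=; ring.
  by move=> j; rewrite ffunE; case: ifP.
pose a : spins 3 := [ffun j : 'I_3 => if j == 2 :> nat then 0 else 1].
have kE : kb (odd k) a = k.
  rewrite /kb !big_ord_recl big_ord0 !ffunE /=.
  by case: (nat_of_ord k) k2 k4 => [|[|[|[|]]]].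
apply: (key (odd k) a); right.
rewrite (DE _ _ kE (fun j => (j != 2) : nat)).
  by rewrite i0 i1 /=; ring.
by move=> j; rewrite ffunE; case: ifP.
Qed.

End slater_determinants.

(** * The limit *)

Lemma int_z_sqgrad_fin_num (R : realType) d N (psi : wavefun R d N) : wave_H1 psi ->
  int_z (fun x a => (sqgrad psi x a)%:E) \is a fin_num.
Proof.
move=> hpsi.
have L2wd (f : 'M[R]_(N, d) -> R) i k : H1 f ->
    (lebesgue_mx R N d).-integrable setT (EFin \o (fun x => weak_derivative (delta_mx i k) f x ^+ 2)).
  move=> [_ /(_ i k)/(xgetPex (cst 0))[wL2 _]].
  exact: (L2_mul_integrable wL2 wL2).
rewrite /int_z; apply/sum_fin_numP => a _ _; apply: integrable_fin_num => //.
have [hr hi] := hpsi a.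
rewrite (_ : (fun x => _) = (fun x => \sum_(i < N) \sum_(k < d)
   (((weak_derivative (delta_mx i k) (re_part psi a) x ^+ 2)%R)%:E +
    ((weak_derivative (delta_mx i k) (im_part psi a) x ^+ 2)%R)%:E))%E).
  apply: integrable_sum => // i _; apply: integrable_sum => // k _.
  by apply: integrableD => //; exact: L2wd.
apply/funext => x; rewrite /sqgrad -sumEFin; apply: eq_bigr => i _.
by rewrite -sumEFin; apply: eq_bigr => k _; rewrite EFinD.
Qed.

Lemma density_measurable (R : realType) d (rho : 'rV[R]_d -> R) : densities rho ->
  measurable_fun setT rho.
Proof.
move=> [rho0 _ [/L2_measurable ms _]].
rewrite (_ : rho = fun x => Num.sqrt (rho x) ^+ 2); first exact: measurable_funX.
by apply/funext => x; rewrite sqr_sqrtr.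
Qed.

Lemma trial_wave_exists (R : realType) (d n : nat) (rho : 'rV[R]_d -> R)
    (P : probability 'M[R]_(n.+1, d) R) (C eps : R) :
  (1 <= d <= 4)%N -> (2 <= n.+1 <= 3)%N -> densities rho -> plans rho P ->
  (\int[P]_x coulomb x <= C%:E)%E -> 0 < eps ->
  exists psi : wavefun R d n.+1, [/\ fermionic psi, has_density psi rho & (Vee psi <= (C + eps)%:E)%E].
Proof.
move=> /andP[d1 d4] nN hrho hP PC eps0; have mrho := density_measurable hrho.
have [rho0 rho1 rhoH1] := hrho.
have [K [theta [alpha [c [[/andP[a0 _] sth sumth dth] [c0 csym] csep cm cV]]]]] :=
  discrete_plan mrho rho0 rho1 d1 hP PC eps0.
have [q [q0 [D [sD dD aD qD]]]] : exists q, 0 < q /\ exists D, @slater_family R d n.+1 alpha q D.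
  case: n nN {P hP PC c c0 csym csep cm cV} => [|[|[|]]]// _.
    by exists 1; split => //; exact: slater_family2.
  by exists (alpha ^+ 2); split; [exact: exprn_gt0|exact: slater_family3].
exists (trial_wave rho theta c D); split.
- exact: (trial_wave_fermionic d1 mrho rho0 rho1 rhoH1 sth sumth dth c0 csym csep cm sD dD aD q0 qD).
- exact: (trial_wave_density d1 mrho rho0 rho1 rhoH1 sth sumth dth c0 csym csep cm sD dD aD q0 qD).
- rewrite (trial_wave_Vee d1 mrho rho0 rhoH1 sth sumth dth c0 csep sD dD q0 qD).
  exact: cV.
Qed.

Lemma optimal_cost_le_F_A (R : realType) (d n : nat) (rho : 'rV[R]_d -> R) (m hbar : R) :
  densities rho -> 0 < m -> (optimal_cost n.+1 rho <= F_A n.+1 m hbar rho)%E.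
Proof.
move=> hrho m0; apply: le_ereal_inf_tmp => _ [psi [fpsi dpsi] <-].
have [rho0 _ _] := hrho.
exact: (optimal_cost_le (density_measurable hrho) rho0 fpsi dpsi).
Qed.

Theorem theorem1p2 (R : realType) (d N : nat)
    (hd : (1 <= d <= 4)%N) (hN : (2 <= N <= 3)%N)
    (m : R) (hm : 0 < m)
    (rho : 'rV[R]_d -> R) (hrho : densities rho) :
  F_A N m hbar rho @[hbar --> 0^'+] --> optimal_cost N rho.
Proof.
case: N hN => // n hN.
have lower hbar := @optimal_cost_le_F_A R d n rho m hbar hrho hm.
have C0 : (0 <= optimal_cost n.+1 rho)%E.
  apply: le_ereal_inf_tmp => _ [P _ <-]; apply: integral_ge0 => x _; exact: coulomb_ge0.
case E : (optimal_cost n.+1 rho) C0 => [C| |//] C0; last first.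
  rewrite (_ : (fun hbar => _) = cst +oo%E); first exact: cvg_cst.
  by apply/funext => hbar; apply/eqP; rewrite -leye_eq -E.
have upper e : 0 < e -> \forall h \near (0 : R)^'+, (F_A n.+1 m h rho <= (C + e)%:E)%E.
  move=> e0; have e3 : 0 < e / 3 by rewrite divr_gt0.
  have : (optimal_cost n.+1 rho < (C + e / 3)%:E)%E by rewrite E lte_fin ltrDl.
  move=> /ereal_inf_lt[_ [P hP <-] /ltW PC].
  have [psi [fpsi dpsi Vpsi]] := trial_wave_exists hd hN hrho hP PC e3.
  have [hpsi _ _] := fpsi.
  have Tfin := int_z_sqgrad_fin_num hpsi.
  pose T := fine (int_z (fun x a => (sqgrad psi x a)%:E)).
  pose b := 2 * m * (e / 3) / (`|T| + 1).
  have b0 : 0 < b by rewrite divr_gt0 ?mulr_gt0// ltr_wpDl.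
  near=> h.
  have h0 : 0 < h by near: h; exact: nbhs_right_gt.
  have h1 : h <= 1 by near: h; exact: nbhs_right_le.
  have hb : h <= b by near: h; exact: nbhs_right_le.
  apply: (@le_trans _ _ (kinetic m h psi + Vee psi)%E).
    by apply: ereal_inf_lbound; exists psi.
  rewrite (_ : C + e = e / 3 + (C + e / 3 + e / 3)); last by field.
  rewrite EFinD leeD// /kinetic -(fineK Tfin) -/T -EFinM lee_fin.
  have TT := ler_norm T; have T0 := normr_ge0 T.
  rewrite mulrAC ler_pdivrMr ?mulr_gt0//.
  apply: (@le_trans _ _ (h * (`|T| + 1))).
    rewrite expr2 -mulrA ler_wpM2l ?(ltW h0)//.
    apply: (@le_trans _ _ (h * `|T|)); first by rewrite ler_wpM2l// ltW.
    by apply: (@le_trans _ _ (1 * `|T|)); [rewrite ler_wpM2r|rewrite mul1r lerDl].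
  rewrite -ler_pdivlMr; last by rewrite ltr_wpDl.
  by rewrite [e / 3 * _]mulrC.
have fin : \forall h \near (0 : R)^'+, F_A n.+1 m h rho \is a fin_num.
  near=> h; rewrite fin_real//; apply/andP; split.
    by apply: (lt_le_trans _ (lower h)); rewrite E ltNyr.
  have Fh : (F_A n.+1 m h rho <= (C + 1)%:E)%E by near: h; exact: upper.
  exact: (le_lt_trans Fh (ltry _)).
apply/fine_cvgP; split => //; apply/cvgrPdist_le => e e0.
near=> h.
have Ffin : F_A n.+1 m h rho \is a fin_num by near: h.
have Fh : (F_A n.+1 m h rho <= (C + e)%:E)%E by near: h; exact: upper.
have := lower h; move: Fh; rewrite E /= -(fineK Ffin) !lee_fin => Fh Cl.
by rewrite ler0_norm ?subr_le0// opprB lerBlDl.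
Unshelve. all: by end_near. Qed.
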